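(* For every $f\in\mathcal F$ there exists a homogeneously multifractal (HM), strictly monotone increasing, continuous function $Z:[0,1]\to\mathbb R$ satisfying: (i) for all $h\in\mathrm{Support}^*(f)\setminus\{1\}$, $d_Z(h)=\max(f(h),0)$; (ii) $d_Z(h)=-\infty$ for every real $h\ge0$ with $h\notin\mathrm{Support}^*(f)$; (iii) the set $\{x\in[0,1]:h_Z(x)=1\}$ has Lebesgue measure $1$.
   Context: For a locally bounded function $Z$ and $\alpha>0$, $Z\in C^\alpha_{x_0}$ means that there are a polynomial $P$ of degree at most $[\alpha]$ (integer part) and a constant $C>0$ such that $|Z(x)-P(x-x_0)|\le C|x-x_0|^\alpha$ for all $x$ (in the domain of $Z$) in a neighborhood of $x_0$. The pointwise H\''older exponent is $h_Z(x_0)=\sup\{\alpha\ge0: Z\in C^\alpha_{x_0}\}$. Let $\dim$ denote Hausdorff dimension with the convention $\dim\emptyset=-\infty$. The multifractal spectrum of $Z:[0,1]\to\mathbb R$ is $d_Z(h)=\dim\{x\in[0,1]:h_Z(x)=h\}$ for real $h\ge0$. The function $Z$ is homogeneously multifractal (HM) if for every non-degenerate subinterval $U\subset[0,1]$ and every $h\ge0$, $\dim\{x\in U:h_Z(x)=h\}=\dim\{x\in[0,1]:h_Z(x)=h\}=d_Z(h)$. For a function $f$ with values in $[0,1]\cup\{-\infty\}$, $\mathrm{Support}(f)=\{x:f(x)>-\infty\}$. For $f:[0,1]\to[0,1]\cup\{-\infty\}$, $\mathrm{Support}^*(f)$ is the smallest interval of the form $[h,1]$ containing $\mathrm{Support}(f)$.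 The set $\mathcal F$ consists of the functions $f:[0,1]\to[0,1]\cup\{-\infty\}$ for which there is a countable family $(f_n)_{n\ge1}$ of functions $f_n:[0,+\infty]\to[0,1]\cup\{-\infty\}$ such that: for every $n$, $\mathrm{Support}(f_n)$ is a closed, possibly degenerate (one-point), interval $I_n\subset[0,1]$; $\inf_{n\ge1}\min(I_n)>0$; $f_n$ is constant on $I_n$; $f_n(x)\le x$ for every $x\in I_n$; and $f(x)=\sup_{n\ge1}f_n(x)$ for every $x\in[0,1]$ (so $f=-\infty$ off $\bigcup_n I_n$). *)

(* Defs.v *)
From HB Require Import structures.
From mathcomp Require Import all_boot all_order all_algebra.
From mathcomp Require Import all_classical all_reals all_analysis.

Set Implicit Arguments.
Unset Strict Implicit.
Unset Printing Implicit Defensive.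

Import Order.TTheory GRing.Theory Num.Theory.
Import numFieldNormedType.Exports.

Local Open Scope classical_set_scope.
Local Open Scope ring_scope.

Section Hausdorff.
Context {R : realType}.
Local Open Scope ereal_scope.

Definition diameter (U : set R) : \bar R :=
  ereal_sup [set z | exists x y, [/\ U x, U y & z = `|x - y|%:E]].

(* The empty set has gauge 0 for every s, including s = 0, whereas
   [x `^ 0 = 1] for every x. *)
Definition hausdorff_gauge (s : R) (U : set R) : \bar R :=
  if U == set0 then 0 else diameter U `^ s.

Definition hausdorff_content (s delta : R) (A : set R) : \bar R :=
  ereal_inf [set z | exists U : nat -> set R,
    [/\ A `<=` \bigcup_n U n,
        forall n, diameter (U n) <= delta%:E
      & z = \sum_(n <oo) hausdorff_gauge s (U n)]].

Definition hausdorff_measure (s : R) (A : set R) : \bar R :=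
  ereal_sup [set hausdorff_content s delta A | delta in [set d | (0 < d)%R]].

Definition hausdorff_dim (A : set R) : \bar R :=
  if A == set0 then -oo
  else ereal_inf [set s%:E | s in [set s | (0 <= s)%R /\
                                           hausdorff_measure s A = 0]].

End Hausdorff.

Section Holder.
Context {R : realType}.

(* [D] is the domain of [Z]; the values of [Z] outside [D] are irrelevant. *)
Definition pointwise_holder (D : set R) (Z : R -> R) (alpha x0 : R) : Prop :=
  exists (P : {poly R}) (C : R),
    [/\ (size P <= (Num.truncn alpha).+1)%N, 0 < C
      & \forall x \near x0, D x ->
          `|Z x - P.[x - x0]| <= C * `|x - x0| `^ alpha].

Definition holder_exponent (D : set R) (Z : R -> R) (x0 : R) : \bar R :=
  ereal_sup [set a%:E | a in [set a | 0 <= a /\ pointwise_holder D Z a x0]].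

(* The part in [U] of the level set of the exponent of [Z : [0,1] -> R]; the
   exponent is always that of [Z] on [0,1], not of its restriction to [U]. *)
Definition iso_holder (Z : R -> R) (U : set R) (h : R) : set R :=
  [set x | U x /\ holder_exponent `[0, 1] Z x = h%:E].

Definition spectrum (Z : R -> R) (h : R) : \bar R :=
  hausdorff_dim (iso_holder Z `[0, 1] h).

Definition homogeneously_multifractal (Z : R -> R) : Prop :=
  forall U : set R, is_interval U -> U `<=` `[0, 1] ->
    (exists x y, [/\ U x, U y & x < y]) ->
    forall h, 0 <= h -> hausdorff_dim (iso_holder Z U h) = spectrum Z h.

End Holder.

Section PrescribedSpectra.
Context {R : realType}.
Local Open Scope ereal_scope.

(* [D] is the domain of [f]; the values of [f] outside [D] are irrelevant. *)
Definition support_on (T : Type) (D : set T) (f : T -> \bar R) : set T :=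
  [set x | D x /\ -oo < f x].

Definition spectrum_valued (T : Type) (D : set T) (f : T -> \bar R) : Prop :=
  forall x, D x -> f x = -oo \/ 0 <= f x <= 1.

Definition support_star (f : R -> \bar R) : set R :=
  smallest [set A | exists2 h : R, (0 <= h <= 1)%R & A = `[h, 1%R]%classic]
           (support_on `[0%R, 1%R] f).

Definition class_F (f : R -> \bar R) : Prop :=
  spectrum_valued `[0%R, 1%R] f /\
  exists (fn : nat -> \bar R -> \bar R) (a b : nat -> R),
    [/\ forall n, spectrum_valued [set x | 0 <= x] (fn n),
        forall n, (0 <= a n)%R /\ (a n <= b n)%R /\ (b n <= 1)%R /\
                  support_on [set x | 0 <= x] (fn n) =
                    [set x%:E | x in `[a n, b n]],
        (0 < inf (range a))%R,
        forall n, {in `[a n, b n] &, forall x y, fn n x%:E = fn n y%:E} /\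
                  {in `[a n, b n], forall x, fn n x%:E <= x%:E}
      & {in `[0%R, 1%R], forall x, f x = ereal_sup [set fn n x%:E | n in setT]}].

End PrescribedSpectra.

Definition lebesgue_measurable {R : realType} (A : set R) : Prop :=
  ((wlength (@idfun R))^*)%mu.-cara.-measurable A.

(* Main.v *)
(* Z x = x + T x + H x, where H is nondecreasing, continuous, and has the
   prescribed exponents below 1, and T is a 1/2-Lipschitz Faber-Schauder series
   whose coefficients are chosen, after H, so that the second differences of
   T + H over the dyadic intervals of sparse levels n are never o(2^-(n alpha))
   for any alpha > 1. Hence the exponent of Z is 1 wherever that of H is at least
   1, and is that of H elsewhere.

   H sums countably many self-similar pieces. A piece belongs to a plateau (a, b, c),
   a prescribed height c < a over an interval [a, b] of exponents. It lives on a
   Cantor set of dimension c: a cell of length r_j contains about r_{j+1}^-c equally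
   spaced children of length r_{j+1}, much smaller than r_j, each of which receives
   the mass r_{j+1}^e with e in a fine grid of [a, b]. The exponent of H at a point
   of the Cantor set is the lower limit of the exponents e along its branch, and any
   value h in [a, b] is obtained on a subset of dimension c by fixing only the grid
   point of each child. Every cell of every level, in a Cantor set or not, contains
   one root of a new Cantor set, which makes H homogeneous; the points lying in
   infinitely many roots form a set of dimension 0, so that different plateaux do
   not interact. Off the Cantor sets and this exceptional set, which are all
   Lebesgue null, the exponent of H is at least 1. *)

(* What makes the exponents prescribable is the strict inequality c < a. The children of one cell
   together carry a mass of about r_{j+1}^(a-c), and r_{j+1} is chosen after r_j, so this can be
   made negligible against any power of r_j. At scales above the spacing of the children a level is
   then Lipschitz with a small constant, and below that spacing only one child is visible: the
   scales do not interact, and the exponent is read off child by child. The condition f_n(x) <= x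
   gives only c <= a, so heights are lowered slightly and intervals are cut before 1; countably many
   such plateaux recover the supremum. An additional plateau of height 0 produces the value 0 where
   f is -oo inside Support*(f). Exponents above 1 are the other obstacle. The definition allows a
   linear polynomial to be subtracted, so a lower bound on slopes proves nothing and second
   differences are needed; those of a fixed T could be cancelled by H, hence the choice of T after
   H. *)
Require Import Defs.
From HB Require Import structures.
From mathcomp Require Import all_boot all_order all_algebra.
From mathcomp Require Import all_classical all_reals all_analysis.
From mathcomp Require Import ring lra.
From mathcomp Require Import zify.
Import Order.TTheory GRing.Theory Num.Theory.
Import numFieldNormedType.Exports.
Local Open Scope classical_set_scope.
Local Open Scope ring_scope.
Set Implicit Arguments.
Unset Strict Implicit.
Unset Printing Implicit Defensive.

(** * Hausdorff measure *)

Notation lam := ((wlength idfun)^*)%mu.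

Section HausdorffTools.
Context {R : realType}.
Implicit Types (A E D U : set R) (s : R).

Lemma lam_itv (p q : R) : p <= q -> lam `[p, q] = (q - p)%:E.
Proof.
move=> pq; change (lebesgue_measure (`[p, q]%classic) = (q - p)%:E).
rewrite lebesgue_measure_itv /= lte_fin; case: ltP => // qp.
by have -> : p = q by [apply/le_anti; rewrite pq qp]; rewrite subrr.
Qed.

Lemma le_diameter U x y : U x -> U y -> (`|x - y|%:E <= diameter U)%E.
Proof. by move=> Ux Uy; apply: ereal_sup_ubound; exists x, y. Qed.

Lemma diameter_ge0 U : U != set0 -> (0 <= diameter U)%E.
Proof.
move=> U0; have /set0P[x Ux] := U0; have := le_diameter Ux Ux.
by rewrite subrr normr0.
Qed.

Lemma diameter_itv_le (p q : R) : (diameter `[p, q] <= (q - p)%:E)%E.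
Proof.
apply: ge_ereal_sup => z [x [y []]]; rewrite /= !in_itv /= => /andP[px xq] /andP[py yq] ->.
by rewrite lee_fin ler_norml; apply/andP; split; lra.
Qed.

Lemma diameter_set0 : diameter (@set0 R) = -oo%E.
Proof.
rewrite /diameter (_ : mkset _ = set0) ?ereal_sup0// -subset0.
by move=> z [x [y []]].
Qed.

Lemma hausdorff_gauge_ge0 s U : (0 <= hausdorff_gauge s U)%E.
Proof. by rewrite /hausdorff_gauge; case: ifP => // _; exact: poweR_ge0. Qed.

Lemma hausdorff_content_ge0 s d A : (0 <= hausdorff_content s d A)%E.
Proof.
apply: le_ereal_inf_tmp => _ [U [_ _ ->]].
by apply: nneseries_ge0 => n _ _; exact: hausdorff_gauge_ge0.
Qed.

Lemma nneseries_le_bound (u : nat -> \bar R) (B : \bar R) :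
  (forall n, 0 <= u n)%E -> (forall N, \sum_(0 <= i < N) u i <= B)%E ->
  (\sum_(n <oo) u n <= B)%E.
Proof.
move=> u0 uB; apply: lime_le; first by apply: is_cvg_nneseries => n _ _.
exact: nearW.
Qed.

Lemma nneseries_double (u : nat -> nat -> \bar R) (f : nat -> nat * nat) :
  set_bij setT setT f -> (forall i j, 0 <= u i j)%E ->
  (\sum_(n <oo) u (f n).1 (f n).2 = \sum_(i <oo) \sum_(j <oo) u i j)%E.
Proof.
move=> fbij u0.
rewrite nneseries_esumT//.
rewrite -(@reindex_esum _ _ _ setT setT f (fun p => u p.1 p.2))//.
rewrite [RHS]nneseries_esumT; last by move=> i; apply: nneseries_ge0.
under [RHS]eq_esum do rewrite nneseries_esumT//.
rewrite esum_esum//; congr (esum _ _).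
by apply/seteqP; split => // -[].
Qed.

Lemma sum_cutoff_le (n N : nat) (c : R) : 0 <= c ->
  \sum_(0 <= j < N) (if (j < n)%N then c else 0) <= n%:R * c.
Proof.
move=> c0; rewrite (_ : \sum_(0 <= j < N) _ = (minn N n)%:R * c).
  by rewrite ler_wpM2r// ler_nat geq_minr.
elim: N => [|N IH]; first by rewrite big_nil min0n mul0r.
rewrite big_nat_recr//= IH; case: ifPn => [Nn|]; last rewrite -leqNgt => Nn.
  by rewrite (minn_idPl (ltnW Nn)) (minn_idPl Nn) -natr1 mulrDl mul1r.
by rewrite addr0 (minn_idPr Nn) (minn_idPr (leqW Nn)).
Qed.

(** Borel-Cantelli covering: for every J the intervals of the levels j >= J cover A, with total
    gauge at most 2 * 2^-J. All upper bounds for dimensions come from here. *)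
Lemma limsup_cover_null s A (n : nat -> nat) (p : nat -> nat -> R) (r : nat -> R) :
  (forall j, 0 <= r j) ->
  (forall x, A x -> forall j0, exists j k,
     [/\ (j0 <= j)%N, (k < n j)%N & p j k <= x <= p j k + r j]) ->
  (exists j0, forall j, (j0 <= j)%N ->
     r j <= 2^-1 ^+ j /\ (n j)%:R * r j `^ s <= 2^-1 ^+ j) ->
  0 <= s -> hausdorff_measure s A = 0%E.
Proof.
move=> r0 Alim [j0 Hj0] s0.
have half0 k : (0 : R) < 2^-1 ^+ k by rewrite exprn_gt0.
have halfsmall (e : R) : 0 < e -> exists k : nat, 2^-1 ^+ k < e.
  move=> e0; have : (fun k => 2^-1 ^+ k : R) @ \oo --> (0 : R).
    by apply: cvg_expr; rewrite ger0_norm ?invr_ge0// invf_lt1// ltr1n.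
  move=> /cvgrPdist_lt/(_ _ e0)[k _ /(_ k (leqnn k))]; rewrite /= sub0r normrN.
  by rewrite ger0_norm ?(ltW (half0 _))// => ?; exists k.
have content0 d : 0 < d -> hausdorff_content s d A = 0%E.
  move=> d0; apply/eqP; rewrite eq_le hausdorff_content_ge0 andbT.
  apply/lee_addgt0Pr => e e0; rewrite add0e.
  have [J1 J1d] := halfsmall _ d0.
  have [J2 J2e] := halfsmall (e / 2) (divr_gt0 e0 (ltr0Sn R 1)).
  (* [J1] keeps the diameters below d, [J2] keeps the geometric tail 2 * 2^-J at most e. *)
  pose J := maxn j0 (maxn J1 J2).
  have [f fbij] : exists f : nat -> nat * nat, set_bij setT setT f.
    have /card_esym/ppcard_eqP[f] := card_nat2.
    by exists f; exact: 'bij_f.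
  pose U i j := if (J <= i)%N && (j < n i)%N then `[p i j, p i j + r i]%classic
                else set0.
  have gU i j : (hausdorff_gauge s (U i j) <=
      if (J <= i)%N && (j < n i)%N then (r i `^ s)%:E else 0)%E.
    rewrite /U; case: ifP => [/andP[Ji jn]|_]; last first.
      by rewrite /hausdorff_gauge eqxx.
    rewrite /hausdorff_gauge; case: ifPn => [_|U0]; first by rewrite lee_fin powR_ge0.
    rewrite -poweR_EFin; apply: gt0_ler_poweR => //.
    - by rewrite in_itv /= diameter_ge0// leey.
    - by rewrite in_itv /= lee_fin r0 leey.
    by apply: le_trans (diameter_itv_le _ _) _; rewrite lee_fin addrC addKr.
  have powhalf k l : (k <= l)%N -> (2^-1 ^+ l <= 2^-1 ^+ k :> R).
    by move=> kl; rewrite ler_wiXn2l// ?invr_ge0// invf_le1// ler1n.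
  apply: (@le_trans _ _ (\sum_(m <oo) hausdorff_gauge s (U (f m).1 (f m).2)))%E.
    apply: ereal_inf_lbound; exists (fun m => U (f m).1 (f m).2); split => //.
      move=> x Ax; have [j [k [Jj kn xI]]] := Alim x Ax J.
      have [_ _ /(_ (j, k) I)[m _ fm]] := fbij.
      by exists m => //; rewrite fm /= /U Jj kn.
    move=> m; rewrite /U; case: ifP => [/andP[Jm _]|_]; last first.
      by rewrite diameter_set0 leNye.
    apply: le_trans (diameter_itv_le _ _) _; rewrite lee_fin addrC addKr.
    have [|rm _] := Hj0 (f m).1; first by apply: leq_trans Jm; rewrite leq_maxl.
    apply: le_trans rm (le_trans _ (ltW J1d)); apply: powhalf.
    by apply: leq_trans Jm; rewrite /J leq_max leq_maxl orbT.
  rewrite (@nneseries_double (fun i j => hausdorff_gauge s (U i j)))//; last first.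
    by move=> i j; exact: hausdorff_gauge_ge0.
  have inner i : (\sum_(j <oo) hausdorff_gauge s (U i j) <=
      if (J <= i)%N then (2^-1 ^+ i)%:E else 0)%E.
    apply: nneseries_le_bound => [j|N]; first exact: hausdorff_gauge_ge0.
    apply: le_trans (lee_sum _ (fun j _ => gU i j)) _.
    case: leqP => Ji /=; last by rewrite big1.
    have [|_ ni] := Hj0 i; first by apply: leq_trans Ji; rewrite leq_maxl.
    have -> : (\sum_(0 <= j < N) (if (j < n i)%N then (r i `^ s)%:E else 0))%E
        = (\sum_(0 <= j < N) (if (j < n i)%N then (r i `^ s) else 0))%:E.
      by rewrite -sumEFin; apply: eq_bigr => j _; case: ifP.
    rewrite lee_fin; apply: le_trans ni.
    exact/sum_cutoff_le/powR_ge0.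
  apply: nneseries_le_bound => [i|N].
    by apply: nneseries_ge0 => j _ _; exact: hausdorff_gauge_ge0.
  apply: le_trans (lee_sum _ (fun i _ => inner i)) _.
  have -> : (\sum_(0 <= i < N) (if (J <= i)%N then (2^-1 ^+ i)%:E else 0))%E
        = (\sum_(0 <= i < N) (if (J <= i)%N then 2^-1 ^+ i else 0 : R))%:E.
      by rewrite -sumEFin; apply: eq_bigr => j _; case: ifP.
  rewrite lee_fin.
  have : \sum_(0 <= i < N) (if (J <= i)%N then 2^-1 ^+ i else 0 : R) <=
     2 * 2^-1 ^+ J - (if (J <= N)%N then 2 * 2^-1 ^+ N else 2 * 2^-1 ^+ J).
    elim: N => [|N IH].
      rewrite big_nil; case: leqP => [|_]; last by rewrite subrr.
      by rewrite leqn0 => /eqP ->; rewrite subrr.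
    rewrite big_nat_recr //=; move: IH; rewrite exprS mulrA divff// mul1r.
    case: leqP => [JN|NJ]; first by rewrite (leqW JN); lra.
    rewrite addr0; have [->|JN] := eqVneq J N.+1; first by rewrite leqnn exprS; lra.
    by rewrite leqNgt ltn_neqAle eq_sym JN NJ.
  move/le_trans; apply.
  have e2 : 2^-1 ^+ J <= e / 2.
    by apply: le_trans (powhalf _ _ _) (ltW J2e); rewrite /J !leq_max leqnn !orbT.
  case: ifP => _; last by lra.
  by have := half0 N; lra.
apply/eqP; rewrite eq_le; apply/andP; split.
  by apply: ge_ereal_sup => _ [d d0 <-]; rewrite content0.
apply: ereal_sup_ubound; exists 1 => //=; exact: content0.
Qed.

(* A parametrisation with Hoelder inverse transports the Lebesgue outer measure
   of the parameter set to a lower bound for the Hausdorff content; this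
   replaces the mass distribution principle. *)
Lemma lam_le_content s d C D E (psi : R -> R) :
  0 <= s -> 0 < C -> (forall u, D u -> E (psi u)) ->
  (forall u v, D u -> D v -> `|u - v| <= C * `|psi u - psi v| `^ s) ->
  (lam D <= (2 * C)%:E * hausdorff_content s d E)%E.
Proof.
move=> s0 C0 DE Dpsi; have C20 : 0 < 2 * C by rewrite mulr_gt0.
rewrite -lee_pdivrMl// -?EFinV; apply: le_ereal_inf_tmp => _ [U [EU _ ->]].
rewrite lee_pdivrMl//.
apply: (@le_trans _ _ (\sum_(n <oo) lam (D `&` psi @^-1` (U n))))%E.
  apply: le_trans (outer_measure_sigma_subadditive lam _).
  apply: le_outer_measure => u Du; have [n _ Un] := EU _ (DE _ Du).
  by exists n.
rewrite -nneseriesZl; last by move=> n _; exact: hausdorff_gauge_ge0.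
apply: lee_nneseries => [n _ _|n _]; first exact: outer_measure_ge0.
have [->|/set0P[u0 [Du0 Uu0]]] := eqVneq (D `&` psi @^-1` U n) set0.
  by rewrite outer_measure0 mule_ge0// ?hausdorff_gauge_ge0// lee_fin ltW.
rewrite /hausdorff_gauge; case: ifPn => [/eqP U0|Un0].
  by move: Uu0; rewrite /preimage /= U0.
have := diameter_ge0 Un0; case dU: (diameter (U n)) => [m| |] // m0.
  rewrite lee_fin in m0; rewrite poweR_EFin -EFinM.
  have L0 : 0 <= C * m `^ s by rewrite mulr_ge0 ?powR_ge0// ltW.
  (* The part of D that is mapped into U n lies within C m^s of any one of its points; the length of
     this interval is the origin of the factor 2 C. *)
  apply: (@le_trans _ _ (lam `[u0 - C * m `^ s, u0 + C * m `^ s])).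
    apply: le_outer_measure => u [Du Uu].
    rewrite /= in_itv /= -ler_distlC.
    apply: le_trans (Dpsi _ _ Du0 Du) _; apply: ler_wpM2l; first exact: ltW.
    apply: ge0_ler_powR; rewrite ?nnegrE//.
    by rewrite -lee_fin -dU; exact: le_diameter.
  rewrite lam_itv; last by lra.
  by rewrite lee_fin; lra.
(* Infinite diameter: for s > 0 the gauge is infinite, while for s = 0 it is 1 and the hypothesis
   itself confines D to a radius C. *)
have [s00|sn0] := eqVneq s 0; last by rewrite poweRyr// gt0_muley ?leey// lte_fin.
rewrite s00 poweRe0 mule1.
apply: (@le_trans _ _ (lam `[u0 - C, u0 + C])).
  apply: le_outer_measure => u [Du Uu].
  rewrite /= in_itv /= -ler_distlC.
  by apply: le_trans (Dpsi _ _ Du0 Du) _; rewrite (_ : s = 0)// powRr0 mulr1.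
rewrite lam_itv; last by lra.
by rewrite lee_fin; lra.
Qed.

Lemma hausdorff_content_le_measure s d A : 0 < d ->
  (hausdorff_content s d A <= hausdorff_measure s A)%E.
Proof. by move=> d0; apply: ereal_sup_ubound; exists d. Qed.

Lemma hausdorff_measure1_lam0 A : hausdorff_measure 1 A = 0%E -> lam A = 0%E.
Proof.
move=> A0; apply/eqP; rewrite eq_le outer_measure_ge0 andbT.
have := @lam_le_content 1 1 1 A A id ler01 ltr01 (fun _ => id).
have -> : hausdorff_content 1 1 A = 0%E.
  apply/eqP; rewrite eq_le hausdorff_content_ge0 andbT -A0.
  exact: hausdorff_content_le_measure.
rewrite mule0; apply => u v _ _.
by rewrite powRr1// mul1r.
Qed.

Lemma hausdorff_measure_neq0 s C D E (psi : R -> R) :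
  0 <= s -> 0 < C -> (forall u, D u -> E (psi u)) ->
  (forall u v, D u -> D v -> `|u - v| <= C * `|psi u - psi v| `^ s) ->
  (0 < lam D)%E -> hausdorff_measure s E <> 0%E.
Proof.
move=> s0 C0 DE Dpsi D0 E0; have := @lam_le_content s 1 _ _ _ _ s0 C0 DE Dpsi.
have -> : hausdorff_content s 1 E = 0%E.
  apply/eqP; rewrite eq_le hausdorff_content_ge0 andbT -E0.
  exact: hausdorff_content_le_measure.
by rewrite mule0 leNgt D0.
Qed.

Lemma hausdorff_dim_le s A : 0 <= s -> hausdorff_measure s A = 0%E ->
  (hausdorff_dim A <= s%:E)%E.
Proof.
move=> s0 As; rewrite /hausdorff_dim; case: ifP => [_|_]; first exact: leNye.
by apply: ereal_inf_lbound; exists s.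
Qed.

(** For c = 0 there is no s to test and the bound rests on non-emptiness alone, since the empty set
    has dimension -oo. *)
Lemma hausdorff_dim_ge c A : A !=set0 ->
  (forall s, 0 <= s < c -> hausdorff_measure s A <> 0%E) ->
  (c%:E <= hausdorff_dim A)%E.
Proof.
move=> /set0P A0 As; rewrite /hausdorff_dim (negbTE A0).
apply: le_ereal_inf_tmp => _ [s [s0 sA] <-]; rewrite lee_fin leNgt.
by apply/negP => sc; apply: (As s) => //; rewrite s0 sc.
Qed.

End HausdorffTools.

(** * Powers of two, series and tents *)

Section PowersOfTwo.
Context {R : realType}.
Implicit Types x y : R.

(** Lengths, counts and masses are written as real powers of 2, so that [ler_p2] turns estimates
    into linear inequalities between exponents. *)
Definition p2 x : R := 2 `^ x.

Lemma p2_gt0 x : 0 < p2 x. Proof. exact: powR_gt0. Qed.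

Lemma p2_ge0 x : 0 <= p2 x. Proof. exact: powR_ge0. Qed.

Lemma p2D x y : p2 (x + y) = p2 x * p2 y.
Proof. by rewrite /p2 powRD// pnatr_eq0 implybT. Qed.

Lemma p20 : p2 0 = 1. Proof. exact: powRr0. Qed.

Lemma p21 : p2 1 = 2. Proof. exact: powRr1. Qed.

Lemma p2N x : p2 (- x) = (p2 x)^-1. Proof. exact: powRN. Qed.

Lemma p2n (n : nat) : p2 n%:R = 2 ^+ n. Proof. exact: powR_mulrn. Qed.

Lemma p2Nn (n : nat) : p2 (- n%:R) = 2^-1 ^+ n.
Proof. by rewrite p2N p2n exprVn. Qed.

Lemma p2M x y : p2 x `^ y = p2 (x * y). Proof. by rewrite /p2 -powRrM. Qed.

Lemma ler_p2 x y : (p2 x <= p2 y) = (x <= y).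
Proof.
apply/idP/idP => [|xy]; last by apply: ler_powR => //; rewrite ler1n.
move=> pxy; rewrite leNgt; apply/negP => yx.
have pyx : p2 y <= p2 x by apply: ler_powR (ltW yx); rewrite ler1n.
have e : p2 (x - y) = 1.
  by rewrite p2D p2N (_ : p2 x = p2 y) ?divff ?gt_eqF ?p2_gt0//; apply/le_anti/andP.
move/eqP: e; rewrite /p2 powR_eq1 subr_eq0 (gt_eqF yx) orbF; apply/negP.
by rewrite negb_or (@eqr_nat R 2 1) -leNgt ler0n.
Qed.

Lemma p2_exists_ge (C : R) : exists n : nat, C <= p2 n%:R.
Proof.
exists (Num.truncn C).+1; rewrite p2n.
apply: le_trans (ltW (truncnS_gt C)) _.
by rewrite -natrX ler_nat ltnW// ltn_expl.
Qed.

End PowersOfTwo.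

Section SeriesOfFunctions.
Context {R : realType}.

Definition fseries (u : nat -> R -> R) (x : R) : R :=
  limn (fun N => \sum_(0 <= n < N) u n x).

Lemma fseries_cvg (u : nat -> R -> R) (b : nat -> R) (B x : R) :
  (forall n, 0 <= u n x <= b n) -> (forall N, \sum_(0 <= n < N) b n <= B) ->
  (fun N => \sum_(0 <= n < N) u n x) @ \oo --> fseries u x.
Proof.
move=> ub bB; apply: nondecreasing_is_cvgn.
  apply/nondecreasing_seqP => n; rewrite big_nat_recr//= lerDl.
  by have /andP[] := ub n.
exists B => _ [N _ <-]; apply: le_trans (bB N).
by apply: ler_sum => n _; have /andP[] := ub n.
Qed.

Lemma fseries_diff_le (u : nat -> R -> R) (x y L : R) :
  (fun N => \sum_(0 <= n < N) u n x) @ \oo --> fseries u x ->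
  (fun N => \sum_(0 <= n < N) u n y) @ \oo --> fseries u y ->
  (forall N, \sum_(0 <= n < N) (u n y - u n x) <= L) ->
  fseries u y - fseries u x <= L.
Proof.
move=> cx cy H; apply: (cvgr_to_le (cvgB cy cx)); near=> N.
by have := H N; rewrite big_split /= sumrN.
Unshelve. all: by end_near. Qed.

Lemma fseries_diff_ge (u : nat -> R -> R) (x y L : R) (N0 : nat) :
  (fun N => \sum_(0 <= n < N) u n x) @ \oo --> fseries u x ->
  (fun N => \sum_(0 <= n < N) u n y) @ \oo --> fseries u y ->
  (forall N, (N0 <= N)%N -> L <= \sum_(0 <= n < N) (u n y - u n x)) ->
  L <= fseries u y - fseries u x.
Proof.
move=> cx cy H; apply: (cvgr_to_ge (cvgB cy cx)); near=> N.
have := H N; rewrite big_split /= sumrN; apply.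
by near: N; exact: nbhs_infty_ge.
Unshelve. all: by end_near. Qed.

Lemma fseries_second_diff (u : nat -> R -> R) (x y z c : R) (N0 : nat) :
  (forall w, w \in [:: x; y; z] ->
    (fun N => \sum_(0 <= n < N) u n w) @ \oo --> fseries u w) ->
  (forall N, (N0 <= N)%N ->
     \sum_(0 <= n < N) (u n x + u n z - 2 * u n y) = c) ->
  fseries u x + fseries u z - 2 * fseries u y = c.
Proof.
move=> cw H.
have cx := cw x (mem_head _ _).
have cy : (fun N => \sum_(0 <= n < N) u n y) @ \oo --> fseries u y.
  by apply: cw; rewrite !inE eqxx orbT.
have cz : (fun N => \sum_(0 <= n < N) u n z) @ \oo --> fseries u z.
  by apply: cw; rewrite !inE eqxx !orbT.
have ct : (fun N => \sum_(0 <= n < N) u n x + \sum_(0 <= n < N) u n z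
    - (\sum_(0 <= n < N) u n y + \sum_(0 <= n < N) u n y)) @ \oo -->
    fseries u x + fseries u z - (fseries u y + fseries u y).
  exact: (cvgB (cvgD cx cz) (cvgD cy cy)).
have E : \forall N \near \oo, \sum_(0 <= n < N) u n x + \sum_(0 <= n < N) u n z
    - (\sum_(0 <= n < N) u n y + \sum_(0 <= n < N) u n y) = c.
  near=> N; rewrite -(H N); last by near: N; exact: nbhs_infty_ge.
  by rewrite !big_split /= sumrN -mulr_sumr mulr2n mulrDl mul1r.
rewrite mulr2n mulrDl mul1r; apply/le_anti/andP; split.
    by apply: (cvgr_to_le ct); near=> N; rewrite (near E).
by apply: (cvgr_to_ge ct); near=> N; rewrite (near E).
Unshelve. all: by end_near. Qed.

End SeriesOfFunctions.

Section Tents.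
Context {R : realType}.

(** One whole level of a Faber-Schauder series; the bit [t k] switches the tent over [k, k+1] on or
    off. *)
Definition tent (t : nat -> bool) (y : R) : R :=
  let k := Num.truncn y in
  (t k)%:R * Num.min (y - k%:R) (k.+1%:R - y).

Lemma tentE t (y : R) k : k%:R <= y <= k.+1%:R ->
  tent t y = (t k)%:R * Num.min (y - k%:R) (k.+1%:R - y).
Proof.
move=> /andP[ky yk]; have y0 : 0 <= y by apply: le_trans ky; rewrite ler0n.
(* At the right end the integer part jumps to the next cell, but both formulas give 0 there. *)
have [yk1|] := eqVneq y k.+1%:R.
  rewrite /tent yk1 natrK subrr.
  rewrite !minElt -natrB// subSnn -natrB ?leqnSn// subSnn.
  by rewrite ltr10 ltr01 !mulr0.
move=> ne; rewrite /tent (_ : Num.truncn y = k)//.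
by apply: truncn_def; rewrite ky lt_neqAle ne yk.
Qed.

Lemma truncn_cell (y : R) : 0 <= y ->
  (Num.truncn y)%:R <= y <= (Num.truncn y).+1%:R.
Proof. by move=> /truncn_itv /andP[-> /ltW ->]. Qed.

Lemma tent_ge0 t (y : R) : 0 <= y -> 0 <= tent t y <= 2^-1.
Proof.
move=> y0; rewrite /tent; have /andP[h1 h2] := truncn_cell y0.
rewrite -natr1 in h2 *; case: (t _); last by rewrite mul0r; apply/andP; split; lra.
by rewrite mul1r minElt; case: ltP => ?; apply/andP; split; lra.
Qed.

Lemma tent_lip t (x y : R) : 0 <= x -> 0 <= y -> `|tent t x - tent t y| <= `|x - y|.
Proof.
wlog xy : x y / x <= y => [hw x0 y0|].
  have [xy|/ltW xy] := leP x y; first exact: hw.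
  by rewrite distrC [leRHS]distrC; exact: hw.
move=> x0 y0; have cx := truncn_cell x0; have cy := truncn_cell y0.
rewrite [leRHS]distrC [leRHS]ger0_norm ?subr_ge0//.
have := le_truncn xy; rewrite leq_eqVlt => /predU1P[e|lt].
  rewrite /tent -e; rewrite -e in cy; move: cx cy; rewrite -natr1.
  move=> /andP[? ?] /andP[? ?]; case: (t _); last by rewrite !mul0r subrr normr0 subr_ge0.
  rewrite !mul1r ler_norml; rewrite !minElt; do 2 case: ltP => ?; apply/andP; split; lra.
have kk : (Num.truncn x).+1%:R <= (Num.truncn y)%:R :> R by rewrite ler_nat.
have /andP[tx1 _] := tent_ge0 t x0; have /andP[ty1 _] := tent_ge0 t y0.
have tx2 : tent t x <= (Num.truncn x).+1%:R - x.
  rewrite /tent; case: (t _); rewrite ?mul1r ?mul0r ?ge_min ?lexx ?orbT//.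
  by move: cx => /andP[_]; lra.
have ty2 : tent t y <= y - (Num.truncn y)%:R.
  rewrite /tent; case: (t _); rewrite ?mul1r ?mul0r ?ge_min ?lexx ?orbT//.
  by move: cy => /andP[+ _]; lra.
by rewrite ler_norml; apply/andP; split; lra.
Qed.

Lemma tent_nat t (k : nat) : tent t (k%:R : R) = 0.
Proof.
rewrite /tent natrK subrr minElt -natr1 addrAC subrr add0r ltr01 mulr0 //.
Qed.

Lemma tent_half t (k : nat) : tent t (k%:R + 2^-1 : R) = (t k)%:R / 2.
Proof.
rewrite (@tentE _ _ k); last by rewrite -(@natr1 R k); apply/andP; split; lra.
by rewrite -(@natr1 R k) minElt; case: ltP => ?; congr (_ * _); lra.
Qed.

(** A dyadic interval of length 2^-d with d > 0 lies in one half of a unit cell, where the tent is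
    affine. *)
Lemma tent_linear t (k d : nat) : (0 < d)%N ->
  tent t (k%:R / (2 ^+ d) : R) + tent t (k.+1%:R / 2 ^+ d) =
  2 * tent t ((k%:R + 2^-1) / 2 ^+ d).
Proof.
case: d => // d _; set K := (k %/ 2 ^ d.+1)%N; set m := (k %% 2 ^ d.+1)%N.
have kE : k%:R = K%:R * 2 ^+ d.+1 + m%:R :> R.
  by rewrite {1}(divn_eq k (2 ^ d.+1)) natrD natrM natrX.
have mlt : (m < 2 ^ d.+1)%N by rewrite ltn_mod expn_gt0.
have P0 : 0 < (2 : R) ^+ d by rewrite exprn_gt0.
have m0 : 0 <= m%:R :> R by rewrite ler0n.
rewrite -(@natr1 R k) kE exprS; set P := 2 ^+ d in P0 *.
pose f c := (m%:R + c) / (2 * P).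
have f12 : f 0 + f 1 = 2 * f 2^-1 by rewrite /f; field; rewrite gt_eqF.
have -> : (K%:R * (2 * P) + m%:R) / (2 * P) = K%:R + f 0.
  by rewrite /f; field; rewrite gt_eqF.
have ux (c : R) : (K%:R * (2 * P) + m%:R + c) / (2 * P) = K%:R + f c.
  by rewrite /f; field; rewrite gt_eqF.
rewrite !ux.
have f01 : f 0 <= f 2^-1 <= f 1.
  by rewrite /f !ler_pM2r ?invr_gt0 ?mulr_gt0// !lerD2l; apply/andP; split; lra.
have f00 : 0 <= f 0 by rewrite /f addr0 divr_ge0// mulr_ge0// ltW.
have f1le : f 1 <= 1.
  rewrite /f ler_pdivrMr ?mulr_gt0// mul1r natr1 /P -exprS -natrX ler_nat //.
have tE c : 0 <= f c <= 1 -> tent t (K%:R + f c) = (t K)%:R * Num.min (f c) (1 - f c).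
  move=> /andP[? ?]; rewrite (@tentE _ _ K); last by rewrite -(@natr1 R K); apply/andP; split; lra.
  by rewrite -(@natr1 R K); congr (_ * Num.min _ _); lra.
rewrite !tE; [|by apply/andP; split; lra..].
have [mh|mh] := ltnP m (2 ^ d).
  have f1h : f 1 <= 2^-1.
    rewrite /f ler_pdivrMr ?mulr_gt0// mulrA mulVf// mul1r natr1 /P -natrX ler_nat//.
  have minE c : f c <= 2^-1 -> Num.min (f c) (1 - f c) = f c.
    by move=> ?; rewrite minElt; case: ltP => ?; lra.
  rewrite !minE; [|lra..]; case: (t K); rewrite ?mul1r ?mul0r; lra.
have f0h : 2^-1 <= f 0.
  rewrite /f addr0 ler_pdivlMr ?mulr_gt0// mulrA mulVf// mul1r /P -natrX ler_nat//.
have minE c : 2^-1 <= f c -> Num.min (f c) (1 - f c) = 1 - f c.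
  by move=> ?; rewrite minElt; case: ltP => ?; lra.
rewrite !minE; [|lra..]; case: (t K); rewrite ?mul1r ?mul0r; lra.
Qed.

End Tents.

(** * A Lipschitz perturbation with large second differences *)

Section AdaptiveTents.
Context {R : realType}.

(** The weights sum to at most 1/2, which becomes the Lipschitz constant of T. *)
Let wt (q : nat) : R := 2^-1 ^+ q.+2.

Lemma sum_wt N : \sum_(0 <= q < N) wt q <= 2^-1.
Proof.
suff -> : \sum_(0 <= q < N) wt q = 2^-1 - 2^-1 ^+ N.+1 by rewrite gerBl exprn_ge0.
elim: N => [|N IH]; first by rewrite big_nil expr1 subrr.
by rewrite big_nat_recr//= IH /wt !exprS; field.
Qed.

Lemma wt_gt0 q : 0 < wt q. Proof. by rewrite exprn_gt0. Qed.

Definition second_diff (V : R -> R) (n k : nat) : R :=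
  V (k%:R / 2 ^+ n) + V (k.+1%:R / 2 ^+ n) - 2 * V ((k%:R + 2^-1) / 2 ^+ n).

Let lvl (t : nat -> nat -> bool) (q : nat) (x : R) : R :=
  wt q * (2^-1 ^+ (q ^ 2) * tent (t q) (2 ^+ (q ^ 2) * x)).

Let lvl_bound t q x : 0 <= x -> 0 <= lvl t q x <= wt q.
Proof.
move=> x0; have h := ltW (wt_gt0 q).
have /(tent_ge0 (t q))/andP[t0 t1] : 0 <= 2 ^+ (q ^ 2) * x by rewrite mulr_ge0.
have e0 : (0 : R) <= 2^-1 ^+ (q ^ 2) by rewrite exprn_ge0.
have e1 : 2^-1 ^+ (q ^ 2) <= 1  :> R.
  by apply: exprn_ile1; lra.
rewrite /lvl; apply/andP; split; first exact: mulr_ge0 h (mulr_ge0 e0 t0).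
rewrite ler_piMr// mulr_ile1// (le_trans t1)//; lra.
Qed.

Let lvl_cvg t x : 0 <= x ->
  (fun N => \sum_(0 <= n < N) lvl t n x) @ \oo --> fseries (lvl t) x.
Proof. by move=> x0; apply: fseries_cvg sum_wt => n; exact: lvl_bound. Qed.

Let lvl_lip t q x y : 0 <= x -> 0 <= y -> lvl t q y - lvl t q x <= wt q * `|y - x|.
Proof.
move=> x0 y0; rewrite /lvl -mulrBr -mulrBr ler_wpM2l ?(ltW (wt_gt0 q))//.
have e0 : (0 : R) < 2^-1 ^+ (q ^ 2) by rewrite exprn_gt0.
rewrite exprVn mulrC ler_pdivrMr ?exprn_gt0//.
apply: le_trans (ler_norm _) _.
have g (z : R) : 0 <= z -> 0 <= 2 ^+ (q ^ 2) * z by move=> z0; rewrite mulr_ge0.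
apply: le_trans (tent_lip _ (g _ y0) (g _ x0)) _.
by rewrite -mulrBr normrM mulrC [`|2 ^+ _|]ger0_norm ?exprn_ge0.
Qed.

(** Only level q is seen by a dyadic interval of length 2^-(q^2): coarser levels are affine on it,
    and finer levels vanish at both ends and at the midpoint, which are multiples of their cell
    length. The tent of level q contributes through its midpoint value 1/2. *)
Lemma lvl_second_diff t q k N : (q < N)%N ->
  \sum_(0 <= i < N) (lvl t i (k%:R / 2 ^+ (q ^ 2))
     + lvl t i (k.+1%:R / 2 ^+ (q ^ 2)) - 2 * lvl t i ((k%:R + 2^-1) / 2 ^+ (q ^ 2)))
  = - (wt q * 2^-1 ^+ (q ^ 2) * (t q k)%:R).
Proof.
move=> qN; have P0 n : 2 ^+ n != 0 :> R by rewrite expf_neq0.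
rewrite (bigD1_seq q) ?mem_index_iota ?iota_uniq//= big1_seq ?addr0.
  rewrite /lvl 3![2 ^+ _ * (_ / _)]mulrC !divfK// tent_nat tent_nat tent_half; by field.
move=> i /andP[iq _].
pose n := (i ^ 2)%N; rewrite /lvl -/n; set m := (q ^ 2)%N.
suff : tent (t i) (2 ^+ n * (k%:R / 2 ^+ m)) + tent (t i) (2 ^+ n * (k.+1%:R / 2 ^+ m))
    = 2 * tent (t i) (2 ^+ n * ((k%:R + 2^-1) / 2 ^+ m)) :> R.
  set A := tent _ _; set B := tent _ _; set C := tent _ _ => h.
  by rewrite [LHS](_ : _ = wt i * (2^-1 ^+ n * (A + B - 2 * C))); [rewrite h subrr !mulr0|ring].
have [nm|mn] := leqP n m.
  have nm' : (n < m)%N.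
    rewrite ltn_neqAle nm andbT /n /m; apply: contra iq.
    by rewrite eqn_exp2r.
  have E (c : R) : 2 ^+ n * (c / 2 ^+ m) = c / 2 ^+ (m - n).
    by rewrite -{1}(subnK nm) exprD; field; rewrite !P0.
    by rewrite !E tent_linear// subn_gt0.
have E (c : R) : 2 ^+ n * (c / 2 ^+ m) = c * 2 ^+ (n - m).
  by rewrite -{1}(subnK (ltnW mn)) exprD; field; rewrite !P0.
rewrite !E -!natrX -!natrM !tent_nat.
have -> : (k%:R + 2^-1) * (2 ^ (n - m))%:R = (k * 2 ^ (n - m) + 2 ^ (n - m).-1)%:R :> R.
  rewrite natrD natrM mulrDl; congr (_ + _).
  by rewrite -[in LHS](prednK (n := n - m)) ?subn_gt0// expnS natrM mulrA mulVf// mul1r.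
by rewrite tent_nat; lra.
Qed.

(* The Faber-Schauder coefficients of [T] are chosen after [H], so that no
   second difference of the sum can be small; the levels [q ^ 2] are sparse
   enough for the weights to be subexponential in the level. *)
Lemma adaptive_tents (H : R -> R) : exists T : R -> R,
  (forall x y, 0 <= x -> 0 <= y -> `|T x - T y| <= `|x - y| / 2) /\
  (forall q k, 2^-1 ^+ (q + 3 + q ^ 2) <=
     `|second_diff (fun x => T x + H x) (q ^ 2) k|).
Proof.
(* A tent that is switched on contributes twice the threshold 2^-(q+3+q^2). Either H alone reaches
   the threshold, or H is too small to cancel the tent below it. *)
pose t q k := `|second_diff H (q ^ 2) k| < 2^-1 ^+ (q + 3 + q ^ 2).
exists (fseries (lvl t)); split.
  have half x y : 0 <= x -> 0 <= y ->
      fseries (lvl t) x - fseries (lvl t) y <= `|x - y| / 2.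
    move=> x0 y0; apply: fseries_diff_le; [exact: lvl_cvg..|] => N.
    apply: (@le_trans _ _ (\sum_(0 <= q < N) wt q * `|x - y|)).
      by apply: ler_sum => q _; exact: lvl_lip.
    by rewrite -mulr_suml mulrC ler_wpM2l// sum_wt.
  move=> x y x0 y0; rewrite ler_norml half// andbT.
  by rewrite lerNl opprB distrC half.
move=> q k.
have -> : second_diff (fun x => fseries (lvl t) x + H x) (q ^ 2) k =
    second_diff (fseries (lvl t)) (q ^ 2) k + second_diff H (q ^ 2) k.
  by rewrite /second_diff; ring.
have -> : second_diff (fseries (lvl t)) (q ^ 2) k
    = - (2 * 2^-1 ^+ (q + 3 + q ^ 2) * (t q k)%:R).
  rewrite /second_diff; apply: (fseries_second_diff (N0 := q.+1)).
    by move=> w; rewrite !inE => /or3P[] /eqP ->; apply: lvl_cvg;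
      rewrite mulr_ge0// ?invr_ge0 ?exprn_ge0 ?addr_ge0// invr_ge0.
  move=> N qN; rewrite lvl_second_diff//; congr (- (_ * _)).
  rewrite /wt -exprD (_ : (q + 3 + q ^ 2 = (q.+2 + q ^ 2).+1)%N); last by lia.
  by rewrite [in RHS]exprS mulrA divff// mul1r.
have [tk|] := boolP (t q k); last first.
  by rewrite /t -leNgt mulr0 oppr0 add0r.
rewrite mulr1 -normrN; apply: le_trans (ler_norm _).
by have := ler_norm (second_diff H (q ^ 2) k); rewrite /t in tk; lra.
Qed.

End AdaptiveTents.

(** * Pointwise exponents *)

Section Exponents.
Context {R : realType}.
Implicit Types (D : set R) (H Z T : R -> R) (x y : R).

Definition hoelder_at H D (alpha x : R) := exists C e : R,
  [/\ 0 < C, 0 < e &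
    forall y, D y -> `|y - x| < e -> `|H y - H x| <= C * `|y - x| `^ alpha].

(* For 0 < h < 1 this is the level set of the exponent of H; the value of alpha is
   cut at 1 because linear polynomials are not subtracted. *)
Definition hoelder_level H h x :=
  (forall alpha, 0 < alpha < h -> hoelder_at H `[0, 1] alpha x) /\
  (forall alpha, h < alpha < 1 -> ~ hoelder_at H `[0, 1] alpha x).

Lemma poly_bound (P : {poly R}) :
  exists2 C, 0 <= C & forall u, `|u| <= 1 -> `|P.[u]| <= C.
Proof.
elim/poly_ind: P => [|P c [C C0 IH]].
  by exists 0 => // u _; rewrite horner0 normr0.
exists (C + `|c|) => [|u u1]; first by rewrite addr_ge0.
rewrite hornerMXaddC; apply: le_trans (ler_normD _ _) _; rewrite lerD2r normrM.
by apply: le_trans (IH u u1); rewrite ler_piMr.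
Qed.

Lemma poly_taylor2 (P : {poly R}) : exists p C : R, 0 <= C /\
  forall u, `|u| <= 1 -> `|P.[u] - P.[0] - p * u| <= C * `|u| ^+ 2.
Proof.
elim/poly_ind: P => [|Q c _].
  by exists 0, 0; split => // u _; rewrite !horner0 !mul0r !subrr normr0.
elim/poly_ind: Q => [|Q d _].
  by exists 0, 0; split => // u _; rewrite !hornerMXaddC !horner0 !mul0r subrr subr0 normr0.
have [C C0 Qb] := poly_bound Q; exists d, C; split => // u u1.
rewrite !hornerMXaddC mulr0 !add0r.
rewrite (_ : _ - _ = Q.[u] * u ^+ 2); last by ring.
by rewrite normrM normrX ler_wpM2r ?exprn_ge0// Qb.
Qed.

Lemma poly_taylor1 (P : {poly R}) : exists C : R, 0 <= C /\
  forall u, `|u| <= 1 -> `|P.[u] - P.[0]| <= C * `|u|.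
Proof.
have [p [C [C0 HC]]] := poly_taylor2 P; exists (C + `|p|); split.
  by rewrite addr_ge0.
move=> u u1; rewrite (_ : _ - _ = (P.[u] - P.[0] - p * u) + p * u); last by ring.
apply: le_trans (ler_normD _ _) _; rewrite mulrDl normrM lerD2r.
apply: le_trans (HC _ u1) _; rewrite ler_wpM2l// expr2 ler_piMr//.
Qed.

Lemma powR_antitone (u a b : R) : `|u| <= 1 -> u != 0 -> b <= a ->
  `|u| `^ a <= `|u| `^ b.
Proof. by move=> u1 u0 ba; apply: ger_powR => //; rewrite normr_gt0 u0. Qed.

Lemma nbhs_norm (P : R -> Prop) x : (\forall y \near x, P y) ->
  exists e : R, 0 < e /\ forall y, `|y - x| < e -> P y.
Proof.
move=> /nbhs_ballP[e /= e0 He]; exists e; split => // y xy.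
by apply: He; rewrite /ball /= distrC.
Qed.

(** The nonconstant part of P is O(|y - x|), which |y - x|^beta absorbs for beta <= 1; taking y = x
    in the estimate forces P(0) = Z x. *)
Lemma holder_hoelder_at Z D (alpha beta x : R) : D x ->
  pointwise_holder D Z alpha x -> 0 < beta -> beta <= alpha -> beta <= 1 ->
  hoelder_at Z D beta x.
Proof.
move=> Dx [P [C [_ C0 /nbhs_norm[e [e0 He]]]]] b0 ba b1.
have [C' [C'0 HP]] := poly_taylor1 P.
have Px : P.[0] = Z x.
  have := He x; rewrite !subrr normr0 powR0 ?mulr0; last by rewrite gt_eqF// (lt_le_trans b0).
  by move=> /(_ e0 Dx); rewrite normr_le0 subr_eq0 => /eqP ->.
exists (C + C'), (Num.min e 1); split; [by rewrite ltr_wpDr|by rewrite lt_min e0 ltr01|].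
move=> y Dy; rewrite lt_min => /andP[ye /ltW y1].
have [yx|yx] := eqVneq y x.
  by rewrite yx subrr normr0 mulr_ge0 ?powR_ge0// addr_ge0// ltW.
have yx0 : y - x != 0 by rewrite subr_eq0.
rewrite (_ : _ - _ = (Z y - P.[y - x]) + (P.[y - x] - P.[0])); last by rewrite Px; ring.
apply: le_trans (ler_normD _ _) _; rewrite mulrDl; apply: lerD.
  apply: le_trans (He _ ye Dy) _; rewrite ler_wpM2l ?(ltW C0)//.
  exact: powR_antitone.
apply: le_trans (HP _ y1) _; rewrite ler_wpM2l// -[leLHS]powRr1//.
exact: powR_antitone.
Qed.

Lemma hoelder_at_holder D Z (alpha x : R) : 0 <= alpha ->
  hoelder_at Z D alpha x -> pointwise_holder D Z alpha x.
Proof.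
move=> a0 [C [e [C0 e0 He]]]; exists (Z x)%:P, C; split => //.
  exact: leq_trans (size_polyC_leq1 _) _.
apply/nbhs_ballP; exists e => //= y; rewrite /ball /= distrC => ye Dy.
by rewrite hornerC; exact: He.
Qed.

Lemma hoelder_at_perturb D H Z (alpha x L : R) : 0 <= L -> alpha <= 1 ->
  (forall y, D y -> `|(Z y - Z x) - (H y - H x)| <= L * `|y - x|) ->
  hoelder_at H D alpha x -> hoelder_at Z D alpha x.
Proof.
move=> L0 a1 HL [C [e [C0 e0 He]]].
exists (C + L), (Num.min e 1); split; [by rewrite ltr_wpDr|by rewrite lt_min e0 ltr01|].
move=> y Dy; rewrite lt_min => /andP[ye /ltW y1].
have [yx|yx] := eqVneq y x.
  by rewrite yx subrr normr0 mulr_ge0 ?powR_ge0// addr_ge0// ltW.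
have yx0 : y - x != 0 by rewrite subr_eq0.
rewrite (_ : Z y - Z x = (H y - H x) + ((Z y - Z x) - (H y - H x))); last by ring.
apply: le_trans (ler_normD _ _) _; rewrite mulrDl; apply: lerD; first exact: He.
apply: le_trans (HL _ Dy) _; rewrite ler_wpM2l// -[leLHS]powRr1//.
exact: powR_antitone.
Qed.

(** Second differences annihilate affine functions; 4 is the sum 1 + 1 + 2 of the absolute
    coefficients. *)
Lemma second_diff_poly (Z : R -> R) (x p p1 B : R) (n k : nat) :
  (forall y, y \in [:: k%:R / 2 ^+ n; (k%:R + 2^-1) / 2 ^+ n; k.+1%:R / 2 ^+ n] ->
     `|Z y - p - p1 * (y - x)| <= B) ->
  `|second_diff Z n k| <= 4 * B.
Proof.
set a := k%:R / _; set m := (_ + _) / _; set b := k.+1%:R / _ => H.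
have Ha := H a (mem_head _ _).
have Hm : `|Z m - p - p1 * (m - x)| <= B by apply: H; rewrite !inE eqxx orbT.
have Hb : `|Z b - p - p1 * (b - x)| <= B by apply: H; rewrite !inE eqxx !orbT.
have amb : a + b = 2 * m.
  by rewrite /a /b /m -(@natr1 R k); field; rewrite expf_neq0.
rewrite /second_diff -/a -/b -/m.
have -> : Z a + Z b - 2 * Z m = (Z a - p - p1 * (a - x)) + (Z b - p - p1 * (b - x))
   - 2 * (Z m - p - p1 * (m - x)) + p1 * (a + b - 2 * m) by ring.
rewrite amb subrr mulr0 addr0; move: Ha Hm Hb; rewrite !ler_norml.
by move=> /andP[? ?] /andP[? ?] /andP[? ?]; apply/andP; split; lra.
Qed.

Lemma dyadic_near (x : R) : 0 <= x <= 1 -> exists n0, forall n, (n0 <= n)%N ->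
  exists k, [/\ (k.+1 <= 2 ^ n)%N, x - 2 * 2^-1 ^+ n <= k%:R / 2 ^+ n &
                k.+1%:R / 2 ^+ n <= x + 2 * 2^-1 ^+ n].
Proof.
move=> /andP[x0 x1]; have P0 n : 0 < 2 ^+ n :> R by rewrite exprn_gt0.
have [->|xn1] := eqVneq x 1.
  exists 0%N => n _; exists (2 ^ n).-1; rewrite prednK ?expn_gt0//; split => //.
    rewrite -subn1 natrB ?expn_gt0// natrX mulrBl divff ?gt_eqF// exprVn mul1r.
    by have : 0 <= (2 ^+ n)^-1 :> R by [rewrite invr_ge0 ltW//]; lra.
  rewrite natrX divff ?gt_eqF// exprVn.
  by have : 0 <= (2 ^+ n)^-1 :> R by [rewrite invr_ge0 ltW//]; lra.
have {}x1 : 0 < 1 - x by rewrite subr_gt0 lt_neqAle xn1.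
have [n0 Hn0] := p2_exists_ge (2 / (1 - x)).
exists n0 => n nn; exists (Num.truncn (2 ^+ n * x)).+1.
have := truncn_cell (mulr_ge0 (ltW (P0 n)) x0); set t := Num.truncn _ => /andP[t1 t2].
have H2 : 2 <= 2 ^+ n * (1 - x).
  rewrite -ler_pdivrMr//; apply: le_trans Hn0 _; rewrite p2n.
  by rewrite ler_eXn2l// ltr1n.
move: t1 t2; rewrite -(@natr1 R t) => t1 t2.
split.
- by rewrite -(@ler_nat R) natrX -(@natr1 R t.+1) -(@natr1 R t); lra.
- rewrite ler_pdivlMr// mulrBl exprVn -mulrA mulVf ?gt_eqF// mulrC.
  by lra.
- rewrite ler_pdivrMr// mulrDl exprVn -mulrA mulVf ?gt_eqF// [x * _]mulrC.
  by rewrite -(@natr1 R t.+1) -(@natr1 R t); lra.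
Qed.

Lemma exists_common_bound (a b c d : nat) :
  exists q, [/\ (0 < q)%N, (a <= q)%N, (b <= q)%N, (c <= q)%N & (d <= q)%N].
Proof. by exists (a + b + c + d).+1; split; lia. Qed.

(** An expansion of order above 1 is affine up to O(|y - x|^beta) with beta > 1, so second
    differences at scale 2^-(q^2) near x are O(2^-(beta q^2)). The assumed lower bound falls short
    of 2^-(q^2) only by the factor 2^-(q+3), which is negligible against 2^-((beta-1) q^2). *)
Lemma holder_exponent_gt1_false (Z : R -> R) (alpha x : R) :
  (forall q k, 2^-1 ^+ (q + 3 + q ^ 2) <= `|second_diff Z (q ^ 2) k|) ->
  0 <= x <= 1 -> 1 < alpha -> ~ pointwise_holder `[0, 1] Z alpha x.
Proof.
move=> Zsd x01 a1 [P [C [_ C0 /nbhs_norm[e [e0 He]]]]].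
have [p1 [C' [C'0 HP]]] := poly_taylor2 P.
(* The cut at 2 is the order of the terms of P beyond its linear part. *)
pose beta := Num.min alpha 2; pose eta := beta - 1.
have eta0 : 0 < eta by rewrite subr_gt0 lt_min a1 ltr1n.
have b2 : beta <= 2 by rewrite ge_min lexx orbT.
have ba : beta <= alpha by rewrite ge_min lexx.
have approx y : `[0, 1]%classic y -> `|y - x| < e -> `|y - x| <= 1 ->
    `|Z y - P.[0] - p1 * (y - x)| <= (C + C') * `|y - x| `^ beta.
  move=> Dy ye y1; have [yx|yx] := eqVneq (y - x) 0.
    rewrite yx normr0 mulr0 subr0 powR0 ?gt_eqF//; last by rewrite /eta in eta0; lra.
    have := He _ ye Dy; rewrite yx normr0 !powR0 ?mulr0//.
    by rewrite gt_eqF// (lt_trans ltr01).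
  rewrite (_ : _ - _ = (Z y - P.[y - x]) + (P.[y - x] - P.[0] - p1 * (y - x))); last by ring.
  apply: le_trans (ler_normD _ _) _; rewrite mulrDl; apply: lerD.
    apply: le_trans (He _ ye Dy) _; rewrite ler_wpM2l ?(ltW C0)//.
    exact: powR_antitone.
  apply: le_trans (HP _ y1) _; rewrite ler_wpM2l// -powR_mulrn//.
  exact: powR_antitone.
have [n0 Hn0] := dyadic_near x01.
have [c Hc] := p2_exists_ge (4 * (C + C')).
have [m Hm] := p2_exists_ge (4 / Num.min e 1).
(* The dyadic interval must exist in [0,1] ([n0]) and lie in the neighborhood of x ([m]); c + 9
   beats the constants, and the last bound gives 2 q <= eta q^2. *)
have [q [q0 nq mq cq eq]] := exists_common_bound n0 m.+2 (c + 9) (Num.truncn (2 / eta)).+1.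
have qq : (q <= q ^ 2)%N by rewrite leq_pmulr.
have [|k [k1 ka kb]] := Hn0 (q ^ 2)%N.
  exact: leq_trans nq qq.
pose t := 2^-1 ^+ (q ^ 2) : R.
have t0 : 0 < t by rewrite exprn_gt0.
have me0 : 0 < Num.min e 1 by rewrite lt_min e0 ltr01.
have tsmall : 2 * t < Num.min e 1.
  have : 4 * t <= Num.min e 1.
    rewrite /t exprVn ler_pdivrMr ?exprn_gt0// mulrC -ler_pdivrMr//.
    apply: le_trans Hm _; rewrite p2n ler_eXn2l ?ltr1n//.
    by apply: leq_trans qq; apply: leq_trans mq; rewrite ltnW.
  by lra.
have := Zsd q k.
have : `|second_diff Z (q ^ 2) k| <= 4 * ((C + C') * (2 * t) `^ beta).
  apply: (@second_diff_poly _ x P.[0] p1) => y yin.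
  have [y0 [y1 yx]] : 0 <= y /\ y <= 1 /\ `|y - x| <= 2 * t.
    have P0 : 0 < 2 ^+ (q ^ 2) :> R by rewrite exprn_gt0.
    have kk : k%:R / 2 ^+ (q ^ 2) <= k.+1%:R / 2 ^+ (q ^ 2) :> R.
      by rewrite ler_pM2r ?invr_gt0// ler_nat.
    have : k%:R / 2 ^+ (q ^ 2) <= y <= k.+1%:R / 2 ^+ (q ^ 2).
      move: yin; rewrite !inE => /or3P[] /eqP ->; rewrite ?lexx ?kk//.
      rewrite !ler_pM2r ?invr_gt0// -(@natr1 R k); apply/andP; split; lra.
    have k0 : 0 <= k%:R / 2 ^+ (q ^ 2) :> R by rewrite divr_ge0// ltW.
    have : k.+1%:R / 2 ^+ (q ^ 2) <= 1 :> R.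
      by rewrite ler_pdivrMr// mul1r -natrX ler_nat.
    rewrite -/t in ka kb => ? /andP[? ?]; split; first lra.
    by split; [lra|rewrite ler_norml; apply/andP; split; lra].
  have ylt := le_lt_trans yx tsmall; rewrite lt_min in ylt.
  have /andP[ye y1'] := ylt.
  apply: le_trans (approx y _ ye (ltW y1')) _.
    by rewrite /= in_itv /= y0 y1.
  rewrite ler_wpM2l ?addr_ge0 ?(ltW C0)// ge0_ler_powR ?nnegrE//.
  - by rewrite /beta le_min ler0n (ltW (lt_trans ltr01 a1)).
  - by rewrite mulr_ge0// ltW.
move=> /[swap] h1 h2; have {h1 h2} := le_trans h1 h2.
rewrite mulrA /t -!p2Nn.
have -> : 2 * p2 (- (q ^ 2)%:R) = p2 (1 - (q ^ 2)%:R) :> R by rewrite p2D p21.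
rewrite p2M => h.
have {h} := le_trans h (ler_wpM2r (p2_ge0 _) Hc).
rewrite -p2D ler_p2 !natrD.
have qe : 2 * q%:R <= q%:R ^+ 2 * eta.
  rewrite expr2 -mulrA mulrC ler_wpM2l//.
  have : 2 / eta <= q%:R.
    apply: le_trans (ltW (truncnS_gt _)) _; by rewrite ler_nat.
  by rewrite ler_pdivrMr.
have : q%:R >= c%:R + 9 :> R by rewrite -natrD ler_nat.
rewrite natrX /eta in qe *.
have -> : (1 - q%:R ^+ 2) * beta = beta - q%:R ^+ 2 * (beta - 1) - q%:R ^+ 2 by ring.
by lra.
Qed.

End Exponents.

(** For orders at most 1 the Lipschitz difference of Z and H is absorbed, so both have the same
    Hoelder orders there, while the second differences exclude orders above 1. All later work
    concerns H alone. The positive order assumed at every point of [0,1] serves the continuity of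
    Z. *)
Lemma exponent_truncation (R : realType) (H : R -> R) :
  {in `[0, 1] &, {homo H : x y / x <= y}} ->
  (forall x : R, 0 <= x <= 1 -> exists2 a, 0 < a & hoelder_at H `[0, 1] a x) ->
  exists Z : R -> R,
    [/\ {in `[0, 1] &, {homo Z : x y / x < y}},
        {within `[0, 1], continuous Z} &
        forall x : R, 0 <= x <= 1 ->
        [/\ (holder_exponent `[0%R, 1%R] Z x <= 1)%E,
            forall b, 0 < b <= 1 ->
              (forall a, 0 < a < b -> hoelder_at H `[0, 1] a x) ->
              (b%:E <= holder_exponent `[0%R, 1%R] Z x)%E &
            forall b, 0 < b <= 1 -> (b%:E < holder_exponent `[0%R, 1%R] Z x)%E ->
              hoelder_at H `[0, 1] b x]].
Proof.
move=> Hmono Hcont; have [T [Tlip Tsd]] := adaptive_tents H.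
(* The slope 1 of the identity outweighs the constant 1/2 of T and makes Z strictly increasing;
   second differences do not see it. *)
pose Z x := x + (T x + H x).
have ZH (x y : R) : 0 <= x <= 1 -> `[0, 1]%classic y ->
    `|(Z y - Z x) - (H y - H x)| <= 2 * `|y - x|.
  rewrite /= in_itv /= => /andP[x0 _] /andP[y0 _].
  rewrite (_ : _ - _ = (y - x) + (T y - T x)); last by rewrite /Z; ring.
  apply: le_trans (ler_normD _ _) _; have := Tlip _ _ y0 x0.
  by have := normr_ge0 (y - x); lra.
have toZ (a x : R) : 0 <= x <= 1 -> a <= 1 -> hoelder_at H `[0, 1] a x ->
    hoelder_at Z `[0, 1] a x.
  move=> x01 a1; apply: (@hoelder_at_perturb _ _ _ _ _ _ 2) => // y Dy.
  exact: ZH.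
have toH (a x : R) : 0 <= x <= 1 -> a <= 1 -> hoelder_at Z `[0, 1] a x ->
    hoelder_at H `[0, 1] a x.
  move=> x01 a1; apply: (@hoelder_at_perturb _ _ _ _ _ _ 2) => // y Dy.
  by rewrite distrC; exact: ZH.
have Zsd q k : 2^-1 ^+ (q + 3 + q ^ 2) <= `|second_diff Z (q ^ 2) k|.
  rewrite (_ : second_diff Z _ _ = second_diff (fun x => T x + H x) (q ^ 2) k)//.
  rewrite /second_diff /Z -(@natr1 R k); field.
  by rewrite expf_neq0.
exists Z; split.
- move=> x y; rewrite !in_itv /= => /andP[x0 x1] /andP[y0 y1] xy.
  have := Hmono x y; rewrite !in_itv /= x0 x1 y0 y1 => /(_ isT isT (ltW xy)) Hxy.
  have := Tlip _ _ y0 x0; rewrite [`|y - x|]ger0_norm ?subr_ge0 ?(ltW xy)//.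
  by rewrite ler_norml /Z => /andP[? ?]; lra.
- apply/subspace_continuousP => x; rewrite /= in_itv /= => x01.
  have [a a0 [C [e [C0 e0 He]]]] := Hcont x x01.
  (* Adding a Lipschitz function preserves orders up to 1 only. *)
  pose a' := Num.min a 1.
  have : hoelder_at Z `[0, 1] a' x.
    apply: toZ => //; first by rewrite /a' ge_min lexx orbT.
    exists C, (Num.min e 1); split => //; first by rewrite lt_min e0 ltr01.
    move=> y Dy; rewrite lt_min => /andP[ye /ltW y1].
    have [->|yx] := eqVneq y x.
      by rewrite subrr normr0 mulr_ge0 ?powR_ge0// ltW.
    apply: le_trans (He _ Dy ye) _; rewrite ler_wpM2l ?(ltW C0)//.
    by apply: powR_antitone; rewrite ?subr_eq0// ge_min lexx.
  move=> [C1 [e1 [C10 e10 HZ]]].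
  have a'0 : 0 < a' by rewrite lt_min a0 ltr01.
  apply/cvgrPdist_le => eps eps0.
  pose d := Num.min e1 ((eps / C1) `^ a'^-1).
  have d0 : 0 < d by rewrite lt_min e10 powR_gt0// divr_gt0.
  rewrite near_withinE; apply/nbhs_ballP; exists d => //= y.
  rewrite /ball /= distrC lt_min => /andP[ye yd] Dy; rewrite distrC.
  apply: le_trans (HZ _ Dy ye) _; rewrite mulrC -ler_pdivlMr//.
  have -> : eps / C1 = ((eps / C1) `^ a'^-1) `^ a'.
    by rewrite -powRrM mulVf ?gt_eqF// powRr1// divr_ge0// ltW.
  by rewrite ge0_ler_powR ?nnegrE ?powR_ge0 ?(ltW a'0) ?(ltW yd).
move=> x x01; have Dx : `[0, 1]%classic x by rewrite /= in_itv.
split.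
- apply: ge_ereal_sup => _ [a [a0 Za] <-]; rewrite lee_fin leNgt; apply/negP => a1.
  exact: (holder_exponent_gt1_false Zsd x01 a1 Za).
- move=> b /andP[b0 b1] Hb; rewrite leNgt; apply/negP => lt_b.
  have : (0 <= holder_exponent `[0%R, 1%R] Z x)%E.
    have /Hb Hh : 0 < b / 2 < b by apply/andP; split; lra.
    apply: (@le_trans _ _ (b / 2)%:E); first by rewrite lee_fin; lra.
    apply: ereal_sup_ubound; exists (b / 2) => //; split; first lra.
    by apply: hoelder_at_holder; [lra|apply: toZ => //; lra].
  case E : (holder_exponent `[0%R, 1%R] Z x) lt_b => [h| |] //.
  rewrite lte_fin lee_fin => hb h0; pose a := (h + b) / 2.
  have ah : h < a by rewrite /a; lra.
  have : (a%:E <= holder_exponent `[0%R, 1%R] Z x)%E.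
    apply: ereal_sup_ubound; exists a => //; split; first lra.
    apply: hoelder_at_holder; first lra.
    by apply: toZ; rewrite ?x01//; [rewrite /a; lra|apply: Hb; apply/andP; split; rewrite /a; lra].
  by rewrite E lee_fin leNgt ah.
- move=> b /andP[b0 b1] /ereal_sup_gt[_ [a [a0 Za] <-]]; rewrite lte_fin => ba.
  by apply: toH => //; apply: (holder_hoelder_at Dx Za b0 (ltW ba)).
Qed.

(** * Sums of ramps *)

Section Combs.
Context {R : realType}.
Implicit Types (x y z l sigma r mu u v : R).

Definition ramp (u : R) : R := Num.max 0 (Num.min u 1).

Lemma clamp_cases u v : 0 <= v -> let w := Num.max 0 (Num.min u v) in
  [\/ u <= 0 /\ w = 0, (0 <= u <= v) /\ w = u | v <= u /\ w = v].
Proof.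
move=> v0; rewrite /=; case: (leP u v) => [uv|/ltW vu].
  case: (leP 0 u) => [u0|/ltW u0]; first by apply: Or32.
  exact: Or31.
by apply: Or33; rewrite max_r.
Qed.

Lemma ramp_cases u :
  [\/ u <= 0 /\ ramp u = 0, (0 <= u <= 1) /\ ramp u = u | 1 <= u /\ ramp u = 1].
Proof. exact: clamp_cases ler01. Qed.

Lemma ramp_ge0 u : 0 <= ramp u.
Proof. by case: (ramp_cases u) => [[_ ->]|[/andP[? ?] ->]|[_ ->]]. Qed.

Lemma ramp_le1 u : ramp u <= 1.
Proof. by case: (ramp_cases u) => [[_ ->]|[/andP[? ?] ->]|[_ ->]]. Qed.

Lemma ramp0 u : u <= 0 -> ramp u = 0.
Proof. by move=> u0; case: (ramp_cases u) => [[_ ->]|[/andP[? ?] ->]|[? ->]]; lra. Qed.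

Lemma ramp1 u : 1 <= u -> ramp u = 1.
Proof. by move=> u0; case: (ramp_cases u) => [[? ->]|[/andP[? ?] ->]|[? ->]]; lra. Qed.

Lemma ramp_mono u v : u <= v -> ramp u <= ramp v.
Proof.
move=> uv; case: (ramp_cases u) => [[? ->]|[/andP[? ?] ->]|[? ->]];
by case: (ramp_cases v) => [[? ->]|[/andP[? ?] ->]|[? ->]]; lra.
Qed.

Lemma ramp_lip u v : u <= v -> ramp v - ramp u <= v - u.
Proof.
move=> uv; case: (ramp_cases u) => [[? ->]|[/andP[? ?] ->]|[? ->]];
by case: (ramp_cases v) => [[? ->]|[/andP[? ?] ->]|[? ->]]; lra.
Qed.

(** Distribution function of a measure that spreads the mass [m d] uniformly over an interval of
    length r starting at l + d sigma. *)
Definition comb (D : nat) (m : nat -> R) l sigma r x : R :=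
  \sum_(d < D) m d * ramp ((x - (l + d%:R * sigma)) / r).

Section FixedComb.
Context (D : nat) (m : nat -> R) (l sigma r mu : R).
Context (D0 : (0 < D)%N) (r0 : 0 < r) (rs : r <= sigma) (m0 : forall d, (d < D)%N -> 0 <= m d <= mu).

Let Q := comb D m l sigma r.

Lemma comb_mono x y : x <= y -> Q x <= Q y.
Proof.
move=> xy; apply: ler_sum => d _; have /andP[md _] := m0 (ltn_ord d).
by rewrite ler_wpM2l// ramp_mono// ler_pM2r ?invr_gt0// lerD2r.
Qed.

Lemma comb_ge0 x : 0 <= Q x.
Proof.
apply: sumr_ge0 => d _; have /andP[md _] := m0 (ltn_ord d).
by rewrite mulr_ge0// ramp_ge0.
Qed.

Lemma comb_le x : Q x <= D%:R * mu.
Proof.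
rewrite -[D in leRHS]card_ord -sum1_card natr_sum mulr_suml; apply: ler_sum => d _.
have /andP[md mmu] := m0 (ltn_ord d).
by rewrite mul1r; apply: le_trans mmu; rewrite ler_piMr// ramp_le1.
Qed.

Lemma comb_lip x y : x <= y -> Q y - Q x <= D%:R * mu / r * (y - x).
Proof.
move=> xy; rewrite -sumrB -[D in leRHS]card_ord -sum1_card natr_sum !mulr_suml.
apply: ler_sum => d _; have /andP[md mmu] := m0 (ltn_ord d).
rewrite -mulrBr mul1r -mulrA; apply: ler_pM => //.
  by rewrite subr_ge0 ramp_mono// ler_pM2r ?invr_gt0// lerD2r.
apply: le_trans (ramp_lip _) _; first by rewrite ler_pM2r ?invr_gt0// lerD2r.
by rewrite -mulrBl [leRHS]mulrC ler_pM2r ?invr_gt0//; lra.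
Qed.

Lemma comb_left x y : x <= l -> y <= l -> Q x = Q y.
Proof.
have E z : z <= l -> Q z = 0.
  move=> zl; apply: big1 => d _; rewrite ramp0 ?mulr0//.
  rewrite pmulr_lle0 ?invr_gt0//; have : 0 <= d%:R * sigma.
    by rewrite mulr_ge0// (le_trans (ltW r0)).
  by lra.
by move=> xl yl; rewrite !E.
Qed.

Lemma comb_right x y : l + D%:R * sigma <= x -> l + D%:R * sigma <= y -> Q x = Q y.
Proof.
have E z : l + D%:R * sigma <= z -> Q z = \sum_(d < D) m d.
  move=> zl; apply: eq_bigr => d _; rewrite ramp1 ?mulr1// ler_pdivlMr// mul1r.
  have : (d.+1)%:R * sigma <= D%:R * sigma.
    by rewrite ler_wpM2r ?ler_nat// (le_trans (ltW r0)).
  rewrite -(@natr1 R d) mulrDl mul1r => h; move: rs; lra.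
by move=> xl yl; rewrite !E.
Qed.

Lemma comb_tooth (d : nat) : (d < D)%N ->
  m d <= Q (l + d%:R * sigma + r) - Q (l + d%:R * sigma).
Proof.
move=> dD; rewrite -sumrB (bigD1 (Ordinal dD))//=.
have -> : l + d%:R * sigma + r - (l + d%:R * sigma) = r by ring.
rewrite subrr mul0r divff ?gt_eqF// ramp1// ramp0// mulr1 mulr0 subr0 lerDl.
apply: sumr_ge0 => e _; have /andP[me _] := m0 (ltn_ord e).
by rewrite -mulrBr mulr_ge0// subr_ge0 ramp_mono// ler_pM2r ?invr_gt0// lerD2r lerDl ltW.
Qed.

Lemma sum_ramp_nat (n : nat) u : \sum_(d < n) ramp (u - d%:R) = Num.max 0 (Num.min u n%:R).
Proof.
elim: n => [|n IH].
  by rewrite big_ord0; case: (clamp_cases u (ler0n R 0)) => -[? /= ->]; rewrite ?mulr0n; lra.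
have n0 : 0 <= n%:R :> R by rewrite ler0n.
have n1 : 0 <= n%:R + 1 :> R by lra.
rewrite big_ord_recr/= IH -(@natr1 R n).
case: (clamp_cases u n0) => -[? /= ->]; case: (clamp_cases u n1) => -[? /= ->];
  by case: (ramp_cases (u - n%:R)) => -[? ->]; lra.
Qed.

(** An interval meets at most (y - x) / sigma + 1 teeth. Instead of counting them, each increment is
    bounded by that of a ramp of width sigma between x and y + sigma; by [sum_ramp_nat] those ramps
    glue to a single clamp of slope 1. *)
Lemma comb_count x y : x <= y -> Q y - Q x <= mu * ((y - x) / sigma + 1).
Proof.
move=> xy; have s0 : 0 < sigma by apply: lt_le_trans rs.
pose K z := \sum_(d < D) ramp ((z - l) / sigma - d%:R).
have KE z : K z = Num.max 0 (Num.min ((z - l) / sigma) D%:R) by exact: sum_ramp_nat.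
apply: (@le_trans _ _ (mu * (K (y + sigma) - K x))).
  rewrite /K -[X in mu * X]sumrB mulr_sumr /Q /comb -sumrB; apply: ler_sum => d _.
  have /andP[md mmu] := m0 (ltn_ord d); rewrite -mulrBr; apply: ler_pM => //.
    by rewrite subr_ge0 ramp_mono// ler_pM2r ?invr_gt0// lerD2r.
  have E z : (z - l) / sigma - d%:R = (z - (l + d%:R * sigma)) / sigma.
    by field; rewrite gt_eqF.
  apply: lerB; last first.
    rewrite E; have [xd|dx] := leP (x - (l + d%:R * sigma)) 0.
      rewrite [leLHS]ramp0 ?ramp_ge0// pmulr_lle0 ?invr_gt0//.
    by apply: ramp_mono; rewrite ler_pM2l// lef_pV2// posrE.
  have [xd|dx] := leP (y - (l + d%:R * sigma)) 0.
    by rewrite [leLHS]ramp0 ?ramp_ge0// pmulr_lle0 ?invr_gt0//.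
  by rewrite [leRHS]ramp1 ?ramp_le1// E ler_pdivlMr//; lra.
have mu0 : 0 <= mu by have /andP[/le_trans h /h] := m0 D0.
rewrite ler_wpM2l// !KE.
have -> : (y + sigma - l) / sigma = (x - l) / sigma + ((y - x) / sigma + 1).
  by field; rewrite gt_eqF.
have t0 : 0 <= (y - x) / sigma by rewrite divr_ge0 ?subr_ge0// ltW.
set X := (x - l) / sigma; set T := (y - x) / sigma in t0 *.
have d0 : 0 <= D%:R :> R by rewrite ler0n.
case: (clamp_cases X d0) => -[? /= ->]; case: (clamp_cases (X + (T + 1)) d0) => -[? /= ->]; lra.
Qed.

(** Teeth of width at most sigma/4 lie so far apart that an interval shorter than sigma/4 meets only
    one of them, and that tooth starts within sigma/2 of z. This is the only estimate in which the
    individual masses matter. *)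
Lemma comb_near x y z mm : x <= z <= y -> r <= sigma / 4 -> y - x < sigma / 4 ->
  0 <= mm ->
  (forall d, (d < D)%N -> `|z - (l + d%:R * sigma)| < sigma / 2 -> m d <= mm) ->
  Q y - Q x <= mm * Num.min 1 ((y - x) / r).
Proof.
move=> /andP[xz zy] r4 t4 mm0 Hm; have xy := le_trans xz zy.
have min0 : 0 <= Num.min 1 ((y - x) / r).
  by rewrite le_min ler01 divr_ge0// ?subr_ge0// ltW.
pose df (d : 'I_D) := ramp ((y - (l + d%:R * sigma)) / r) - ramp ((x - (l + d%:R * sigma)) / r).
have df0 d : 0 <= df d by rewrite subr_ge0 ramp_mono// ler_pM2r ?invr_gt0// lerD2r.
have dfmin d : df d <= Num.min 1 ((y - x) / r).
  rewrite le_min; apply/andP; split.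
    by have := ramp_ge0 ((x - (l + d%:R * sigma)) / r);
       have := ramp_le1 ((y - (l + d%:R * sigma)) / r); rewrite /df; lra.
  apply: le_trans (ramp_lip _) _; first by rewrite ler_pM2r ?invr_gt0// lerD2r.
  by rewrite -mulrBl ler_pM2r ?invr_gt0//; lra.
have dfn0 d : df d != 0 -> `|z - (l + d%:R * sigma)| <= sigma / 2 /\
    l + d%:R * sigma < y /\ x < l + d%:R * sigma + r.
  move=> dfd; have h1 : l + d%:R * sigma < y.
    rewrite ltNge; apply: contra dfd => h; rewrite /df !ramp0 ?subrr//;
      by rewrite pmulr_lle0 ?invr_gt0//; lra.
  have h2 : x < l + d%:R * sigma + r.
    rewrite ltNge; apply: contra dfd => h; rewrite /df !ramp1 ?subrr//;
      by rewrite ler_pdivlMr//; lra.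
  by split => //; rewrite ler_norml; apply/andP; split; lra.
rewrite -sumrB; under eq_bigr do rewrite -mulrBr -/(df _).
have [d1 dd1|all0] := pickP (fun d => df d != 0); last first.
  rewrite big1 ?mulr_ge0// => d _.
  by have := all0 d; move=> /negbT; rewrite negbK => /eqP ->; rewrite mulr0.
have [n1 [l1 u1]] := dfn0 _ dd1.
rewrite (bigD1 d1)//= big1 ?addr0.
  have /andP[md _] := m0 (ltn_ord d1).
  apply: ler_pM => //; apply: Hm => //.
  by rewrite ltr_norml; apply/andP; split; lra.
move=> d dd; have [->|dd2] := eqVneq (df d) 0; first by rewrite mulr0.
have [_ [l2 u2]] := dfn0 _ dd2; exfalso; move: dd; rewrite neq_ltn => /orP[] lt.
  have : (d.+1)%:R * sigma <= d1%:R * sigma by rewrite ler_wpM2r ?ler_nat//; lra.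
  by rewrite -(@natr1 R d) mulrDl mul1r; lra.
have : (d1.+1)%:R * sigma <= d%:R * sigma by rewrite ler_wpM2r ?ler_nat//; lra.
by rewrite -(@natr1 R d1) mulrDl mul1r; lra.
Qed.

End FixedComb.
End Combs.

(** * The tree of cells *)

(* Plateau i prescribes the value [pc i] of the spectrum on [pa i, pb i]. *)
Record plateaux (R : realType) := Plateaux {
  pinf : R; pa : nat -> R; pb : nat -> R; pc : nat -> R;
  pinf_gt0 : 0 < pinf;
  pinf_le : forall i, pinf <= pa i;
  pa_le_pb : forall i, pa i <= pb i;
  pb_lt1 : forall i, pb i < 1;
  pc_ge0 : forall i, 0 <= pc i;
  pc_lt_pa : forall i, pc i < pa i }.

Section Tree.
Context {R : realType} (t : plateaux R).

Definition gap (i : nat) : nat := (Num.truncn ((pa t i - pc t i)^-1)).+1.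

(** Since gap i * (pa i - pc i) >= 1, the first factor gives [depth_gap] for all plateaux i < j at
    once, and j+1 alone makes depth j negligible against depth (j+1). In the second factor, one
    depth j pays for the number of cells of level j and the other for comparison with their length;
    one j pays for the grid of exponents, the other for summation over the levels, and 10 for
    numerical constants. *)
Fixpoint depth_rec (j : nat) : nat :=
  if j is j'.+1 then
    ((j'.+1 + \sum_(0 <= i < j') gap i) * (2 * depth_rec j' + 2 * j' + 10))%N
  else 0%N.

(* The cells of level j are the dyadic intervals of length 2^-(depth j). *)
Definition depth : nat -> nat := locked depth_rec.

Lemma depthS j : depth j.+1 =
  ((j.+1 + \sum_(0 <= i < j) gap i) * (2 * depth j + 2 * j + 10))%N.
Proof. by rewrite /depth -lock. Qed.

Lemma pa_lt1 i : pa t i < 1.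
Proof. exact: le_lt_trans (pa_le_pb t i) (pb_lt1 t i). Qed.

Lemma pc_lt1 i : pc t i < 1.
Proof. exact: lt_trans (pc_lt_pa t i) (pa_lt1 i). Qed.

Lemma depth_quad j : (j.+1 * (2 * depth j + 2 * j + 10) <= depth j.+1)%N.
Proof. by rewrite depthS leq_mul2r leq_addr orbT. Qed.

Lemma gapP i : 1 <= (gap i)%:R * (pa t i - pc t i).
Proof.
have p0 : 0 < pa t i - pc t i by rewrite subr_gt0 pc_lt_pa.
rewrite -ler_pdivrMr// div1r; exact: ltW (truncnS_gt _).
Qed.

Lemma depth_gap i j : (i < j)%N ->
  2 * (depth j)%:R + 2 * j%:R + 10 <= (depth j.+1)%:R * (pa t i - pc t i).
Proof.
move=> ij; have p0 : 0 <= pa t i - pc t i by rewrite subr_ge0 ltW// pc_lt_pa.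
have B0 : (0 : R) <= (2 * depth j + 2 * j + 10)%:R by rewrite ler0n.
apply: (@le_trans _ _ ((gap i)%:R * (2 * depth j + 2 * j + 10)%:R * (pa t i - pc t i))).
  rewrite mulrAC -[leLHS]mul1r; apply: ler_pM => //.
  - exact: gapP.
  - by rewrite !(natrD, natrM).
rewrite ler_wpM2r// -natrM ler_nat depthS leq_mul2r; apply/orP; right.
rewrite addnC (big_cat_nat (n := i.+1))//= big_nat_recr//=; lia.
Qed.

Lemma depth_sq j : (j * j <= depth j.+1)%N.
Proof. by apply: leq_trans (depth_quad j); apply: leq_mul; lia. Qed.

(** The number of free binary digits in the index of a child: 2^digs is r_{j+1}^-c up to a factor 2
    and carries the dimension. The j further digits in [nchildren] select the exponent and are
    negligible. *)
Definition digs j i : nat := Num.truncn (pc t i * (depth j.+1)%:R).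

Lemma digs_le j i : (digs j i)%:R <= pc t i * (depth j.+1)%:R.
Proof. by rewrite truncn_le mulr_ge0// pc_ge0. Qed.

Lemma digs_gt j i : pc t i * (depth j.+1)%:R < (digs j i)%:R + 1.
Proof. by rewrite natr1 truncnS_gt. Qed.

Lemma depth_room i j : (i < j)%N ->
  (digs j i + 2 * depth j + 2 * j + 10 <= depth j.+1)%N.
Proof.
move=> ij; rewrite -(@ler_nat R) !(natrM, natrD).
have := depth_gap ij; have := digs_le j i.
have : (depth j.+1)%:R * (pa t i - pc t i) <= (depth j.+1)%:R * (1 - pc t i).
  by rewrite ler_wpM2l// lerD2r ltW// pa_lt1.
by rewrite !mulrBr mulr1 [pc t i * _]mulrC; lra.
Qed.

Lemma depth_succ j : (depth j + j + 10 <= depth j.+1)%N.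
Proof. by apply: leq_trans (depth_quad j); rewrite mulSn; lia. Qed.

Lemma depth_ge j : (j <= depth j)%N.
Proof. by case: j => // j; have := depth_succ j; lia. Qed.

Lemma depth_mono j k : (j <= k)%N -> (depth j <= depth k)%N.
Proof.
move=> /subnK <-; elim: (k - j)%N => // n IH; apply: leq_trans IH _.
by rewrite addSn; have := depth_succ (n + j); lia.
Qed.

Definition len j : R := 2^-1 ^+ depth j.

(** Chosen so that the children fill exactly the second quarter of their cell ([cnt_spc]). The root
    sits at three quarters, and the first quarter is an empty margin that separates neighboring
    cells. *)
Definition spc j i : R := 2^-1 ^+ (depth j + 2 + j + digs j i).

Definition nchildren j i : nat := 2 ^ (j + digs j i).

Lemma len_gt0 j : 0 < len j. Proof. by rewrite exprn_gt0. Qed.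

Lemma spc_gt0 j i : 0 < spc j i. Proof. by rewrite exprn_gt0. Qed.

Lemma cnt_gt0 j i : (0 < nchildren j i)%N. Proof. by rewrite expn_gt0. Qed.

Lemma len_p2 j : len j = p2 (- (depth j)%:R). Proof. by rewrite p2Nn. Qed.

Lemma spc_p2 j i : spc j i = p2 (- ((depth j)%:R + 2 + j%:R + (digs j i)%:R)).
Proof. by rewrite -!natrD p2Nn. Qed.

Lemma cnt_p2 j i : (nchildren j i)%:R = p2 (j%:R + (digs j i)%:R) :> R.
Proof. by rewrite -natrD p2n natrX. Qed.

Lemma cnt_spc j i : (nchildren j i)%:R * spc j i = len j / 4.
Proof.
have -> : 4^-1 = p2 (- 2) :> R by rewrite p2N (p2n 2) -natrX.
by rewrite cnt_p2 spc_p2 len_p2 -!p2D; congr p2; lra.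
Qed.

Lemma len_spc j i : (i < j)%N -> len j.+1 <= spc j i / 4.
Proof.
move=> ij; have -> : 4^-1 = p2 (- 2) :> R by rewrite p2N (p2n 2) -natrX.
rewrite spc_p2 len_p2 -!p2D ler_p2.
have := depth_room ij; rewrite -(@ler_nat R) !(natrM, natrD).
by have := ler0n R j; have := ler0n R (depth j); lra.
Qed.

Lemma len_succ j : len j.+1 <= len j / 16.
Proof.
have -> : 16^-1 = p2 (- 4) :> R by rewrite p2N (p2n 4) -natrX.
rewrite !len_p2 -p2D ler_p2.
have := depth_succ j; rewrite -(@ler_nat R) !natrD.
by have := ler0n R j; lra.
Qed.

(* Exponents run through a grid of [pa i, pb i] of mesh 2^-j; the grid point is
   read off the leading part of the index d of the child. *)
Definition expo j i (d : nat) : R :=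
  pa t i + (pb t i - pa t i) * (d %/ 2 ^ digs j i)%:R / 2 ^+ j.

Definition mass j i (d : nat) : R := p2 (- (depth j.+1)%:R * expo j i d).

Lemma expo_ge j i d : pa t i <= expo j i d.
Proof. by rewrite /expo lerDl -mulrA !mulr_ge0 ?invr_ge0 ?exprn_ge0// subr_ge0 pa_le_pb. Qed.

Lemma expo_le j i d : (d < nchildren j i)%N -> expo j i d <= pb t i.
Proof.
move=> dc; have b0 : 0 <= pb t i - pa t i by rewrite subr_ge0 pa_le_pb.
rewrite /expo -mulrA -lerBrDl ler_piMr// ler_pdivrMr ?exprn_gt0// mul1r.
by rewrite -natrX ler_nat ltnW// ltn_divLR ?expn_gt0// -expnD.
Qed.

Lemma mass_le j i d alpha : alpha <= expo j i d -> mass j i d <= p2 (- (depth j.+1)%:R * alpha).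
Proof. by move=> h; rewrite ler_p2 !mulNr lerN2 ler_wpM2l. Qed.

Lemma mass_bounds j i d : 0 <= mass j i d <= p2 (- (depth j.+1)%:R * pa t i).
Proof. by rewrite p2_ge0 mass_le// expo_ge. Qed.

(** The 2-adic valuation of j+1 takes every value infinitely often, so each plateau starts Cantor
    sets at arbitrarily fine levels; it is at most j, so a plateau is active only at levels where
    [depth_gap] applies to it. *)
Definition gen j : nat := logn 2 j.+1.

Lemma gen_le j : (gen j <= j)%N.
Proof.
rewrite /gen -ltnS; apply: leq_trans (ltn_expl _ (ltnSn 1)) _.
by rewrite dvdn_leq// pfactor_dvdnn.
Qed.

Lemma gen_cofinal i j0 : exists2 j, (j0 <= j)%N & gen j = i.
Proof.
exists (2 ^ i * (2 * j0).+1).-1; last first.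
  rewrite /gen prednK ?muln_gt0 ?expn_gt0// lognM ?expn_gt0// pfactorK//.
  by rewrite (@lognE 2) /= dvdn2 /= oddM /= addn0.
rewrite -ltnS prednK ?muln_gt0 ?expn_gt0//.
by apply: leq_trans (leq_pmull _ _); rewrite ?expn_gt0//; lia.
Qed.

Definition depth_incr j : nat := depth j.+1 - depth j.

(** Here and in [child_pos], offsets inside the parent cell are measured in cells of the next
    level. *)
Definition root_pos j : nat := 3 * 2 ^ (depth_incr j - 2).

Definition child_pos j i (d : nat) : nat :=
  2 ^ (depth_incr j - 2) + d * 2 ^ (depth j.+1 - (depth j + 2 + j + digs j i)).

(* [act j k] is the plateau of the Cantor set to which the k-th cell of level j
   belongs, if any. Every cell contains one root, where a new Cantor set starts;
   only Cantor cells have children, and only children carry mass. A point whose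
   plateau changes infinitely often lies in infinitely many roots, which happens
   only on a set of dimension 0. *)
Fixpoint act (j k : nat) : option nat :=
  if j is j'.+1 then
    let p := (k %% 2 ^ depth_incr j')%N in
    if p == root_pos j' then Some (gen j') else
    if act j' (k %/ 2 ^ depth_incr j') is Some i then
      if [exists d : 'I_(nchildren j' i), p == child_pos j' i d] then Some i else None
    else None
  else None.

Lemma act_lt j k i : act j k = Some i -> (i < j)%N.
Proof.
elim: j k => //= j IH k; case: ifP => _ => [[<-]|]; first by rewrite ltnS gen_le.
case E : (act j _) => [i'|]//; case: ifP => // _ [ii]; rewrite ii in E.
by rewrite ltnS ltnW// (IH _ E).
Qed.

Definition teeth j i k : R -> R :=
  comb (nchildren j i) (mass j i) (k%:R * len j + len j / 4) (spc j i) (len j.+1).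

(** Each level brings masses of its own, with no consistency required between a cell and its
    children. Since the layers are added up, the exponents of successive children can be chosen
    independently. *)
Definition layer j (x : R) : R :=
  \sum_(k < 2 ^ depth j) if act j k is Some i then teeth j i k x else 0.

Definition cantor_sum : R -> R := fseries layer.

End Tree.

Section TreeGeometry.
Context {R : realType} (t : plateaux R).
Implicit Types (x y z : R) (i j k d : nat).

Notation depth := (depth t).
Notation len := (len t).
Notation spc := (spc t).
Notation cnt := (nchildren t).
Notation act := (act t).
Notation incr := (depth_incr t).

Definition cell j x : nat := Num.truncn (2 ^+ depth j * x).

Definition child_left j i k d : R := k%:R * len j + len j / 4 + d%:R * spc j i.

Definition root_left j k : R := k%:R * len j + 3 * (len j / 4).

Lemma exp2_half m n : (m <= n)%N -> 2 ^+ m * 2^-1 ^+ n = 2^-1 ^+ (n - m) :> R.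
Proof.
move=> mn; rewrite -{1}(subnK mn) exprD mulrC -mulrA -exprMn mulVf//.
by rewrite expr1n mulr1.
Qed.

Lemma exp2_len j : 2 ^+ depth j * len j = 1.
Proof. by rewrite /len exp2_half// subnn. Qed.

Lemma drop_len j : (2 ^ incr j)%:R * len j.+1 = len j.
Proof.
by rewrite natrX exp2_half ?leq_subr// subKn// depth_mono.
Qed.

Lemma drop_ge2 j : (2 <= incr j)%N.
Proof. by rewrite /depth_incr; have := depth_succ t j; lia. Qed.

Lemma quarter_len j : (2 ^ (incr j - 2))%:R * len j.+1 = len j / 4.
Proof.
rewrite -(drop_len j) -{2}(subnK (drop_ge2 j)) expnD natrM (natrX _ 2 2); by field.
Qed.

Lemma child_len i j : (i < j)%N ->
  (2 ^ (depth j.+1 - (depth j + 2 + j + digs t j i)))%:R * len j.+1 = spc j i.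
Proof.
move=> ij; rewrite natrX exp2_half ?leq_subr// subKn//.
by have := depth_room t ij; lia.
Qed.

Lemma cell_spec j x : 0 <= x -> (cell j x)%:R * len j <= x < (cell j x).+1%:R * len j.
Proof.
move=> x0; have /truncn_itv : 0 <= 2 ^+ depth j * x by rewrite mulr_ge0 ?exprn_ge0.
rewrite -/(cell j x) => /andP[h1 h2]; have l0 := len_gt0 t j.
have e : x = (2 ^+ depth j * x) * len j by rewrite mulrAC exp2_len mul1r.
by rewrite {2 3}e ler_pM2r// ltr_pM2r// h1 h2.
Qed.

Lemma cellE j x k : k%:R * len j <= x < k.+1%:R * len j -> cell j x = k.
Proof.
move=> /andP[h1 h2]; apply: truncn_def; have P0 : 0 < (2 : R) ^+ depth j by rewrite exprn_gt0.
have e n : n%:R = 2 ^+ depth j * (n%:R * len j) by rewrite mulrCA exp2_len mulr1.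
by rewrite [k%:R]e [k.+1%:R]e ler_pM2l// ltr_pM2l// h1 h2.
Qed.

Lemma cell_parent j x : 0 <= x -> cell j x = (cell j.+1 x %/ 2 ^ incr j)%N.
Proof.
move=> x0; have /andP[h1 h2] := cell_spec j.+1 x0; set K := cell j.+1 x in h1 h2 *.
have l0 := ltW (len_gt0 t j.+1); apply: cellE; rewrite -(drop_len j) !mulrA -!natrM.
apply/andP; split.
  by apply: le_trans h1; rewrite ler_wpM2r// ler_nat leq_divM.
apply: lt_le_trans h2 _; rewrite ler_wpM2r// ler_nat.
by rewrite ltn_ceil// expn_gt0.
Qed.

Lemma cell_split j x : 0 <= x ->
  (cell j.+1 x)%:R * len j.+1 =
  (cell j x)%:R * len j + (cell j.+1 x %% 2 ^ incr j)%:R * len j.+1.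
Proof.
move=> x0; rewrite {1}(divn_eq (cell j.+1 x) (2 ^ incr j)) -cell_parent//.
by rewrite natrD natrM mulrDl -mulrA drop_len.
Qed.

Lemma root_pos_len j : (root_pos t j)%:R * len j.+1 = 3 * (len j / 4).
Proof. by rewrite natrM -mulrA quarter_len. Qed.

Lemma child_pos_len j i d : (i < j)%N ->
  (child_pos t j i d)%:R * len j.+1 = len j / 4 + d%:R * spc j i.
Proof. by move=> ij; rewrite natrD mulrDl quarter_len natrM -mulrA child_len. Qed.

Definition in_root j x := root_left j (cell j x) <= x < root_left j (cell j x) + len j.+1.

Definition in_child j i d x :=
  child_left j i (cell j x) d <= x < child_left j i (cell j x) d + len j.+1.

Lemma act_succ j x i : 0 <= x -> act j.+1 (cell j.+1 x) = Some i ->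
  in_root j x \/
  (act j (cell j x) = Some i /\ exists2 d, (d < cnt j i)%N & in_child j i d x).
Proof.
move=> x0 /=; have := cell_spec j.+1 x0.
rewrite -(@natr1 R (cell j.+1 x)) mulrDl mul1r cell_split// -cell_parent//.
set p := (_ %% _)%N => hx; case: eqP => [pe _|_].
  by left; move: hx; rewrite pe root_pos_len.
case E : (act j (cell j x)) => [i'|]//; case: ifP => // /existsP[d /eqP pd] [ii].
right; rewrite -ii; split => //; exists d => //.
by move: hx; rewrite pd (child_pos_len _ (act_lt E)) addrA.
Qed.

Lemma root_lt_drop j : (root_pos t j < 2 ^ incr j)%N.
Proof.
rewrite /root_pos -{2}(subnK (drop_ge2 j)) expnD mulnC ltn_pmul2l//.
by rewrite expn_gt0.
Qed.

Lemma child_lt_root i j d : (i < j)%N -> (d < cnt j i)%N -> (child_pos t j i d < root_pos t j)%N.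
Proof.
move=> ij dc; rewrite -(ltr_nat R) -(ltr_pM2r (len_gt0 t j.+1)) root_pos_len child_pos_len//.
have : d.+1%:R * spc j i <= (cnt j i)%:R * spc j i.
  by rewrite ler_pM2r ?spc_gt0// ler_nat.
rewrite cnt_spc -(@natr1 R d) mulrDl mul1r; have := spc_gt0 t j i; have := len_gt0 t j.
lra.
Qed.

Lemma cell_pos j k p x : (p < 2 ^ incr j)%N ->
  k%:R * len j + p%:R * len j.+1 <= x < k%:R * len j + p%:R * len j.+1 + len j.+1 ->
  cell j.+1 x = (k * 2 ^ incr j + p)%N.
Proof.
move=> pd hx; apply: cellE; rewrite -(@natr1 R (k * 2 ^ incr j + p)) mulrDl mul1r.
by rewrite natrD natrM mulrDl -mulrA drop_len.
Qed.

Lemma act_root j k x : root_left j k <= x < root_left j k + len j.+1 ->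
  act j.+1 (cell j.+1 x) = Some (gen j).
Proof.
rewrite /root_left -root_pos_len => /(cell_pos (root_lt_drop j)) ->.
by rewrite /= modnMDl modn_small ?root_lt_drop// eqxx.
Qed.

Lemma act_child j i k d x : act j k = Some i -> (d < cnt j i)%N ->
  child_left j i k d <= x < child_left j i k d + len j.+1 ->
  act j.+1 (cell j.+1 x) = Some i.
Proof.
move=> ak dc; have ij := act_lt ak; have cr := child_lt_root ij dc.
have pd := ltn_trans cr (root_lt_drop j).
rewrite /child_left -addrA -child_pos_len// => /(cell_pos pd) ->.
rewrite /= modnMDl modn_small// (ltn_eqF cr) divnMDl ?expn_gt0// divn_small// addn0 ak.
by case: ifP => // /existsP[]; exists (Ordinal dc).
Qed.

(** This is the index of the cell of x = 1, one past the range of the sum in [layer]; its offset 0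
    in the parent is neither that of a root nor that of a child. *)
Lemma act_top j : act j (2 ^ depth j) = None.
Proof.
case: j => // j; have dd : (depth j <= depth j.+1)%N by rewrite depth_mono.
have -> : (2 ^ depth j.+1 = 2 ^ depth j * 2 ^ incr j + 0)%N by rewrite addn0 -expnD subnKC.
rewrite /= modnMDl mod0n; case: eqP => [/esym/eqP|_].
  by rewrite muln_eq0 expn_eq0.
case: (act j _) => // i; case: ifP => // /existsP[d /eqP/esym/eqP].
by rewrite addn_eq0 expn_eq0.
Qed.

Lemma act_cell_lt1 j x i : 0 <= x <= 1 -> act j (cell j x) = Some i -> (cell j x < 2 ^ depth j)%N.
Proof.
move=> /andP[x0 x1]; rewrite ltn_neqAle; case: eqP => [->|_ _]; first by rewrite act_top.
rewrite /= -(@ler_nat R) natrX; apply: le_trans (_ : 2 ^+ depth j * x <= _).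
  by rewrite truncn_le mulr_ge0.
by rewrite ler_piMr.
Qed.

End TreeGeometry.

(** * Exponents of the Cantor sum *)

Section LayerEstimates.
Context {R : realType} (t : plateaux R).
Implicit Types (x y z u : R) (i j k d : nat).

Notation depth := (depth t).
Notation len := (len t).
Notation spc := (spc t).
Notation cnt := (nchildren t).
Notation act := (act t).
Notation cell := (cell t).
Notation layer := (layer t).
Notation teeth := (teeth t).

Let maxmass j i : R := p2 (- (depth j.+1)%:R * pa t i).

Lemma teeth_total i j : (i < j)%N ->
  (cnt j i)%:R * maxmass j i <= p2 (- (2 * (depth j)%:R + j%:R + 10)).
Proof.
move=> ij; rewrite cnt_p2 -p2D ler_p2.
by have := depth_gap t ij; have := digs_le t j i; rewrite mulrBr mulNr [pc t i * _]mulrC; lra.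
Qed.

(** The mean slope of the teeth at scales above their spacing. The mass r_{j+1}^a over a spacing of
    about r_{j+1}^c times a factor depending on level j is small because c < a. *)
Lemma teeth_ratio i j : (i < j)%N ->
  maxmass j i / spc j i <= p2 (- ((depth j)%:R + j%:R + 8)).
Proof.
move=> ij; rewrite spc_p2 -p2N -p2D ler_p2.
by have := depth_gap t ij; have := digs_le t j i; rewrite mulrBr mulNr [pc t i * _]mulrC; lra.
Qed.

Let massP j i d : (d < cnt j i)%N -> 0 <= mass t j i d <= maxmass j i.
Proof. by move=> _; exact: mass_bounds. Qed.

Let ls i j : (i < j)%N -> len j.+1 <= spc j i.
Proof.
move=> ij; apply: le_trans (len_spc t ij) _; have := spc_gt0 t j i; lra.
Qed.

Lemma teeth_mono i j k : (i < j)%N -> {homo teeth j i k : x y / x <= y}.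
Proof. by move=> ij x y xy; apply: (comb_mono _ _ (len_gt0 t j.+1) (@massP j i)). Qed.

Lemma layer_mono j : {homo layer j : x y / x <= y}.
Proof.
move=> x y xy; apply: ler_sum => k _; case E : (act j k) => [i|] //.
exact: teeth_mono (act_lt E) _ _ xy.
Qed.

Lemma layer_ge0 j x : 0 <= layer j x.
Proof.
apply: sumr_ge0 => k _; case E : (act j k) => [i|] //.
exact: (comb_ge0 _ _ _ (@massP j i)).
Qed.

Lemma layer_le j x : layer j x <= p2 (- ((depth j)%:R + j%:R + 10)).
Proof.
apply: (@le_trans _ _ (\sum_(k < 2 ^ depth j) p2 (- (2 * (depth j)%:R + j%:R + 10)))).
  apply: ler_sum => k _; case E : (act j k) => [i|]; last exact: p2_ge0.
  exact: le_trans (comb_le _ _ _ (@massP j i) _) (teeth_total (act_lt E)).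
rewrite sumr_const card_ord -[leLHS]mulr_natl natrX -p2n -p2D ler_p2; lra.
Qed.

(** A crude constant, needed only for the finitely many levels before the precise estimates at a
    point begin. *)
Lemma layer_lip j : exists2 M, 0 <= M &
  forall x y, x <= y -> layer j y - layer j x <= M * (y - x).
Proof.
exists ((2 ^ depth j)%:R * (len j.+1)^-1).
  by rewrite mulr_ge0// invr_ge0 ltW// len_gt0.
move=> x y xy; rewrite -sumrB -mulrA.
rewrite -[in leRHS](card_ord (2 ^ depth j)) -sum1_card natr_sum mulr_suml.
apply: ler_sum => k _; rewrite mul1r; have l0 := len_gt0 t j.+1.
case E : (act j k) => [i|]; last first.
  by rewrite subrr mulr_ge0 ?subr_ge0// invr_ge0 ltW.
apply: le_trans (comb_lip _ _ l0 (@massP j i) xy) _.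
rewrite ler_wpM2r ?subr_ge0// ler_piMl ?invr_ge0 ?(ltW l0)//.
apply: le_trans (teeth_total (act_lt E)) _.
by rewrite -[leRHS]p20 ler_p2; have := ler0n R j; have := ler0n R (depth j); lra.
Qed.

(** The teeth of a cell vary only in its second quarter, so an interval shorter than len/8 that
    meets them and contains z forces z into that same cell. *)
Lemma layer_local j x y z : x <= z <= y -> y - x < len j / 8 ->
  layer j y - layer j x = 0 \/
  exists k i, [/\ act j k = Some i, cell j z = k &
    layer j y - layer j x = teeth j i k y - teeth j i k x].
Proof.
move=> /andP[xz zy] yx; have l0 := len_gt0 t j.
pose F (k : 'I_(2 ^ depth j)) z := if act j k is Some i then teeth j i k z else 0.
have -> : layer j y - layer j x = \sum_k (F k y - F k x) by rewrite sumrB.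
have Fcell (k : 'I_(2 ^ depth j)) : F k y - F k x != 0 -> cell j z = k.
  rewrite /F; case E : (act j k) => [i|]; last by rewrite subrr eqxx.
  have cs := cnt_spc t j i; have ij := act_lt E => ne.
  have h1 : k%:R * len j + len j / 4 < y.
    rewrite ltNge; apply: contra ne => h; rewrite subr_eq0; apply/eqP.
    by apply: (comb_left _ _ (len_gt0 t j.+1) (ls ij)) => //; lra.
  have h2 : x < k%:R * len j + len j / 4 + (cnt j i)%:R * spc j i.
    rewrite ltNge; apply: contra ne => h; rewrite subr_eq0; apply/eqP.
    by apply: (comb_right _ (len_gt0 t j.+1) (ls ij)) => //; lra.
  apply: cellE; rewrite -(@natr1 R k) mulrDl mul1r; rewrite cs in h2.
  by apply/andP; split; lra.
have [k1 dk1|all0] := pickP (fun k : 'I_(2 ^ depth j) => F k y - F k x != 0); last first.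
  left; apply: big1 => k _; have := all0 k.
  by move=> /negbT; rewrite negbK => /eqP.
right; have kz := Fcell _ dk1; have : F k1 y - F k1 x != 0 by [].
rewrite (bigD1 k1)//= big1 ?addr0; last first.
  move=> k kk; apply/eqP; apply: contraTT kk => /Fcell kz'.
  by rewrite negbK; apply/eqP/val_inj => /=; rewrite -kz -kz'.
rewrite /F; case E : (act j k1) => [i|]; last by rewrite subrr eqxx.
by move=> _; exists k1, i.
Qed.

Lemma min1_le_powR u alpha : 0 < u -> 0 <= alpha <= 1 -> Num.min 1 u <= u `^ alpha.
Proof.
move=> u0 /andP[a0 a1]; case: (leP 1 u) => [u1|/ltW u1].
  by rewrite -(powRr0 u) ler_powR.
by apply: ger1_powR => //; rewrite u0 u1.
Qed.

(** Three regimes. Above len/8 the whole layer is smaller than the claim; between spc/4 and len/8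
    the mean slope of the teeth is at most 2^-j up to constants already paid for; below spc/4 a
    single tooth of mass at most r_{j+1}^alpha' is met, and min(1, u) <= u^alpha. The loss alpha' -
    alpha yields the factor 2^-j that makes the layers summable. *)
Lemma layer_hoelder j alpha alpha' x y z :
  x <= z <= y -> y - x <= 1 -> 0 <= alpha <= 1 ->
  j%:R <= (depth j.+1)%:R * (alpha' - alpha) ->
  (forall i d, act j (cell j z) = Some i -> (d < cnt j i)%N ->
     `|z - child_left t j i (cell j z) d| < spc j i / 2 -> alpha' <= expo t j i d) ->
  layer j y - layer j x <= 2^-1 ^+ j * (y - x) `^ alpha.
Proof.
move=> xzy yx1 /andP[a0 a1] ja Hz; have xy : x <= y by case/andP: xzy => ?; apply: le_trans.
have [->|yx] := eqVneq y x; first by rewrite !subrr mulr_ge0 ?powR_ge0 ?exprn_ge0.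
have t0 : 0 < y - x by rewrite subr_gt0 lt_neqAle eq_sym yx.
have ttal : y - x <= (y - x) `^ alpha by apply: ger1_powR => //; rewrite t0.
suff : layer j y - layer j x <= 2^-1 ^+ j * (y - x) \/
    layer j y - layer j x <= 2^-1 ^+ j * (y - x) `^ alpha.
  by case => // h; apply: le_trans h _; rewrite ler_wpM2l ?exprn_ge0.
have j0 := ler0n R j; have d0 := ler0n R (depth j).
have [far|near] := leP (len j / 8) (y - x).
  left; apply: (@le_trans _ _ (2^-1 ^+ j * (len j / 8))).
    have := layer_le j y; have := layer_ge0 j x.
    have -> : 8^-1 = p2 (- 3) :> R by rewrite p2N (p2n 3) -natrX.
    rewrite -p2Nn len_p2 -!p2D => h1 h2.
    apply: le_trans (_ : p2 (- ((depth j)%:R + j%:R + 10)) <= _); first lra.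
    by rewrite ler_p2; lra.
  by rewrite ler_wpM2l// exprn_ge0.
have [->|[k [i [ak kz ->]]]] := layer_local xzy near.
  by left; rewrite mulr_ge0 ?(ltW t0)// exprn_ge0.
have ij := act_lt ak; have s0 := spc_gt0 t j i; have l0 := len_gt0 t j.+1.
have [far|{}near] := leP (spc j i / 4) (y - x).
  left; apply: le_trans (comb_count _ (cnt_gt0 t j i) l0 (ls ij) (@massP j i) xy) _.
  apply: (@le_trans _ _ (maxmass j i / spc j i * 5 * (y - x))).
    rewrite -!mulrA ler_wpM2l ?p2_ge0//.
    rewrite (_ : (y - x) / spc j i + 1 = (spc j i)^-1 * ((y - x) + spc j i)); last first.
      by field; rewrite gt_eqF.
    by rewrite ler_pM2l ?invr_gt0//; move: far; lra.
  rewrite ler_pM2r//; apply: (@le_trans _ _ (p2 (- ((depth j)%:R + j%:R + 8)) * p2 3)).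
    apply: ler_pM; rewrite ?divr_ge0 ?p2_ge0 ?(ltW s0) ?teeth_ratio//.
    by rewrite (p2n 3) -natrX ler_nat.
  by rewrite -p2D -p2Nn ler_p2; lra.
right; pose mm := p2 (- (depth j.+1)%:R * alpha').
apply: le_trans (_ : mm * Num.min 1 ((y - x) / len j.+1) <= _).
  apply: (comb_near l0 (@massP j i) xzy (len_spc t ij) near (p2_ge0 _)) => d dc hd.
  apply: mass_le; by apply: (Hz i d) => //; rewrite kz.
apply: le_trans (_ : mm * ((y - x) / len j.+1) `^ alpha <= _).
  by rewrite ler_wpM2l ?p2_ge0// min1_le_powR ?a0// divr_gt0.
rewrite powRM ?invr_ge0 ?(ltW t0) ?(ltW l0)// len_p2 -p2N p2M mulrCA mulrC -p2D.
rewrite ler_wpM2r ?powR_ge0// -p2Nn ler_p2.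
by move: ja; rewrite mulrBr opprK mulNr; lra.
Qed.

End LayerEstimates.

Section CantorSumExponents.
Context {R : realType} (t : plateaux R).
Implicit Types (x y z u : R) (i j k d : nat).

Notation depth := (depth t).
Notation len := (len t).
Notation spc := (spc t).
Notation cnt := (nchildren t).
Notation act := (act t).
Notation cell := (cell t).
Notation layer := (layer t).
Notation H := (cantor_sum t).

Lemma sum_half_le (N : nat) : \sum_(0 <= n < N) 2^-1 ^+ n <= 2 :> R.
Proof.
suff -> : \sum_(0 <= n < N) 2^-1 ^+ n = 2 - 2 * 2^-1 ^+ N :> R.
  by rewrite gerBl mulr_ge0// exprn_ge0.
elim: N => [|N IH]; first by rewrite big_nil expr0 mulr1 subrr.
by rewrite big_nat_recr//= IH exprS; field.
Qed.

Lemma layer_cvg x : (fun N => \sum_(0 <= n < N) layer n x) @ \oo --> H x.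
Proof.
apply: fseries_cvg sum_half_le => j; rewrite layer_ge0/=.
apply: le_trans (layer_le t j x) _; rewrite -p2Nn ler_p2.
by have := ler0n R j; have := ler0n R (depth j); lra.
Qed.

Lemma cantor_sum_mono : {homo H : x y / x <= y}.
Proof.
move=> x y xy; rewrite -subr_ge0.

apply: (@fseries_diff_ge _ layer _ _ _ 0 (@layer_cvg x) (@layer_cvg y)) => N _.
by apply: sumr_ge0 => j _; rewrite subr_ge0 layer_mono.
Qed.

Lemma cantor_sum_hoelder x alpha alpha' j1 :
  0 <= alpha < alpha' -> alpha' <= 1 ->
  (forall j i d, (j1 <= j)%N -> act j (cell j x) = Some i -> (d < cnt j i)%N ->
     `|x - child_left t j i (cell j x) d| < spc j i / 2 -> alpha' <= expo t j i d) ->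
  hoelder_at H `[0, 1] alpha x.
Proof.
move=> /andP[a0 aa'] a'1 Hx; have eta0 : 0 < alpha' - alpha by rewrite subr_gt0.
(* From here on j (alpha' - alpha) >= 1, and depth (j+1) >= j^2 turns this into the hypothesis of
   [layer_hoelder]. *)
pose j2 := maxn j1 (Num.truncn (alpha' - alpha)^-1).+1.
pose M j := projT1 (cid2 (layer_lip t j)).
have M0 j : 0 <= M j by rewrite /M; case: cid2.
have ML j u v : u <= v -> layer j v - layer j u <= M j * (v - u).
  by rewrite /M; case: cid2 => /= m _; apply.
pose C := \sum_(0 <= j < j2) M j + 2.
have C0 : 0 < C by rewrite ltr_wpDl// sumr_ge0.
exists C, 1; split => // y Dy y1.
pose u := Num.min x y; pose v := Num.max x y.
have [uv uxv vuE HE] : [/\ u <= v, u <= x <= v, v - u = `|y - x| & `|H y - H x| = H v - H u].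
  rewrite /u /v; case: (leP x y) => [xy|/ltW yx].
    by rewrite !ger0_norm ?subr_ge0 ?cantor_sum_mono// lexx xy.
  rewrite -[`|y - x|]normrN -[`|H y - H x|]normrN !opprB.
  by rewrite !ger0_norm ?subr_ge0 ?cantor_sum_mono// lexx yx.
rewrite HE; apply: (@fseries_diff_le _ layer _ _ _ (@layer_cvg u) (@layer_cvg v)) => N.
have pow0 : 0 <= `|y - x| `^ alpha by exact: powR_ge0.
have lin : `|y - x| <= `|y - x| `^ alpha.
  have [->|yx] := eqVneq (y - x) 0; first by rewrite normr0 powR_ge0.
  by apply: ger1_powR; rewrite ?normr_gt0 ?yx ?(ltW y1)//; lra.
apply: (@le_trans _ _ (\sum_(0 <= j < N) ((if (j < j2)%N then M j else 0) + 2^-1 ^+ j)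
    * `|y - x| `^ alpha)).
  apply: ler_sum => j _; case: ltnP => j2j.
    apply: le_trans (ML _ _ _ uv) _; rewrite vuE mulrDl -[leLHS]addr0; apply: lerD.
      by rewrite ler_wpM2l.
    by rewrite mulr_ge0// exprn_ge0.
  rewrite add0r -vuE; apply: (layer_hoelder (alpha' := alpha') uxv).
  - by rewrite vuE ltW.
  - by apply/andP; split; lra.
  - have jn : (Num.truncn (alpha' - alpha)^-1).+1%:R <= j%:R :> R.
      by rewrite ler_nat; apply: leq_trans j2j; rewrite leq_maxr.
    have j1' : 1 <= j%:R * (alpha' - alpha).
      rewrite -ler_pdivrMr// div1r; apply: le_trans jn; exact: ltW (truncnS_gt _).
    have dj := depth_sq t j.
    apply: (@le_trans _ _ ((j * j)%:R * (alpha' - alpha))).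
      by rewrite natrM -mulrA ler_peMr.
    by rewrite ler_wpM2r ?(ltW eta0)// ler_nat.
  - move=> i d; apply: Hx; apply: leq_trans j2j; exact: leq_maxl.
rewrite -mulr_suml ler_wpM2r// big_split/=; apply: lerD; last exact: sum_half_le.
rewrite -big_mkcond /=.
apply: (@le_trans _ _ (\sum_(0 <= j < maxn N j2 | (j < j2)%N) M j)).
  rewrite (big_cat_nat (n := N) (p := maxn N j2)) ?leq_maxl//= lerDl.
  by apply: sumr_ge0.
rewrite (big_cat_nat (n := j2) (p := maxn N j2)) ?leq_maxr//= [X in _ + X]big1_seq ?addr0.
  by rewrite big_mkcond; apply: ler_sum => j _; case: ifP.
by move=> j /andP[jl]; rewrite mem_index_iota leqNgt jl.
Qed.

Lemma child_mass_jump j i k d : (k < 2 ^ depth j)%N -> act j k = Some i ->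
  (d < cnt j i)%N ->
  mass t j i d <= H (child_left t j i k d + len j.+1) - H (child_left t j i k d).
Proof.
move=> klt ak dc; set L := child_left _ _ _ _ _; have l0 := len_gt0 t j.+1.
have LL : L <= L + len j.+1 by rewrite lerDl ltW.
apply: (@fseries_diff_ge _ layer _ _ _ j.+1 (@layer_cvg _) (@layer_cvg _)) => N jN.
rewrite (bigD1_seq j) ?mem_index_iota ?iota_uniq//= -[leLHS]addr0; apply: lerD; last first.
  by apply: sumr_ge0 => l _; rewrite subr_ge0 layer_mono.
rewrite /layer -sumrB (bigD1 (Ordinal klt))//= ak -[leLHS]addr0; apply: lerD.
  by apply: (comb_tooth _ _ l0 _ dc) => e _; exact: mass_bounds.
apply: sumr_ge0 => k' _; case E : (act j k') => [i'|]; last by rewrite subrr.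
by rewrite subr_ge0 teeth_mono// (act_lt E).
Qed.

Lemma child_bounds j i x d : 0 <= x <= 1 -> act j (cell j x) = Some i ->
  (d < cnt j i)%N ->
  0 <= child_left t j i (cell j x) d /\ child_left t j i (cell j x) d + len j.+1 <= 1.
Proof.
move=> x01 ak dc; have klt := act_cell_lt1 x01 ak; have ij := act_lt ak.
have l0 := len_gt0 t j; have l1 := len_gt0 t j.+1; have s0 := spc_gt0 t j i.
have k0 := ler0n R (cell j x); have d0 := ler0n R d.
split; first by rewrite /child_left !addr_ge0 ?mulr_ge0 ?divr_ge0 ?(ltW l0) ?(ltW s0).
have : (cell j x).+1%:R * len j <= 1.
  by rewrite -[leRHS](exp2_len t j) ler_pM2r// -natrX ler_nat.
have : d.+1%:R * spc j i <= (cnt j i)%:R * spc j i by rewrite ler_pM2r// ler_nat.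
rewrite cnt_spc -(@natr1 R d) -(@natr1 R (cell j x)) !mulrDl !mul1r /child_left.
by have := len_spc t ij; lra.
Qed.

(** Both ends of a child containing x are within r_{j+1} of x, and H grows between them by at least
    r_{j+1}^beta, which eventually exceeds twice C r_{j+1}^alpha. *)
Lemma cantor_sum_not_hoelder x alpha beta :
  0 <= x <= 1 -> 0 < alpha -> beta < alpha ->
  (forall j0, exists j i d, [/\ (j0 <= j)%N, act j (cell j x) = Some i,
     (d < cnt j i)%N, in_child t j i d x & expo t j i d <= beta]) ->
  ~ hoelder_at H `[0, 1] alpha x.
Proof.
move=> x01 a0 ba Hx [C [e [C0 e0 He]]].
have eta0 : 0 < alpha - beta by rewrite subr_gt0.
have [n Hn] := p2_exists_ge (2 * C).
have [m Hm] := p2_exists_ge (2 / e).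
pose j0 := maxn m.+1 (maxn n.+1 (Num.truncn (alpha - beta)^-1).+1).
have [j [i [d [j0j ak dc /andP[Lx xL] eb]]]] := Hx j0.
have klt := act_cell_lt1 x01 ak; have jump := child_mass_jump klt ak dc.
have [L0 L1] := child_bounds x01 ak dc.
set L := child_left _ _ _ _ _ in Lx xL jump L0 L1.
have l1 := len_gt0 t j.+1.
have mj : (m.+1 <= j)%N by apply: leq_trans j0j; rewrite leq_maxl.
have nj : (n.+1 <= j)%N by apply: leq_trans j0j; rewrite /j0 !leq_max leqnn orbT.
have tj : ((Num.truncn (alpha - beta)^-1).+1 <= j)%N.
  by apply: leq_trans j0j; rewrite /j0 !leq_max leqnn !orbT.
have le : len j.+1 < e.
  have : 2 * len j.+1 <= e; last by lra.
  rewrite len_p2 p2N ler_pdivrMr ?p2_gt0// mulrC -ler_pdivrMr//.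
  apply: le_trans Hm _; rewrite ler_p2 ler_nat.
  exact: leq_trans (ltnW mj) (leq_trans (leqnSn j) (depth_ge t j.+1)).
have pow y : `|y - x| <= len j.+1 -> 0 <= y <= 1 ->
    `|H y - H x| <= C * p2 (- (depth j.+1)%:R * alpha).
  move=> yx y01; apply: le_trans (He y _ (le_lt_trans yx le)) _.
    by rewrite /= in_itv.
  rewrite ler_wpM2l ?(ltW C0)// -p2M -len_p2.
  by apply: ge0_ler_powR; rewrite ?nnegrE ?(ltW l1) ?(ltW a0).
have h1 := pow (L + len j.+1); have h2 := pow L.
have {}h1 : `|H (L + len j.+1) - H x| <= C * p2 (- (depth j.+1)%:R * alpha).
  by apply: h1; [rewrite ger0_norm; lra|apply/andP; split; lra].
have {}h2 : `|H L - H x| <= C * p2 (- (depth j.+1)%:R * alpha).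
  by apply: h2; [rewrite distrC ger0_norm; lra|apply/andP; split; lra].
have hm : p2 (- (depth j.+1)%:R * beta) <= mass t j i d.
  by rewrite /mass ler_p2 !mulNr lerN2 ler_wpM2l.
have : p2 (- (depth j.+1)%:R * beta) <= 2 * C * p2 (- (depth j.+1)%:R * alpha).
  apply: le_trans hm (le_trans jump _).
  move: h1 h2; rewrite !ler_norml => /andP[_ h1] /andP[h2 _].
  by rewrite -mulrA; lra.
move=> /le_trans h; have {}h := h _ (ler_wpM2r (p2_ge0 _) Hn).
move: h; rewrite -p2D ler_p2 !mulNr => h.
have dj := depth_sq t j.
have j1 : 1 <= j%:R * (alpha - beta).
  rewrite -ler_pdivrMr// div1r; apply: le_trans (ltW (truncnS_gt _)) _.
  by rewrite ler_nat.
have : j%:R <= (depth j.+1)%:R * (alpha - beta).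
  apply: (@le_trans _ _ ((j * j)%:R * (alpha - beta))).
    by rewrite natrM -mulrA ler_peMr.
  by rewrite ler_wpM2r ?(ltW eta0)// ler_nat.
have : n.+1%:R <= j%:R :> R by rewrite ler_nat.
by rewrite -(@natr1 R n) mulrBr; lra.
Qed.

End CantorSumExponents.

(** * Upper bounds for the dimension *)

Section LevelSets.
Context {R : realType} (t : plateaux R).
Implicit Types (x y z u h : R) (i j k d : nat).

Notation depth := (depth t).
Notation len := (len t).
Notation spc := (spc t).
Notation cnt := (nchildren t).
Notation act := (act t).
Notation cell := (cell t).
Notation H := (cantor_sum t).

Lemma pinf_lt1 : pinf t < 1.
Proof. exact: le_lt_trans (pinf_le t 0) (pa_lt1 t 0). Qed.

Lemma cantor_sum_hoelder_pinf x alpha : 0 <= alpha < pinf t -> hoelder_at H `[0, 1] alpha x.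
Proof.
move=> a0; apply: (cantor_sum_hoelder (j1 := 0) a0 (ltW pinf_lt1)) => j i d _ _ _ _.
exact: le_trans (pinf_le t i) (expo_ge _ _ _ _).
Qed.

Lemma inactive_hoelder x alpha J : 0 <= alpha < 1 ->
  (forall j, (J <= j)%N -> act j (cell j x) = None) -> hoelder_at H `[0, 1] alpha x.
Proof.
move=> a0 none; apply: (cantor_sum_hoelder (j1 := J) a0 (lexx 1)) => j i d Jj.
by rewrite none.
Qed.

(** Without new roots a cell can be active only as a child of an active cell of the same plateau.
    Activity at arbitrarily fine levels therefore propagates back to level j0 and fixes one plateau
    throughout. *)
Lemma act_eventually x j0 : 0 <= x ->
  (forall j, (j0 <= j)%N -> ~ in_root t j x) ->
  (exists J, forall j, (J <= j)%N -> act j (cell j x) = None) \/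
  (exists i, forall j, (j0 <= j)%N -> act j (cell j x) = Some i /\
     exists2 d, (d < cnt j i)%N & in_child t j i d x).
Proof.
move=> x0 noroot; have back n i : act (j0 + n) (cell (j0 + n) x) = Some i ->
    forall m, (m < n)%N -> act (j0 + m) (cell (j0 + m) x) = Some i /\
      exists2 d, (d < cnt (j0 + m) i)%N & in_child t (j0 + m) i d x.
  elim: n => // n IH; rewrite addnS => /(act_succ x0)[|[an hd] m].
    by move/noroot; rewrite leq_addr => /(_ isT).
  by rewrite ltnS leq_eqVlt => /predU1P[->//|]; exact: IH.
have [ev|nev] := pselect (exists J, forall j, (J <= j)%N -> act j (cell j x) = None).
  by left.
have often J : exists2 n, (J < n)%N & exists i, act (j0 + n) (cell (j0 + n) x) = Some i.
  apply: contrapT => no; apply: nev; exists (j0 + J.+1)%N => j jJ.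
  case E : (act j (cell j x)) => [i|]//; exfalso; apply: no.
  exists (j - j0)%N; first by rewrite ltn_subRL; apply: leq_trans jJ; rewrite addnS.
  by exists i; rewrite subnKC//; apply: leq_trans jJ; rewrite leq_addr.
right; have [n0 n00 [i an0]] := often 0%N; exists i => j jj0.
have [n jn [i' an]] := often (j - j0)%N.
have [a0 _] := back _ _ an0 0%N n00.
have [a0' _] := back _ _ an 0%N (leq_ltn_trans (leq0n _) jn).
have ii : i' = i by move: a0'; rewrite a0 => -[->].
by have := back _ _ an _ jn; rewrite ii subnKC.
Qed.

(** Otherwise x is eventually inactive, with exponent at least 1, or stays in one plateau whose
    interval misses h: h < pa would make the exponent too large, h > pb too small. *)
Lemma exponent_level_limsup x h : 0 <= x <= 1 -> 0 < h < 1 -> hoelder_level H h x ->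
  forall j0, exists j, (j0 <= j)%N /\ (in_root t j x \/
    exists i d, [/\ act j (cell j x) = Some i, (d < cnt j i)%N, in_child t j i d x &
                    pa t i <= h <= pb t i]).
Proof.
move=> x01 /andP[h0 h1] [Hlow Hup] j0; apply: contrapT => no; have /andP[x0 _] := x01.
have noroot j : (j0 <= j)%N -> ~ in_root t j x.
  by move=> jj r; apply: no; exists j; split => //; left.
have [[J none]|[i all_i]] := act_eventually x0 noroot.
  apply: (Hup ((h + 1) / 2)); first by apply/andP; split; lra.
  by apply: inactive_hoelder none; apply/andP; split; lra.
have [a0 [d dc di]] := all_i _ (leqnn j0).
have : ~ (pa t i <= h <= pb t i).
  by move=> hi; apply: no; exists j0; split => //; right; exists i, d.
move/negP; rewrite negb_and -!ltNge => /orP[ha|hb].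
  have := pa_lt1 t i => p1; apply: (Hup ((h + pa t i) / 2)); first by apply/andP; split; lra.
  apply: (@cantor_sum_hoelder _ t x _ (pa t i) j0).
  - by apply/andP; split; lra.
  - exact: ltW.
  - move=> j i' d' jj aj _ _; have [aj' _] := all_i j jj.
    by move: aj; rewrite aj' => -[<-]; exact: expo_ge.
have bp : 0 < pb t i.
  exact: lt_le_trans (pinf_gt0 t) (le_trans (pinf_le t i) (pa_le_pb t i)).
have := Hlow ((pb t i + h) / 2); apply/not_implyP; split; first by apply/andP; split; lra.
apply: (@cantor_sum_not_hoelder _ t x _ (pb t i)) => //; [lra|lra|].
move=> J; have [aJ [e ec ei]] := all_i (maxn j0 J) (leq_maxl _ _).
by exists (maxn j0 J), i, e; split => //; [exact: leq_maxr|exact: expo_le].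
Qed.

Lemma irregular_limsup x alpha : 0 <= x <= 1 -> 0 <= alpha < 1 ->
  ~ hoelder_at H `[0, 1] alpha x ->
  forall j0, exists j, (j0 <= j)%N /\ (in_root t j x \/
    exists i d, [/\ act j (cell j x) = Some i, (d < cnt j i)%N & in_child t j i d x]).
Proof.
move=> /andP[x0 _] a01 nh j0; apply: contrapT => no; apply: nh.
apply: (@inactive_hoelder _ _ j0.+1 a01) => -[//|j] jj.
case E : (act j.+1 _) => [i|]//; exfalso; apply: no; exists j; split => //.
have [r|[aj [d dc dx]]] := act_succ x0 E; first by left.
by right; exists i, d.
Qed.

(** At level j the cover takes one root and at most M j children from each cell, the extra cell
    being that of x = 1. The bound M j is required only for the children that X actually meets, so
    plateaux of larger height do no harm. *)
Lemma limsup_cells_null (X : set R) (M : nat -> nat) s :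
  0 <= s ->
  (forall x, X x -> 0 <= x <= 1 /\ forall j0, exists j, (j0 <= j)%N /\ (in_root t j x \/
    exists i d, [/\ act j (cell j x) = Some i, (d < cnt j i)%N, in_child t j i d x &
                    (cnt j i <= M j)%N])) ->
  (exists j0, forall j, (j0 <= j)%N ->
     ((2 ^ depth j + 1) * (M j + 1))%:R * len j.+1 `^ s <= 2^-1 ^+ j) ->
  hausdorff_measure s X = 0%E.
Proof.
move=> s0 Xlim Msum.
(* The number k encodes a cell c and a slot d: d < M j is a child, d = M j the root; inactive cells
   get a dummy interval at 0. *)
pose p j k := let c := (k %/ (M j + 1))%N in let d := (k %% (M j + 1))%N in
  if d == M j then root_left t j c else
  if act j c is Some i then child_left t j i c d else 0.
apply: (@limsup_cover_null _ s X (fun j => (2 ^ depth j + 1) * (M j + 1))%N p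
  (fun j => len j.+1)) => //.
- by move=> j; exact: ltW (len_gt0 _ _).
- move=> x /Xlim[/andP[x0 x1] Xx] j0; have [j [jj hj]] := Xx j0.
  have cl : (cell j x < 2 ^ depth j + 1)%N.
    rewrite addn1 ltnS -(@ler_nat R) natrX; apply: le_trans (_ : 2 ^+ depth j * x <= _).
      by rewrite truncn_le mulr_ge0.
    by rewrite ler_piMr.
  have code d : (d < M j + 1)%N -> [/\ (cell j x * (M j + 1) + d < (2 ^ depth j + 1) * (M j + 1))%N,
      ((cell j x * (M j + 1) + d) %/ (M j + 1))%N = cell j x &
      ((cell j x * (M j + 1) + d) %% (M j + 1))%N = d].
    move=> dM; have Mpos : (0 < M j + 1)%N by rewrite addn1.
    split; [|by rewrite divnMDl// divn_small// addn0|by rewrite modnMDl modn_small].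
    apply: (@leq_trans ((cell j x).+1 * (M j + 1))); last by rewrite leq_mul2r cl orbT.
    by rewrite mulSn addnC ltn_add2r.
  case: hj => [/andP[r1 r2]|[i [d [ai dc /andP[c1 c2] cM]]]].
    have [|k1 k2 k3] := code (M j); first by rewrite addn1.
    exists j, (cell j x * (M j + 1) + M j)%N; split => //.
    by rewrite /p k2 k3 eqxx r1 ltW.
  have dM : (d < M j)%N by apply: leq_trans dc cM.
  have [|k1 k2 k3] := code d; first by rewrite addn1 ltnW.
  exists j, (cell j x * (M j + 1) + d)%N; split => //.
  by rewrite /p k2 k3 (ltn_eqF dM) ai c1 ltW.
have [j0 Hj0] := Msum; exists j0 => j jj; split; last exact: Hj0.
by rewrite len_p2 -p2Nn ler_p2 lerN2 ler_nat (leq_trans (leqnSn j))// depth_ge.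
Qed.

Lemma count_len_le (n m j : nat) s : (n <= 2 ^ m)%N ->
  m%:R + j%:R <= s * (depth j.+1)%:R -> n%:R * len j.+1 `^ s <= 2^-1 ^+ j.
Proof.
move=> nm mj; rewrite len_p2 p2M; apply: (@le_trans _ _ (p2 m%:R * p2 (- (depth j.+1)%:R * s))).
  by rewrite ler_wpM2r ?p2_ge0// p2n -natrX ler_nat.
by rewrite -p2D -p2Nn ler_p2 mulNr [_ * s]mulrC; lra.
Qed.

Lemma succ_pow2_mul_le (p q : nat) : ((2 ^ p + 1) * (2 ^ q + 1) <= 2 ^ (p + q + 2))%N.
Proof.
have le n : (2 ^ n + 1 <= 2 ^ n.+1)%N by rewrite expnS mul2n -addnn leq_add2l expn_gt0.
by rewrite (_ : p + q + 2 = p.+1 + q.+1)%N ?expnD ?leq_mul//; lia.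
Qed.

(** [depth_room] bounds the number of children uniformly over all plateaux active at level j, and
    the roots and children together have length at most 2^-j. *)
Lemma irregular_null (X : set R) :
  (forall x, X x -> 0 <= x <= 1 /\
     exists2 alpha, 0 <= alpha < 1 & ~ hoelder_at H `[0, 1] alpha x) ->
  hausdorff_measure 1 X = 0%E.
Proof.
move=> HX; apply: (@limsup_cells_null _ (fun j => 2 ^ (depth j.+1 - (2 * depth j + j + 10)))%N) => //.
  move=> x /HX[x01 [alpha a01 na]]; split => // j0.
  have [j [jj hj]] := irregular_limsup x01 a01 na j0; exists j; split => //.
  case: hj => [r|[i [d [ai dc di]]]]; [by left|right; exists i, d; split => //].
  rewrite /nchildren leq_exp2l//; have := depth_room t (act_lt ai); lia.
exists 0%N => j _; apply: count_len_le (succ_pow2_mul_le _ _) _.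
have := depth_quad t j; rewrite mulSn => /(leq_trans (leq_addr _ _)) D'.
rewrite mul1r -natrD ler_nat; move: (depth j) (depth j.+1) D' => m n; lia.
Qed.

(** Only plateaux over h contribute children, about r_{j+1}^-c per cell; the number 2^(depth j) of
    cells is absorbed by r_{j+1}^(s-c). *)
Lemma exponent_level_null (X : set R) h (c s : R) : 0 < h < 1 -> 0 <= c < s ->
  (forall i, pa t i <= h <= pb t i -> pc t i <= c) ->
  (forall x, X x -> 0 <= x <= 1 /\ hoelder_level H h x) ->
  hausdorff_measure s X = 0%E.
Proof.
move=> h01 /andP[c0 cs] Hc HX.
apply: (@limsup_cells_null _ (fun j => 2 ^ (j + Num.truncn (c * (depth j.+1)%:R)))%N) => //.
- lra.
- move=> x /HX[x01 ex]; split => // j0.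
  have [j [jj hj]] := exponent_level_limsup x01 h01 ex j0; exists j; split => //.
  case: hj => [r|[i [d [ai dc di hi]]]]; [by left|right; exists i, d; split => //].
  rewrite /nchildren leq_exp2l// leq_add2l; apply: le_truncn.
  by rewrite ler_wpM2r// Hc.
exists (Num.truncn (s - c)^-1).+1 => j jj; apply: count_len_le (succ_pow2_mul_le _ _) _.
have eta0 : 0 < s - c by rewrite subr_gt0.
have j1 : 1 <= j.+1%:R * (s - c).
  rewrite -ler_pdivrMr// div1r; apply: le_trans (ltW (truncnS_gt _)) _.
  by rewrite ler_nat leqW.
have tr : (Num.truncn (c * (depth j.+1)%:R))%:R <= c * (depth j.+1)%:R.
  by rewrite truncn_le mulr_ge0.
have hh : (2 * depth j + 2 * j + 10)%:R <= (depth j.+1)%:R * (s - c).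
  apply: (@le_trans _ _ ((j.+1 * (2 * depth j + 2 * j + 10))%:R * (s - c))).
    by rewrite natrM mulrAC ler_peMl.
  by rewrite ler_wpM2r ?(ltW eta0)// ler_nat depth_quad.
move: hh; rewrite !(natrM, natrD) mulrBr [_ * c]mulrC [_ * s]mulrC.
by have := ler0n R (depth j); lra.
Qed.

End LevelSets.

(** * Lower bounds for the dimension *)

Section Branches.
Context {R : realType} (t : plateaux R).
Implicit Types (x y z u v h s : R) (i j k n : nat).

Notation depth := (depth t).
Notation len := (len t).
Notation spc := (spc t).
Notation cnt := (nchildren t).
Notation digs := (digs t).
Notation act := (act t).
Notation cell := (cell t).
Notation H := (cantor_sum t).

(* The point of the Cantor set started at the root of the k0-th cell of level j0
   whose successive children have the indices d 0, d 1, and so on. *)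
Fixpoint branch_left (j0 k0 i : nat) (d : nat -> nat) (n : nat) : R :=
  if n is n'.+1 then
    branch_left j0 k0 i d n' + len (j0.+1 + n') / 4 + (d n')%:R * spc (j0.+1 + n') i
  else root_left t j0 k0.

Definition branch j0 k0 i d : R := limn (branch_left j0 k0 i d).

Section OneBranch.
Context (j0 k0 i : nat) (gi : gen j0 = i) (d : nat -> nat).
Context (dc : forall n, (d n < cnt (j0.+1 + n) i)%N).
Notation left := (branch_left j0 k0 i d).
Notation pt := (branch j0 k0 i d).

Let ij n : (i < j0.+1 + n)%N.
Proof. by rewrite addSn ltnS -gi (leq_trans (gen_le _)) ?leq_addr. Qed.

Lemma branch_left_step n : left n <= left n.+1 /\
  left n.+1 + len (j0.+1 + n.+1) <= left n + 3 / 4 * len (j0.+1 + n).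
Proof.
have l0 := len_gt0 t (j0.+1 + n); have s0 := spc_gt0 t (j0.+1 + n) i.
have h : (d n).+1%:R * spc (j0.+1 + n) i <= len (j0.+1 + n) / 4.
  by rewrite -(cnt_spc t _ i) ler_pM2r// ler_nat.
have d0 : 0 <= (d n)%:R * spc (j0.+1 + n) i by rewrite mulr_ge0// ltW.
have ls : len (j0.+1 + n.+1) <= spc (j0.+1 + n) i / 4 by rewrite addnS len_spc.
by rewrite -(@natr1 R (d n)) mulrDl mul1r in h; split => /=; lra.
Qed.

Lemma branch_left_mono n m : (n <= m)%N ->
  left n <= left m /\ left m + len (j0.+1 + m) <= left n + len (j0.+1 + n).
Proof.
move=> /subnK <-; elim: (m - n)%N => [|e [h1 h2]]; first by rewrite add0n.
have [h3 h4] := branch_left_step (e + n); rewrite addSn.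
by have := len_gt0 t (j0.+1 + (e + n)); split; lra.
Qed.

Lemma branch_cvg : left @ \oo --> pt.
Proof.
apply: nondecreasing_is_cvgn.
  by apply/nondecreasing_seqP => n; have [] := branch_left_step n.
exists (left 0 + len (j0.+1 + 0)) => _ [m _ <-].
have [_] := branch_left_mono (leq0n m); have := len_gt0 t (j0.+1 + m); lra.
Qed.

Lemma branch_in n : left n <= pt < left n + len (j0.+1 + n).
Proof.
have below : left n <= pt.
  apply: (cvgr_to_ge branch_cvg); near=> m.
  suff : (n <= m)%N by move=> /branch_left_mono[].
  by near: m; exact: nbhs_infty_ge.
(* Passing to the limit loses strictness; it is regained one step later, because the next child ends
   within three quarters of the cell. *)
rewrite below /=; have [_ h] := branch_left_step n.
have l0 := len_gt0 t (j0.+1 + n); have l1 := len_gt0 t (j0.+1 + n.+1).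
apply: (@le_lt_trans _ _ (left n.+1 + len (j0.+1 + n.+1))); last lra.
apply: (cvgr_to_le branch_cvg); near=> m.
suff : (n.+1 <= m)%N.
  move=> /branch_left_mono[_]; have := len_gt0 t (j0.+1 + m); lra.
by near: m; exact: nbhs_infty_ge.
Unshelve. all: by end_near. Qed.

Lemma branch_act n : act (j0.+1 + n) (cell (j0.+1 + n) pt) = Some i /\
  left n = (cell (j0.+1 + n) pt)%:R * len (j0.+1 + n).
Proof.
have mult j K x y : x = K%:R * len j -> x <= y < x + len j -> x = (cell j y)%:R * len j.
  move=> -> hy; congr (_%:R * _); apply/esym/cellE.
  by rewrite -(@natr1 R K) mulrDl mul1r.
elim: n => [|n [IH1 IH2]].
  have hin := branch_in 0; rewrite addn0 in hin *; split.
    by rewrite (act_root hin) gi.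
  apply: (mult _ (k0 * 2 ^ depth_incr t j0 + root_pos t j0)%N) => //.
  by rewrite natrD natrM mulrDl -mulrA drop_len root_pos_len.
have hin := branch_in n.+1.
have leftE : left n.+1 = child_left t (j0.+1 + n) i (cell (j0.+1 + n) pt) (d n).
  by rewrite /= IH2.
rewrite addnS in hin *; split.
  by apply: (act_child IH1 (dc n)); rewrite -leftE.
apply: (mult _ (cell (j0.+1 + n) pt * 2 ^ depth_incr t (j0.+1 + n) +
   child_pos t (j0.+1 + n) i (d n))%N) => //.
by rewrite natrD natrM mulrDl -mulrA drop_len child_pos_len// leftE addrA.
Qed.

Lemma branch_child n : in_child t (j0.+1 + n) i (d n) pt.
Proof.
have [_ e] := branch_act n; have := branch_in n.+1.
by rewrite /in_child /child_left -e addnS.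
Qed.

(** The point lies in its own child, of length at most spc/4, hence at least 3/4 spc away from where
    any other child starts. Only the exponents along the branch enter the Hoelder estimate. *)
Lemma branch_near n e : `|pt - child_left t (j0.+1 + n) i (cell (j0.+1 + n) pt) e|
  < spc (j0.+1 + n) i / 2 -> e = d n.
Proof.
have := branch_child n; rewrite /in_child /child_left; set l := _ + _ / 4.
set s := spc _ _ => /andP[h1 h2]; rewrite ltr_norml => /andP[h3 h4].
have s0 : 0 < s by exact: spc_gt0.
have ls : len (j0.+1 + n).+1 <= s / 4 by exact: len_spc.
case: (ltngtP e (d n)) => // lt; exfalso; last first.
  have : (d n).+1%:R * s <= e%:R * s by rewrite ler_pM2r// ler_nat.
  by rewrite -(@natr1 R (d n)) mulrDl mul1r; lra.
have : e.+1%:R * s <= (d n)%:R * s by rewrite ler_pM2r// ler_nat.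
by rewrite -(@natr1 R e) mulrDl mul1r; lra.
Qed.

Lemma branch_01 : (k0 < 2 ^ depth j0)%N -> 0 <= pt <= 1.
Proof.
move=> k0lt; have := branch_in 0; rewrite addn0 /= /root_left => /andP[h1 h2].
have l0 := len_gt0 t j0; have k00 : 0 <= k0%:R * len j0 by rewrite mulr_ge0// ltW.
have : k0.+1%:R * len j0 <= 1.
  by rewrite -[leRHS](exp2_len t j0) ler_pM2r// -natrX ler_nat.
rewrite -(@natr1 R k0) mulrDl mul1r => h3; have := len_succ t j0.
by move=> h4; apply/andP; split; lra.
Qed.

Lemma branch_level h : 0 < h < 1 -> 0 <= pt <= 1 ->
  (forall n, `|expo t (j0.+1 + n) i (d n) - h| <= 2^-1 ^+ (j0.+1 + n)) ->
  hoelder_level H h pt.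
Proof.
move=> /andP[h0 h1] pt01 Hexp.
have small (e : R) : 0 < e -> exists n1, forall n, (n1 <= n)%N ->
    `|expo t (j0.+1 + n) i (d n) - h| <= e.
  move=> e0; have [n1 Hn1] := p2_exists_ge e^-1; exists n1 => n nn.
  apply: le_trans (Hexp n) _; rewrite -p2Nn p2N -[leRHS]invrK lef_pV2 ?posrE ?p2_gt0 ?invr_gt0//.
  by apply: le_trans Hn1 _; rewrite ler_p2 ler_nat (leq_trans nn)// leq_addl.
split => alpha /andP[a0 a1].
  have [|n1 Hn1] := small ((h - alpha) / 2); first lra.
  apply: (@cantor_sum_hoelder _ t pt alpha ((h + alpha) / 2) (j0.+1 + n1)).
  - by apply/andP; split; lra.
  - lra.
  move=> j i' e jj; have -> : j = (j0.+1 + (j - j0.+1))%N.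
    by rewrite subnKC// (leq_trans _ jj)// leq_addr.
  have [-> _] := branch_act (j - j0.+1) => -[<-] _ /branch_near ->.
  have jn : (n1 <= j - j0.+1)%N by rewrite leq_subRL// (leq_trans _ jj)// leq_addr.
  have := Hn1 _ jn; rewrite ler_norml => /andP[? ?]; lra.
have [|n1 Hn1] := small ((alpha - h) / 2); first lra.
apply: (@cantor_sum_not_hoelder _ t pt alpha ((h + alpha) / 2)) => //; [lra|lra|].
move=> J; pose n := maxn n1 J; have [ac _] := branch_act n.
exists (j0.+1 + n)%N, i, (d n); split => //.
- by rewrite (leq_trans (leq_maxr n1 J))// leq_addl.
- exact: branch_child.
- by have := Hn1 n (leq_maxl _ _); rewrite ler_norml => /andP[? ?]; lra.
Qed.

End OneBranch.

Lemma grid_digit i h : pa t i <= h <= pb t i -> forall j, exists e : nat,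
  (e < 2 ^ j)%N /\ `|pa t i + (pb t i - pa t i) * e%:R / 2 ^+ j - h| <= 2^-1 ^+ j.
Proof.
move=> /andP[ah hb] j; set a := pa t i in ah *; set b := pb t i in hb *.
have P0 : 0 < 2 ^+ j :> R by rewrite exprn_gt0.
have ba1 : b - a <= 1.
  have := pb_lt1 t i; have := pinf_le t i; have := pinf_gt0 t; rewrite -/a -/b; lra.
have hb' : 0 <= b - a by lra.
have scale (e c : R) : (b - a) * e / 2 ^+ j + (a - h) = c -> `|c| <= (2 ^+ j)^-1 ->
    `|a + (b - a) * e / 2 ^+ j - h| <= 2^-1 ^+ j.
  by move=> ec cle; rewrite exprVn (_ : _ - h = c)// -ec; ring.
(* The grid stops one mesh short of b, so h = b takes the last grid point; this also settles a = b.
   Otherwise the grid point just below h is used. *)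
have [hbe|nhb] := eqVneq h b.
  exists (2 ^ j).-1; rewrite prednK ?expn_gt0//; split => //.
  apply: (scale _ (- ((b - a) / 2 ^+ j))).
    rewrite -subn1 natrB ?expn_gt0// natrX hbe; field; by rewrite gt_eqF.
  by rewrite normrN normrM !ger0_norm ?invr_ge0 ?(ltW P0)// ler_piMl// invr_ge0 ltW.
have hb2 : h < b by rewrite lt_neqAle nhb.
have ab : 0 < b - a by lra.
pose th := (h - a) / (b - a) * 2 ^+ j.
have th0 : 0 <= th by rewrite mulr_ge0 ?(ltW P0)// divr_ge0//; lra.
have /andP[e1 e2] := truncn_itv th0; exists (Num.truncn th); split.
  rewrite -(@ltr_nat R) natrX; apply: le_lt_trans e1 _.
  by rewrite gtr_pMl// ltr_pdivrMr// mul1r; lra.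
have thE : (b - a) * th / 2 ^+ j = h - a by rewrite /th; field; rewrite !gt_eqF.
rewrite -(@natr1 R (Num.truncn th)) in e2.
apply: (scale _ (- ((b - a) * (th - (Num.truncn th)%:R) / 2 ^+ j))).
  have -> : a - h = - ((b - a) * th / 2 ^+ j) by rewrite thE; ring.
  ring.
rewrite normrN ger0_norm; last by rewrite divr_ge0 ?(ltW P0)// mulr_ge0//; lra.
rewrite ler_piMl ?invr_ge0 ?(ltW P0)//; apply: mulr_ile1 => //; lra.
Qed.

End Branches.

Section BranchFamily.
Context {R : realType} (t : plateaux R).
Implicit Types (x y z u v h s : R) (i j k n : nat).

Notation depth := (depth t).
Notation len := (len t).
Notation spc := (spc t).
Notation cnt := (nchildren t).
Notation digs := (digs t).
Notation H := (cantor_sum t).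

(** The source of homogeneity: roots of every plateau occur in every interval at arbitrarily fine
    levels. *)
Lemma root_in_interval i p q J : 0 <= p -> p < q -> q <= 1 -> exists j0 k0,
  [/\ (J <= j0)%N, gen j0 = i, (k0 < 2 ^ depth j0)%N, p <= k0%:R * len j0 &
      k0.+1%:R * len j0 <= q].
Proof.
move=> p0 pq q1; have [n Hn] := p2_exists_ge (2 / (q - p)).
have [j0 jj gj] := gen_cofinal i (maxn J n); exists j0, (Num.truncn (2 ^+ depth j0 * p)).+1.
have l0 := len_gt0 t j0; have qp : 0 < q - p by rewrite subr_gt0.
have h2 : 2 * len j0 <= q - p.
  rewrite len_p2 p2N ler_pdivrMr ?p2_gt0// mulrC -ler_pdivrMr//.
  apply: le_trans Hn _; rewrite ler_p2 ler_nat; apply: leq_trans (depth_ge t j0).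
  by apply: leq_trans jj; exact: leq_maxr.
have := cell_spec t j0 p0; rewrite /cell; set k := Num.truncn _.
rewrite -(@natr1 R k.+1) -(@natr1 R k) !mulrDl !mul1r => /andP[h3 h4].
have h5 : k%:R * len j0 + len j0 + len j0 <= q by lra.
split => //.
- by apply: leq_trans jj; exact: leq_maxl.
- rewrite -(ltr_nat R) -(ltr_pM2r l0) natrX exp2_len -(@natr1 R k) mulrDl mul1r; lra.
- exact: ltW.
Qed.

Section DigitMap.
Context (j0 k0 i : nat) (gi : gen j0 = i) (e : nat -> nat) (e_lt : forall j, (e j < 2 ^ j)%N).

Let J := j0.+1.

(** The parameter u is read in blocks of binary digits, stage l consuming digs (J + l) of them;
    [quot u n] is the integer formed by the digits used before stage n. *)
Definition wid n : nat := \sum_(0 <= l < n) digs (J + l) i.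

Definition quot u n : nat := Num.truncn (2 ^+ wid n * u).

(** The leading part is dictated by e and fixes the exponent; the trailing part is the next block of
    digits of u and is free. *)
Definition digit u n : nat :=
  e (J + n) * 2 ^ digs (J + n) i + quot u n.+1 %% 2 ^ digs (J + n) i.

Definition branch_map u : R := branch t j0 k0 i (digit u).

Lemma digit_lt u n : (digit u n < cnt (J + n) i)%N.
Proof.
rewrite /digit /nchildren expnD; apply: (@leq_trans ((e (J + n)).+1 * 2 ^ digs (J + n) i)).
  by rewrite mulSn addnC ltn_add2r ltn_mod expn_gt0.
by rewrite leq_mul2r e_lt orbT.
Qed.

Lemma digit_div u n : (digit u n %/ 2 ^ digs (J + n) i = e (J + n))%N.
Proof. by rewrite divnMDl ?expn_gt0// divn_small ?addn0// ltn_mod expn_gt0. Qed.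

Lemma quot_spec u n : 0 <= u -> (quot u n)%:R <= 2 ^+ wid n * u < (quot u n).+1%:R.
Proof. by move=> u0; apply: truncn_itv; rewrite mulr_ge0// exprn_ge0. Qed.

Lemma quot_div u n : 0 <= u -> quot u n = (quot u n.+1 %/ 2 ^ digs (J + n) i)%N.
Proof.
move=> u0; have /andP[h1 h2] := quot_spec n.+1 u0; set Q := quot u n.+1 in h1 h2 *.
have P0 : 0 < 2 ^+ digs (J + n) i :> R by rewrite exprn_gt0.
have w : 2 ^+ wid n.+1 * u = 2 ^+ wid n * u * 2 ^+ digs (J + n) i.
  by rewrite /wid big_nat_recr//= exprD mulrAC.
apply: truncn_def; rewrite -(ler_pM2r P0) -(ltr_pM2r P0) -w -natrX -!natrM.
apply/andP; split.
  by apply: le_trans h1; rewrite ler_nat leq_divM.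
by apply: lt_le_trans h2 _; rewrite ler_nat ltn_ceil// expn_gt0.
Qed.

Lemma branch_left_congr u v n : 0 <= u -> 0 <= v -> quot u n = quot v n ->
  branch_left t j0 k0 i (digit u) n = branch_left t j0 k0 i (digit v) n.
Proof.
move=> u0 v0; elim: n => //= n IH q1.
have q0 : quot u n = quot v n by rewrite (quot_div n u0) (quot_div n v0) q1.
by rewrite (IH q0) /digit q1.
Qed.

(** The last block alone suffices: it has about pc i times the next depth many digits, and (pc i -
    s) times that depth dominates the linear terms. The condition on J asks for a starting level
    deep enough for s. *)
Lemma wid_ge s n : 0 <= s < pc t i -> 1 <= (pc t i - s) * J%:R ->
  s * ((depth (J + n.+1))%:R + 3 + (J + n.+1)%:R) + n.+1%:R <= (wid n.+1)%:R.
Proof.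
move=> /andP[s0 sc] Jbig; have c1 := pc_lt1 t i; have eta0 : 0 < pc t i - s by lra.
have h1 : (digs (J + n) i)%:R <= (wid n.+1)%:R :> R.
  by rewrite ler_nat /wid big_nat_recr//= leq_addl.
have h2 := digs_gt t (J + n) i; rewrite addnS; set D := depth _ in h2 *.
have h3 : 2 * (J + n)%:R + 10 <= D%:R * (pc t i - s).
  apply: (@le_trans _ _ ((J * (2 * (J + n) + 10))%:R * (pc t i - s))).
    have -> : (J * (2 * (J + n) + 10))%:R * (pc t i - s) =
        (pc t i - s) * J%:R * (2 * (J + n)%:R + 10) by rewrite !natrM (natrD _ (2 * _)) natrM; ring.
    by rewrite ler_peMl// addr_ge0// mulr_ge0.
  rewrite ler_wpM2r ?(ltW eta0)// ler_nat; apply: leq_trans (depth_quad t (J + n)).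
  by apply: leq_mul; [rewrite leqW// leq_addr|rewrite leq_add2r leq_addl].
have h4 : s * (3 + (J + n).+1%:R) <= 3 + (J + n).+1%:R.
  have s1 : s <= 1 by rewrite ltW// (lt_trans sc).
  by apply: ler_piMl => //; exact: addr_ge0.
have h5 : n.+1%:R <= (J + n)%:R :> R by rewrite ler_nat /J addSn ltnS leq_addl.
have -> : s * (D%:R + 3 + (J + n).+1%:R) = s * D%:R + s * (3 + (J + n).+1%:R) by ring.
move: h3 h2 h4; rewrite -(@natr1 R (J + n)) mulrBr [D%:R * s]mulrC [D%:R * _]mulrC; lra.
Qed.

(** At n = 0 no digit has been used yet; the added constant covers the depth of the starting
    cell. *)
Lemma wid_gap s n : 0 <= s < pc t i -> 1 <= (pc t i - s) * J%:R ->
  s * ((depth (J + n))%:R + 3 + (J + n)%:R) <=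
  (wid n)%:R + s * ((depth J)%:R + 3 + J%:R).
Proof.
move=> sc Jbig; have s0 : 0 <= s by case/andP: sc.
case: n => [|n]; first by rewrite addn0 /wid big_nil add0r.
have := wid_ge n sc Jbig; have := ler0n R n.+1.
have : 0 <= s * ((depth J)%:R + 3 + J%:R) by rewrite mulr_ge0// !addr_ge0.
lra.
Qed.

(** Let n be the last stage at which the digits of u and v agree, and delta the difference of their
    next blocks. Then |u - v| is at most 2 delta 2^-wid(n+1), and the two points are at least delta
    spc/2 apart. Keeping delta, instead of only delta >= 1, handles the scales between spc and
    len. *)
Lemma branch_map_inverse_hoelder s : 0 <= s < pc t i -> 1 <= (pc t i - s) * J%:R ->
  exists2 C, 0 < C & forall u v, 0 <= u < 1 -> 0 <= v < 1 ->
    `|u - v| <= C * `|branch_map u - branch_map v| `^ s.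
Proof.
move=> /andP[s0 sc] Jbig; have c1 := pc_lt1 t i.
pose C := p2 (1 + s * ((depth J)%:R + 3 + J%:R)) : R.
exists C; first exact: p2_gt0.
move=> u v /andP[u0 u1] /andP[v0 v1].
have [->|uv] := eqVneq u v; first by rewrite subrr normr0 mulr_ge0 ?powR_ge0 ?p2_ge0.
have uv0 : 0 < `|u - v| by rewrite normr_gt0 subr_eq0.
have sc' : 0 <= s < pc t i by rewrite s0.
have close n : quot u n = quot v n -> `|u - v| * 2 ^+ wid n < 1.
  move=> q; have /andP[a1 a2] := quot_spec n u0; have /andP[b1 b2] := quot_spec n v0.
  rewrite -(ger0_norm (exprn_ge0 (wid n) (ler0n R 2))) -normrM mulrBl.
  rewrite q in a1 a2; move: a2 b2; rewrite -(@natr1 R (quot v n)) ![_ * 2 ^+ _]mulrC => a2 b2.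
  by rewrite ltr_norml; apply/andP; split; lra.
have ex : exists n, quot u n != quot v n.
  have [n Hn] := p2_exists_ge `|u - v|^-1; exists n.+1; apply/eqP => /close.
  apply/negP; rewrite -leNgt -ler_pdivrMl// mulr1; apply: le_trans Hn _.
  rewrite p2n ler_eXn2l ?ltr1n//; apply: (@leq_trans n.+1) => //.
  rewrite -(@ler_nat R); apply: le_trans (wid_ge n sc' Jbig).
  by rewrite lerDr mulr_ge0// !addr_ge0.
have [m mne mmin] := ex_minnP ex.
(* Stage 0 cannot separate them: u and v both have integer part 0. *)
case: m mne mmin => [|n] ne mmin.
  move: ne; rewrite /quot /wid big_nil !expr0 !mul1r.
  by rewrite !(@truncn_def _ _ 0%N) ?eqxx// ?u0 ?v0.
have eqn : quot u n = quot v n.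
  by apply/eqP; apply: contraT => /mmin; rewrite ltnn.
have left_eq := branch_left_congr u0 v0 eqn.
set S := digs (J + n) i; set a := quot u n.+1; set b := quot v n.+1.
have digE w : 0 <= w -> (digit w n)%:R = (e (J + n) * 2 ^ S)%:R +
    ((quot w n.+1)%:R - (quot w n * 2 ^ S)%:R) :> R.
  move=> w0; rewrite /digit natrD; congr (_ + _).
  by rewrite {2}(divn_eq (quot w n.+1) (2 ^ S)) -quot_div// natrD addrAC subrr add0r.
have dd : (digit u n)%:R - (digit v n)%:R = a%:R - b%:R :> R.
  by rewrite !digE// eqn -/a -/b; ring.
pose delta := `|a%:R - b%:R : R|.
have delta1 : 1 <= delta.
  rewrite /delta; case: (ltngtP a b) => ab; last by move: ne; rewrite -/a -/b ab eqxx.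
    rewrite distrC ger0_norm; last by rewrite subr_ge0 ler_nat ltnW.
    by rewrite lerBrDr addrC natr1 ler_nat.
  rewrite ger0_norm; last by rewrite subr_ge0 ler_nat ltnW.
  by rewrite lerBrDr addrC natr1 ler_nat.
have deltaN : delta <= p2 S%:R.
  have P0 : (0 < 2 ^ S)%N by rewrite expn_gt0.
  have aE := divn_eq a (2 ^ S); have bE := divn_eq b (2 ^ S).
  rewrite -quot_div// eqn in aE; rewrite -quot_div// in bE.
  have am := ltn_pmod a P0; have bm := ltn_pmod b P0.
  rewrite /delta aE bE !natrD p2n -natrX opprD addrACA subrr add0r.
  have := ler0n R (a %% 2 ^ S); have := ler0n R (b %% 2 ^ S).
  move: am bm; rewrite -!(ltr_nat R) ler_norml => ? ? ? ?; apply/andP; split; lra.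
have widS : (wid n.+1)%:R = (wid n)%:R + S%:R :> R.
  by rewrite /wid big_nat_recr//= natrD.
have upper : `|u - v| <= 2 * delta * p2 (- (wid n.+1)%:R).
  have /andP[a1 a2] := quot_spec n.+1 u0; have /andP[b1 b2] := quot_spec n.+1 v0.
  rewrite p2N ler_pdivlMr ?p2_gt0// p2n.
  rewrite -(ger0_norm (exprn_ge0 (wid n.+1) (ler0n R 2))) -normrM mulrBl.
  apply: (@le_trans _ _ (delta + 1)); last lra.
  move: a1 a2 b1 b2; rewrite -/a -/b -(@natr1 R a) -(@natr1 R b) ![_ * 2 ^+ _]mulrC.
  have : - delta <= a%:R - b%:R <= delta by rewrite -ler_norml.
  by move=> /andP[? ?] ? ? ? ?; rewrite ler_norml; apply/andP; split; lra.
have s00 := spc_gt0 t (J + n) i.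
have lower : delta * (spc (J + n) i / 2) <= `|branch_map u - branch_map v|.
  have iJ : (i < J + n)%N by rewrite /J addSn ltnS -gi (leq_trans (gen_le _)) ?leq_addr.
  have ls : len (J + n).+1 <= spc (J + n) i / 4 by exact: len_spc.
  have /andP[x1 x2] := branch_in k0 gi (digit_lt u) n.+1.
  have /andP[y1 y2] := branch_in k0 gi (digit_lt v) n.+1.
  move: x1 x2 y1 y2; rewrite /= -/J -/(branch_map u) -/(branch_map v) left_eq addnS.
  set L := branch_left _ _ _ _ _ _ + _ => x1 x2 y1 y2.
  have : `|(branch_map u - branch_map v) - (a%:R - b%:R) * spc (J + n) i| <= spc (J + n) i / 4.
    rewrite -dd mulrBl ler_norml; apply/andP; split; lra.
  have : delta * spc (J + n) i = `|(a%:R - b%:R) * spc (J + n) i|.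
    by rewrite normrM (ger0_norm (ltW s00)).
  set X := branch_map u - branch_map v; set Y := (_ - _) * _ => eY hXY.
  have : `|Y| <= `|X| + `|X - Y|.
    have := ler_normB X (X - Y); rewrite (_ : X - (X - Y) = Y)//; ring.
  have : spc (J + n) i <= delta * spc (J + n) i by rewrite ler_peMl// ltW.
  by rewrite mulrA; lra.
have delta0 : 0 <= delta by exact: normr_ge0.
apply: le_trans upper _.
have key : 2 * delta * p2 (- (wid n.+1)%:R) <= C * (delta * (spc (J + n) i / 2)) `^ s.
  have -> : spc (J + n) i / 2 = p2 (- ((depth (J + n))%:R + 3 + (J + n)%:R + S%:R)).
    rewrite spc_p2 -/S -[X in _ / X]p21 -p2N -p2D; congr p2; ring.
  rewrite powRM ?p2_ge0// p2M.
  (* As delta is at most 2^S, its power 1 - s costs at most 2^(S (1-s)); the terms in S then cancel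
     and [wid_gap] remains. *)
  have d1 : delta <= delta `^ s * p2 (S%:R * (1 - s)).
    rewrite -p2M -{1}(powRr1 delta0) -{1}(subrK s 1) addrC powRD; last first.
      by rewrite (gt_eqF (lt_le_trans ltr01 delta1)) implybT.
    rewrite ler_wpM2l ?powR_ge0//; apply: ge0_ler_powR; rewrite ?nnegrE ?p2_ge0//; lra.
  apply: (@le_trans _ _ (delta `^ s * p2 (S%:R * (1 - s)) * p2 (1 - (wid n.+1)%:R))).
    rewrite p2D p21 mulrA [_ * 2]mulrC ler_wpM2r ?p2_ge0// ler_wpM2l//.
  rewrite -mulrA [leRHS]mulrCA ler_wpM2l ?powR_ge0// /C -!p2D ler_p2 widS.
  have := wid_gap n sc' Jbig; set D := depth (J + n); lra.
apply: le_trans key _; rewrite ler_wpM2l ?p2_ge0//.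
by apply: ge0_ler_powR; rewrite ?nnegrE// mulr_ge0// divr_ge0// ltW.
Qed.

End DigitMap.

(** The root is chosen after s, deep enough for [wid_ge], and all its branches stay in [p, q].
    Non-emptiness is stated separately because pc i = 0 leaves no s to test. *)
Lemma level_measure_neq0 (X : set R) i h p q :
  0 <= p -> p < q -> q <= 1 -> pa t i <= h <= pb t i ->
  (forall x, p <= x <= q -> hoelder_level H h x -> X x) ->
  X !=set0 /\ forall s, 0 <= s < pc t i -> hausdorff_measure s X <> 0%E.
Proof.
move=> p0 pq q1 hi HX.
have h01 : 0 < h < 1.
  move: hi => /andP[ah hb]; rewrite (lt_le_trans (pinf_gt0 t)) ?(le_trans (pinf_le t i))//=.
  exact: le_lt_trans hb (pb_lt1 t i).
have [e He] := choice (grid_digit hi).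
have e_lt j : (e j < 2 ^ j)%N by have [] := He j.
have inX j0 k0 : gen j0 = i -> (k0 < 2 ^ depth j0)%N -> p <= k0%:R * len j0 ->
    k0.+1%:R * len j0 <= q -> forall u, X (branch_map j0 k0 i e u).
  move=> gj kl pk kq u; have dl := digit_lt j0 i e_lt u.
  have p01 := branch_01 gj dl kl.
  apply: HX; last first.
    apply: (branch_level gj dl h01 p01) => n; rewrite /expo digit_div.
    by have [] := He (j0.+1 + n)%N.
  have := branch_in k0 gj dl 0; rewrite addn0 /= /root_left => /andP[b1 b2].
  have l0 := len_gt0 t j0; have := len_succ t j0.
  rewrite -(@natr1 R k0) mulrDl mul1r in kq.
  by move=> h4; apply/andP; split; rewrite /branch_map; lra.
split.
  have [j0 [k0 [_ gj kl pk kq]]] := root_in_interval i 0 p0 pq q1.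
  by exists (branch_map j0 k0 i e 0); exact: inX.
move=> s /andP[s0 sc]; have eta0 : 0 < pc t i - s by rewrite subr_gt0.
have [j0 [k0 [jj gj kl pk kq]]] := root_in_interval i (Num.truncn (pc t i - s)^-1) p0 pq q1.
have Jbig : 1 <= (pc t i - s) * j0.+1%:R.
  rewrite mulrC -ler_pdivrMr// div1r; apply: le_trans (ltW (truncnS_gt _)) _.
  by rewrite ler_nat ltnS.
have [|C C0 HC] := branch_map_inverse_hoelder k0 gj e_lt _ Jbig; first by rewrite s0.
apply: (@hausdorff_measure_neq0 _ s C [set u | 0 <= u < 1] X (branch_map j0 k0 i e)) => //.
- by move=> u _; exact: inX.
- have : (lam `[0%R, 2^-1%R] <= lam [set u : R | (0 <= u < 1)%R])%E.
    apply: le_outer_measure => u; rewrite /= in_itv /= => /andP[-> uh].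
    by apply: le_lt_trans uh _; lra.
  apply: lt_le_trans; rewrite lam_itv ?invr_ge0// lte_fin; lra.
Qed.

End BranchFamily.

(** * Reduction of the prescribed spectrum to plateaux *)

Section PlateauxOfF.
Context {R : realType}.
Implicit Types (h x p q : R).

(** The factor n/(n+1) stays below 1 and tends to 1, so each cut ends before 1 while every h < 1 in
    [a, b] is eventually covered. *)
Definition cut (a b : R) (n : nat) : R := Num.min b (a + (1 - a) * (n%:R / n.+1%:R)).

Lemma frac_lt1 (n : nat) : 0 <= (n%:R / n.+1%:R : R) < 1.
Proof. by rewrite divr_ge0//= ltr_pdivrMr// mul1r ltr_nat. Qed.

Lemma cut_ge_left (a b : R) n : a <= b -> a < 1 -> a <= cut a b n.
Proof.
move=> ab a1; have /andP[f0 f1] := frac_lt1 n; rewrite /cut le_min ab lerDl.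
by rewrite mulr_ge0// subr_ge0 ltW.
Qed.

Lemma cut_lt1 (a b : R) n : a < 1 -> cut a b n < 1.
Proof.
move=> a1; have /andP[f0 f1] := frac_lt1 n; rewrite /cut gt_min; apply/orP; right.
have a0 : 0 < 1 - a by rewrite subr_gt0.
by rewrite addrC -ltrBrDr gtr_pMr.
Qed.

Lemma cut_le_right (a b : R) n : cut a b n <= b.
Proof. by rewrite ge_min lexx. Qed.

Lemma cut_ge_eventually (a b h : R) : a < 1 -> h < 1 -> h <= b ->
  exists n0, forall n, (n0 <= n)%N -> h <= cut a b n.
Proof.
move=> a1 h1 hb; exists (Num.truncn ((1 - a) / (1 - h))) => n nn.
rewrite /cut le_min hb /=.
have h10 : 0 < 1 - h by rewrite subr_gt0.
have : (1 - a) / (1 - h) <= n.+1%:R.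
  by apply: le_trans (ltW (truncnS_gt _)) _; rewrite ler_nat.
rewrite ler_pdivrMr// => H.
have -> : a + (1 - a) * (n%:R / n.+1%:R) = 1 - (1 - a) / n.+1%:R.
  by rewrite -(@natr1 R n); field; rewrite natr1 pnatr_eq0.
by rewrite lerBrDr addrC -lerBrDr ler_pdivrMr// mulrC.
Qed.

(* The countable family of plateaux: every [a n, b n] is cut strictly before 1 and
   its height lowered below the height c n, which makes all inequalities strict.
   The index 0 stands for the plateau of height 0 over [h0, 1). *)
Definition plateau_code (i : nat) : nat * nat := odflt (0, 0)%N (unpickle i).

Lemma plateau_code_surj np : exists i, plateau_code i = np.
Proof. by exists (pickle np); rewrite /plateau_code pickleK. Qed.

(** The last two clauses say that cutting and lowering lose nothing: over each h < 1 the heights of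
    the plateaux have the same supremum as the c n, up to the value 0 of the additional plateau. *)
Lemma plateaux_exist (h0 : R) (a b c : nat -> R) :
  0 < h0 < 1 -> (forall n, h0 <= a n) -> (forall n, a n <= b n) ->
  (forall n, 0 <= c n <= a n) ->
  exists t : plateaux R, [/\ pinf t = h0,
    forall h, h0 <= h < 1 -> exists i, pa t i <= h <= pb t i,
    forall n h (e : R), a n <= h <= b n -> h < 1 -> 0 < e -> exists i,
      pa t i <= h <= pb t i /\ c n - e <= pc t i &
    forall i h, pa t i <= h <= pb t i -> pc t i = 0 \/
      exists n, a n <= h <= b n /\ pc t i <= c n].
Proof.
move=> /andP[h00 h01] ha ab ca.
(* An interval with a n >= 1 prescribes nothing below 1; its codes fall back on the plateau of
   height 0. *)
pose reg i := if plateau_code i is (n.+1, _) then a n < 1 else false.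
pose A i := if reg i then a (plateau_code i).1.-1 else h0.
pose B i := if reg i then cut (a (plateau_code i).1.-1) (b (plateau_code i).1.-1) (plateau_code i).2
  else cut h0 1 (plateau_code i).2.
pose C i := if reg i then Num.max 0 (c (plateau_code i).1.-1 - (plateau_code i).2.+1%:R^-1) else 0.
have regP i : reg i -> a (plateau_code i).1.-1 < 1.
  by rewrite /reg; case: (plateau_code i) => -[].
have A0 i : h0 <= A i by rewrite /A; case: ifP.
have AB i : A i <= B i.
  rewrite /A /B; case: ifP => [/regP r|_]; apply: cut_ge_left => //; exact: ltW.
have B1 i : B i < 1 by rewrite /B; case: ifP => [/regP r|_]; exact: cut_lt1.
have C0 i : 0 <= C i by rewrite /C; case: ifP => // _; rewrite le_max lexx.
have CA i : C i < A i.
  rewrite /C /A; case: ifP => // _; rewrite gt_max (lt_le_trans h00 (ha _))/=.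
  have /andP[_ cn] := ca (plateau_code i).1.-1.
  by apply: lt_le_trans cn; rewrite gtrBl invr_gt0.
exists (Plateaux h00 A0 AB B1 C0 CA); split => //=.
- move=> h /andP[hh h1]; have [n0 Hn0] := cut_ge_eventually h01 h1 (ltW h1).
  have [i ci] := plateau_code_surj (0, n0)%N; exists i.
  by rewrite /A /B /reg ci /= hh Hn0.
- move=> n h e /andP[anh hbn] h1 e0; have an1 := le_lt_trans anh h1.
  have [n0 Hn0] := cut_ge_eventually an1 h1 hbn.
  pose m := maxn n0 (Num.truncn e^-1).
  have [i ci] := plateau_code_surj (n.+1, m)%N; exists i.
  rewrite /A /B /C /reg ci /= an1 anh Hn0 ?leq_maxl//; split => //.
  rewrite le_max; apply/orP; right; rewrite lerD2l lerN2.
  rewrite -[leRHS]invrK lef_pV2 ?posrE ?invr_gt0//.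
  apply: le_trans (ltW (truncnS_gt _)) _; rewrite ler_nat ltnS; exact: leq_maxr.
move=> i h; rewrite /A /B /C; case: ifP => r; last by left.
move=> /andP[ah hb]; have cb := le_trans hb (cut_le_right _ _ _).
have [|c0] := leP (c (plateau_code i).1.-1 - (plateau_code i).2.+1%:R^-1) 0; first by left.
right; exists (plateau_code i).1.-1; rewrite ah cb; split => //.
by rewrite gerBl invr_ge0.
Qed.

(** Replaces f by real data: f x is the supremum of the heights c n over the intervals that contain
    x. The three clauses for x say this through inequalities, so that the empty family needs no
    separate formula. *)
Lemma class_F_heights (f : R -> \bar R) : class_F f -> exists (h0 : R) (a b c : nat -> R),
  [/\ 0 < h0 <= 1,
      (forall n, h0 <= a n) /\ (forall e : R, h0 < e -> exists n, a n < e),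
      (forall n, a n <= b n) /\ (forall n, b n <= 1),
      (forall n, 0 <= c n <= a n) &
      forall x, 0 <= x <= 1 -> [/\ forall n, a n <= x <= b n -> ((c n)%:E <= f x)%E,
        (-oo < f x)%E -> exists n, a n <= x <= b n &
        forall M : R, 0 <= M -> (forall n, a n <= x <= b n -> c n <= M) -> (f x <= M%:E)%E]].
Proof.
move=> [fv [fn [a [b [fnv ab h0 fnc fsup]]]]].
pose c n := fine (fn n (a n)%:E).
have a0 n : 0 <= a n by have [] := ab n.
have ab' n : a n <= b n by have [_ []] := ab n.
have b1 n : b n <= 1 by have [_ [_ []]] := ab n.
have supp n x : 0 <= x -> (-oo < fn n x%:E)%E -> a n <= x <= b n.
  move=> x0 fx; have [_ [_ [_ sE]]] := ab n.
  have : support_on [set x | (0 <= x)%E] (fn n) x%:E by split => //; rewrite /= lee_fin.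
  by rewrite sE => -[y]; rewrite /= in_itv /= => hy [<-].
have fnval n x : a n <= x <= b n -> fn n x%:E = (c n)%:E.
  move=> hx; have [fnc1 _] := fnc n; rewrite /c.
  have hxa : x \in `[a n, b n] by rewrite in_itv.
  have haa : a n \in `[a n, b n] by rewrite in_itv /= lexx ab'.
  rewrite (fnc1 _ _ hxa haa) fineK//.
  have [_ [_ [_ sE]]] := ab n.
  have : support_on [set x | (0 <= x)%E] (fn n) (a n)%:E.
    by rewrite sE; exists (a n) => //; rewrite /= in_itv /= lexx ab'.
  move=> [_ fgt]; have [|e|/andP[f0 f1]] := fnv n (a n)%:E; first by rewrite /= lee_fin.
    by rewrite e in fgt.
  by rewrite fin_numE; apply/andP; split; [rewrite gt_eqF|rewrite lt_eqF// (le_lt_trans f1)// ltry].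
have ca n : 0 <= c n <= a n.
  have e : fn n (a n)%:E = (c n)%:E by rewrite fnval// lexx ab'.
  apply/andP; split; last first.
    rewrite -lee_fin -e; have [_ /(_ (a n))] := fnc n; apply.
    by rewrite in_itv /= lexx ab'.
  have [|e'|/andP[f0 f1]] := fnv n (a n)%:E; first by rewrite /= lee_fin.
    by rewrite e' in e.
  by rewrite -lee_fin -e.
have rng : has_inf (range a).
  by split; [exists (a 0%N), 0%N|exists 0 => _ [n _ <-]].
exists (inf (range a)), a, b, c; split => //.
- rewrite h0 /=; apply: le_trans (_ : a 0%N <= _); last exact: le_trans (ab' _) (b1 _).
  by apply: ge_inf; [case: rng|exists 0%N].
- split=> [n|e he]; first by apply: ge_inf; [case: rng|exists n].
  have e0 : 0 < e - inf (range a) by rewrite subr_gt0.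
  have [_ [n _ <-]] := inf_adherent e0 rng; rewrite addrC subrK => an.
  by exists n.
move=> x x01; have xin : x \in `[0, 1] by rewrite in_itv.
have x0 : 0 <= x by case/andP: x01.
split.
- move=> n hx; rewrite (fsup _ xin) -(fnval _ _ hx); apply: ereal_sup_ubound.
  by exists n.
- move=> fx; apply: contrapT => no; move: fx; rewrite (fsup _ xin) => /ereal_sup_gt[_ [n _ <-] h].
  by apply: no; exists n; exact: supp.
- move=> M M0 HM; rewrite (fsup _ xin); apply: ge_ereal_sup => _ [n _ <-].
  have [h|h] := boolP (a n <= x <= b n); first by rewrite fnval// lee_fin HM.
  rewrite (_ : fn n x%:E = -oo%E) ?leNye//.
  apply/eqP; rewrite -leeNy_eq leNgt; apply: contra h; exact: supp.
Qed.

(** X is any set squeezed between the level set inside [p, q] and the level set in [0,1]; it will be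
    a level set of Z in a subinterval. The bounds involve h but neither p nor q, which gives
    homogeneity. *)
Lemma monotone_part_exists (h0 : R) (a b c : nat -> R) :
  0 < h0 <= 1 -> (forall n, h0 <= a n) -> (forall n, a n <= b n) ->
  (forall n, 0 <= c n <= a n) -> exists H : R -> R,
  [/\ {in `[0, 1] &, {homo H : x y / x <= y}},
      forall x alpha, 0 <= alpha < h0 -> hoelder_at H `[0, 1] alpha x,
      hausdorff_measure 1 [set x | 0 <= x <= 1 /\
        exists2 alpha, 0 <= alpha < 1 & ~ hoelder_at H `[0, 1] alpha x] = 0%E &
      forall h (X : set R) p q, h0 <= h < 1 -> 0 <= p -> p < q -> q <= 1 ->
        (forall x, X x -> 0 <= x <= 1 /\ hoelder_level H h x) ->
        (forall x, p <= x <= q -> hoelder_level H h x -> X x) ->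
        [/\ X !=set0,
            forall M, 0 <= M -> (forall n, a n <= h <= b n -> c n <= M) ->
              (hausdorff_dim X <= M%:E)%E,
            forall n, a n <= h <= b n -> ((c n)%:E <= hausdorff_dim X)%E &
            (0 <= hausdorff_dim X)%E]].
Proof.
move=> /andP[h00 h01] ha ab ca.
(* For h0 = 1 there is no exponent below 1 to prescribe, and no plateau strictly below 1 could
   exist; the zero function serves. *)
have [h0lt1|h0ge1] := ltP h0 1; last first.
  have hz alpha x : hoelder_at (fun=> 0) `[0, 1] alpha x.
    by exists 1, 1; split => // y _ _; rewrite subrr normr0 mulr_ge0// powR_ge0.
  exists (fun=> 0); split => // [|h X p q /andP[h0h h1]]; last first.
    by have := le_lt_trans (le_trans h0ge1 h0h) h1; rewrite ltxx.
  rewrite [X in hausdorff_measure _ X](_ : _ = set0); last first.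
    by rewrite -subset0 => x [_ [alpha _]]; exact.
  by apply: (@limsup_cover_null _ 1 set0 (fun=> 0%N) (fun _ _ => 0) (fun=> 0)) => //;
    exists 0%N => j _; rewrite mul0r exprn_ge0.
have [|t [tinf tdef treg tcap]] := plateaux_exist _ ha ab ca; first by rewrite h00.
exists (cantor_sum t); split.
- by move=> x y _ _; exact: cantor_sum_mono.
- by move=> x alpha; rewrite -tinf; exact: cantor_sum_hoelder_pinf.
- by apply: (@irregular_null _ t).
move=> h X p q hh p0 pq q1 X1 X2.
have hpos : 0 < h < 1 by case/andP: hh => ? ->; rewrite (lt_le_trans h00).
have low i : pa t i <= h <= pb t i -> ((pc t i)%:E <= hausdorff_dim X)%E.
  move=> hi; have [X0 Xs] := level_measure_neq0 p0 pq q1 hi X2.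
  exact: hausdorff_dim_ge.
have [i0 hi0] := tdef _ hh.
have [X0 _] := level_measure_neq0 p0 pq q1 hi0 X2.
split => //.
- move=> M M0 HM; apply/lee_addgt0Pr => e e0; rewrite -EFinD.
  apply: hausdorff_dim_le; first by rewrite addr_ge0// ltW.
  apply: (@exponent_level_null _ t X h M) => //; first by rewrite M0 ltrDl.
  by move=> i /tcap[->//|[n [hn cn]]]; exact: le_trans cn (HM _ hn).
- move=> n hn; apply/lee_addgt0Pr => e e0; rewrite -leeBlDr// -EFinB.
  have [|i [hi ci]] := treg n h e hn _ e0; first by case/andP: hpos.
  by apply: le_trans (low _ hi); rewrite lee_fin.
- by apply: le_trans (low _ hi0); rewrite lee_fin pc_ge0.
Qed.

End PlateauxOfF.

(** * The level sets of Z and the theorem *)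

Section Assembly.
Context {R : realType}.
Implicit Types (h x p q s : R) (X U : set R).

Lemma hoelder_at_antitone H D (alpha beta x : R) : beta <= alpha ->
  hoelder_at H D alpha x -> hoelder_at H D beta x.
Proof.
move=> ba [C [e [C0 e0 He]]]; exists C, (Num.min e 1); split => //.
  by rewrite lt_min e0 ltr01.
move=> y Dy; rewrite lt_min => /andP[ye /ltW y1].
have [->|yx] := eqVneq y x; first by rewrite subrr normr0 mulr_ge0 ?powR_ge0// ltW.
apply: le_trans (He _ Dy ye) _; rewrite ler_wpM2l ?(ltW C0)//.
by apply: powR_antitone; rewrite ?subr_eq0.
Qed.

(** About 2^m intervals of length 2^-m have total gauge 2^-(m (s-1)); m = K (j+1) with K >= 1/(s-1)
    makes this summable over j. *)
Lemma unit_interval_null X s : 1 < s -> (forall x, X x -> 0 <= x <= 1) ->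
  hausdorff_measure s X = 0%E.
Proof.
move=> s1 HX; have s10 : 0 < s - 1 by rewrite subr_gt0.
pose K := (Num.truncn (s - 1)^-1).+1.
have K1 : 1 <= (s - 1) * K%:R.
  by rewrite mulrC -ler_pdivrMr// div1r; exact: ltW (truncnS_gt _).
pose m j := (K * j.+1)%N.
apply: (@limsup_cover_null _ s X (fun j => 2 ^ m j + 1)%N (fun j k => k%:R * 2^-1 ^+ m j)
  (fun j => 2^-1 ^+ m j)) => //.
- move=> x /HX/andP[x0 x1] j0; exists j0, (Num.truncn (2 ^+ m j0 * x)).
  have P0 : 0 < 2^-1 ^+ m j0 :> R by rewrite exprn_gt0.
  have PP : 2 ^+ m j0 * 2^-1 ^+ m j0 = 1 :> R by rewrite -exprMn divff// expr1n.
  have u0 : 0 <= 2 ^+ m j0 * x by rewrite mulr_ge0.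
  have /andP[t1 t2] := truncn_cell u0; split => //.
    rewrite addn1 ltnS -(@ler_nat R) natrX; apply: le_trans t1 _.
    by rewrite ler_piMr.
  have xE : x = 2 ^+ m j0 * x * 2^-1 ^+ m j0 by rewrite mulrAC PP mul1r.
  have -> : (Num.truncn (2 ^+ m j0 * x))%:R * 2^-1 ^+ m j0 + 2^-1 ^+ m j0 =
      (Num.truncn (2 ^+ m j0 * x)).+1%:R * 2^-1 ^+ m j0 :> R.
    by rewrite -[in RHS]natr1 mulrDl mul1r.
  by rewrite [X in _ <= X <= _]xE !ler_pM2r// t1 t2.
- exists 0%N => j _; rewrite -!p2Nn p2M; split.
    by rewrite ler_p2 lerN2 ler_nat /m mulSn (leq_trans (leqnSn j))// leq_addr.
  apply: (@le_trans _ _ (p2 (m j).+1%:R * p2 (- (m j)%:R * s))).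
    rewrite ler_wpM2r ?p2_ge0// p2n -natrX ler_nat.
    by rewrite expnS mul2n -addnn leq_add2l expn_gt0.
  rewrite -p2D ler_p2 -(@natr1 R (m j)) /m natrM -(@natr1 R j).
  have j0 : 0 <= j%:R + 1 :> R by rewrite addr_ge0.
  have : j%:R + 1 <= (s - 1) * K%:R * (j%:R + 1) by rewrite ler_peMl.
  rewrite !mulrBl mul1r -mulrA; set Y := K%:R * _.
  by rewrite [s * _]mulrC mulNr; lra.
- lra.
Qed.

(** The identity serves as parametrisation for every s < 1, since |u - v| <= |u - v|^s on the unit
    interval. *)
Lemma full_measure_dim X p q : 0 <= p -> p < q -> q <= 1 -> (forall x, X x -> 0 <= x <= 1) ->
  lam [set x | p <= x <= q /\ ~ X x] = 0%E -> hausdorff_dim X = 1%E.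
Proof.
move=> p0 pq q1 HX; set Y := mkset _ => null; pose D := [set x | p <= x <= q /\ X x].
have Dpos : (0 < lam D)%E.
  have : (lam `[p, q] <= lam D + lam Y)%E.
    apply: le_trans (outer_measureU2 _ _ _); apply: le_outer_measure => x.
    rewrite /= in_itv /= => hx; have [Xx|nX] := pselect (X x); by [left|right].
  rewrite null adde0; apply: lt_le_trans; rewrite lam_itv ?(ltW pq)//.
  by rewrite lte_fin subr_gt0.
apply/le_anti/andP; split.
  apply/lee_addgt0Pr => e e0; rewrite -EFinD; apply: hausdorff_dim_le; first lra.
  by apply: unit_interval_null => //; rewrite ltrDl.
apply: hausdorff_dim_ge.
  have [D0|/set0P[x [_ Xx]]] := eqVneq D set0; last by exists x.
  by move: Dpos; rewrite D0 outer_measure0 ltxx.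
move=> s /andP[s0 s1]; apply: (@hausdorff_measure_neq0 _ s 1 D X id) => //.
  by move=> u [].
move=> u v [/andP[pu uq] _] [/andP[pv vq] _]; rewrite mul1r.
have [->|uv] := eqVneq u v; first by rewrite subrr normr0 powR_ge0.
apply: ger1_powR; last exact: ltW.
by rewrite normr_gt0 subr_eq0 uv/= ler_norml; apply/andP; split; lra.
Qed.

Lemma support_star_itv (f : R -> \bar R) (h0 : R) (a : nat -> R) :
  0 <= h0 <= 1 ->
  (forall x, 0 <= x <= 1 -> (-oo < f x)%E -> h0 <= x) ->
  (forall e, h0 < e -> exists x, [/\ 0 <= x <= 1, (-oo < f x)%E & x < e]) ->
  forall h, support_star f h <-> h0 <= h <= 1.
Proof.
move=> h01 fge fex h; split.
  move=> /(_ `[h0, 1]%classic); rewrite /= in_itv /=; apply; split; first by exists h0.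
  move=> x [/=]; rewrite !in_itv /= => x01 fx; have /andP[_ x1] := x01.
  by rewrite (fge _ x01 fx).
move=> /andP[h0h h1] A [[g g01 ->] sub]; rewrite /= in_itv /= h1 andbT.
rewrite leNgt; apply/negP => hg; have [x [x01 fx xg]] := fex g (le_lt_trans h0h hg).
have := sub x; rewrite /support_on /= !in_itv /= => /(_ (conj x01 fx)) /andP[gx _].
by move: xg; rewrite ltNge gx.
Qed.

End Assembly.

Unset Implicit Arguments.

Theorem theorem1p14 (R : realType) (f : R -> \bar R) (hf : class_F f) :
  exists Z : R -> R,
    [/\ homogeneously_multifractal Z,
        {in `[0, 1] &, {homo Z : x y / x < y}}
      & {within `[0, 1], continuous Z}] /\
    [/\ forall h, (support_star f `\ 1) h ->
          spectrum Z h = maxe (f h) 0%E,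
        forall h, 0 <= h -> ~ support_star f h -> spectrum Z h = -oo%E
      & lebesgue_measurable (iso_holder Z `[0, 1] 1) /\
        completed_lebesgue_measure (iso_holder Z `[0, 1] 1) = 1%E].
Proof.
have [h0 [a [b [c [h01 [ha hinf] [ab b1] ca Hf]]]]] := class_F_heights hf.
have [H [Hmono Hlow Hnull Hdim]] := monotone_part_exists h01 ha ab ca.
have /andP[h00 h0le1] := h01.
have [|Z [Zmono Zcont Zexp]] := exponent_truncation Hmono.
  by move=> x _; exists (h0 / 2); [lra|apply: Hlow; apply/andP; split; lra].
pose e x := holder_exponent `[0%R, 1%R] Z x.
have e_le1 x : 0 <= x <= 1 -> (e x <= 1)%E by move=> /Zexp[].
have e_ge x : 0 <= x <= 1 -> (h0%:E <= e x)%E.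
  move=> /Zexp[_ + _]; apply; first by rewrite h00.
  by move=> alpha /andP[a0 ah]; apply: Hlow; rewrite (ltW a0).
have e_level h x : 0 <= x <= 1 -> 0 < h < 1 -> (e x = h%:E <-> hoelder_level H h x).
  move=> x01 /andP[hp h1]; have [z1 z2 z3] := Zexp x x01; split.
    move=> ex; split => alpha /andP[a1 a2].
      apply: z3; first by apply/andP; split => //; lra.
      by rewrite -/(e x) ex lte_fin.
    move=> hol; have : (alpha%:E <= e x)%E.
      apply: z2; first by apply/andP; split; lra.
      by move=> beta /andP[_ ba]; apply: hoelder_at_antitone hol; exact: ltW.
    by rewrite ex lee_fin leNgt a1.
  move=> [l1 l2]; apply/le_anti/andP; split; last by apply: z2 => //; rewrite hp ltW.
  rewrite leNgt; apply/negP => he.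
  have := e_le1 x x01; case ex : (e x) he => [r| |]; rewrite ?lte_fin ?lee_fin// => hr r1.
  apply: (l2 ((h + r) / 2)); first by apply/andP; split; lra.
  apply: z3; first by apply/andP; split; lra.
  by rewrite -/(e x) ex lte_fin; lra.
have e_one x : 0 <= x <= 1 -> (e x = 1%E <-> forall alpha, 0 <= alpha < 1 ->
    hoelder_at H `[0, 1] alpha x).
  move=> x01; have [z1 z2 z3] := Zexp x x01; split.
    move=> ex alpha /andP[a0 a1].
    apply: (@hoelder_at_antitone _ H _ ((alpha + 1) / 2)); first lra.
    apply: z3; first by apply/andP; split; lra.
    by rewrite -/(e x) ex lte_fin; lra.
  move=> hol; apply/le_anti/andP; split => //.
  by apply: z2 => [|alpha /andP[a0 a1]]; rewrite ?ltr01 ?lexx//; apply: hol; rewrite ltW.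
have star : forall h, support_star f h <-> h0 <= h <= 1.
  apply: support_star_itv => //; first by rewrite (ltW h00).
    move=> x x01 fx; have [_ /(_ fx)[n /andP[ax _]] _] := Hf x x01.
    exact: le_trans (ha n) ax.
  move=> g hg; have [n an] := hinf g hg; exists (a n).
  have an01 : 0 <= a n <= 1.
    by rewrite (le_trans (ltW h00) (ha n)) (le_trans (ab n) (b1 n)).
  split => //; have [/(_ n) cf _ _] := Hf _ an01.
  by apply: lt_le_trans (cf _); rewrite ?ltNyr// lexx ab.
(* The spectrum is computed at once for every subinterval U, with values that do not depend on U;
   the spectrum of Z is the case of [0,1] and homogeneity is the comparison of the two. *)
have specU (U : set R) : is_interval U -> U `<=` `[0, 1] ->
    (exists x y, [/\ U x, U y & x < y]) ->
    [/\ forall h, h0 <= h < 1 -> hausdorff_dim (iso_holder Z U h) = maxe (f h) 0%E,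
        hausdorff_dim (iso_holder Z U 1) = 1%E &
        forall h, ~ (h0 <= h <= 1) -> hausdorff_dim (iso_holder Z U h) = -oo%E].
  move=> Uitv U01 [p [q [Up Uq pq]]].
  have Ux01 x : U x -> 0 <= x <= 1 by move=> /U01; rewrite /= in_itv.
  have /andP[p0 _] := Ux01 p Up; have /andP[_ q1] := Ux01 q Uq.
  have Upq x : p <= x <= q -> U x by exact: Uitv.
  split.
  - move=> h hh; have /andP[h0h h1] := hh.
    have hp : 0 < h < 1 by rewrite (lt_le_trans h00 h0h).
    have h01' : 0 <= h <= 1 by rewrite (le_trans (ltW h00) h0h) ltW.
    have [|x hx hl|Xne Xle Xge X0] := Hdim h (iso_holder Z U h) p q hh p0 pq q1.
    + by move=> x [Ux ex]; split; [exact: Ux01|apply/e_level => //; exact: Ux01].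
    + by split; [exact: Upq|apply/e_level => //; exact/Ux01/Upq].
    have [f1 f2 f3] := Hf h h01'.
    (* Finiteness allows the dimension itself to be the real bound M in the characterisation of f
       h. *)
    have dim_fin : hausdorff_dim (iso_holder Z U h) \is a fin_num.
      rewrite fin_numE; apply/andP; split; first by rewrite gt_eqF// (lt_le_trans _ X0)// ltNyr.
      rewrite lt_eqF//; apply: le_lt_trans (Xle 1 _ _) (ltry _) => //.
      by move=> n _; have /andP[_ /le_trans] := ca n; apply; exact: le_trans (ab n) (b1 n).
    apply/le_anti/andP; split; last first.
      rewrite ge_max X0 andbT -(fineK dim_fin); apply: f3.
        by rewrite -lee_fin fineK.
      by move=> n hn; rewrite -lee_fin fineK// Xge.
    case fh : (f h) => [r| |]; last 2 first.
    + by rewrite maxye leey.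
    + rewrite maxNye; apply: Xle => // n hn.
      by have := f1 n hn; rewrite fh.
    rewrite -EFin_max; apply: Xle; first by rewrite le_max lexx orbT.
    by move=> n hn; have := f1 n hn; rewrite fh lee_fin le_max => ->.
  - apply: (full_measure_dim p0 pq q1); first by move=> x [Ux _]; exact: Ux01.
    apply/eqP; rewrite eq_le outer_measure_ge0 andbT.
    rewrite -(hausdorff_measure1_lam0 Hnull); apply: le_outer_measure => x [hx nX].
    have x01 := Ux01 _ (Upq _ hx); split => //.
    apply: contrapT => no; apply: nX; split; first exact: Upq.
    apply/e_one => // alpha al; apply: contrapT => nh; apply: no.
    by exists alpha.
  - move=> h nh; rewrite (_ : iso_holder Z U h = set0).
      by rewrite /hausdorff_dim eqxx.
    rewrite -subset0 => x [Ux ex]; apply: nh; have x01 := Ux01 x Ux.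
    by have := e_ge x x01; have := e_le1 x x01; rewrite /e ex !lee_fin => -> ->.
have [spec spec1 spec0] : [/\ forall h, h0 <= h < 1 -> spectrum Z h = maxe (f h) 0%E,
    spectrum Z 1 = 1%E & forall h, ~ (h0 <= h <= 1) -> spectrum Z h = -oo%E].
  apply: specU => //; first exact: interval_is_interval.
  by exists 0, 1; rewrite /= !in_itv /= !lexx ler01 ltr01.
exists Z; split; split => //.
- move=> U Uitv U01 Une h _; have [u1 u2 u3] := specU U Uitv U01 Une.
  have [hh|nh] := pselect (h0 <= h <= 1); last by rewrite u3// spec0.
  have [->|hn1] := eqVneq h 1; first by rewrite u2 spec1.
  have /andP[hh1 hh2] := hh; have hlt : h0 <= h < 1 by rewrite hh1 lt_neqAle hn1.
  by rewrite u1// spec.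
- move=> h [/star /andP[hh1 hh2] /eqP hn1]; apply: spec.
  by rewrite hh1 lt_neqAle hn1.
- by move=> h _ nh; apply: spec0 => hh; apply/nh/star.
set N := [set x | _] in Hnull; have N0 := hausdorff_measure1_lam0 Hnull.
have isoE : iso_holder Z `[0, 1] 1 = `[0, 1]%classic `\` N.
  apply/seteqP; split => x; rewrite /iso_holder /N /= in_itv /=.
    move=> [x01 ex]; split => // -[_ [alpha al nh]].
    by apply: nh; exact: (iffLR (e_one x x01)).
  move=> [x01 nN]; split => //; apply/(e_one x x01) => alpha al.
  by apply: contrapT => nh; apply: nN; split => //; exists alpha.
(* An outer null set meets the Caratheodory condition because its trace on any set has outer measure
   0. *)
have mN : (lam).-cara.-measurable N.
  apply: le_caratheodory_measurable => Y.
  have YN0 : lam (Y `&` N) = 0%E.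
    by apply/eqP; rewrite eq_le outer_measure_ge0 andbT -N0 le_outer_measure.
  by rewrite [X in (X + _ <= _)%E]YN0 add0e le_outer_measure.
have lam01 : lam `[0, 1] = 1%E :> \bar R by rewrite lam_itv// subr0.
rewrite isoE; split.
  apply: caratheodory_measurable_setD => //.
  by apply: sub_caratheodory; exact: measurable_itv.
apply/le_anti/andP; split.
  rewrite -lam01; apply: (le_outer_measure lam); exact: subDsetl.
apply: (@le_trans _ _ (lam (`[0%R, 1%R] `\` N) + lam N)%E); last by rewrite N0 adde0.
rewrite -lam01; apply: le_trans (outer_measureU2 _ _ _); apply: le_outer_measure => x x01.
by have [Nx|nN] := pselect (N x); [right|left].
Qed.
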